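(* Let $\psi\in C^0([0,1])$ satisfy $\psi(0)<0$, $\psi(1)<0$ and $\psi(x_0)>0$ for some $x_0\in(0,1)$. Assume that $$\inf_{v\in\mathcal N(\psi)}W(v)<c_0^2 .$$ Then there exists $u\in\mathcal N(\psi)$ such that $$W(u)=\inf_{v\in\mathcal N(\psi)}W(v).$$ Moreover, $u\in C^2([0,1])$, $u''$ is weakly differentiable and $u'''\in BV(0,1)$.
   Context: For $v\in H^2(0,1)$ the elastica functional is $$W(v)=\int_0^1\frac{v''(x)^2}{(1+v'(x)^2)^{5/2}}\,dx .$$ The admissible set (no symmetry required) is $$\mathcal N(\psi)=\{v\in H^2_0(0,1)\mid v(x)\ge\psi(x)\ \text{for all }x\in[0,1]\},$$ where $H^2_0(0,1)$ is the set of $v\in H^2(0,1)$ with $v(0)=v(1)=0$ and $v'(0)=v'(1)=0$. The constant $c_0$ is $$c_0=\int_{\mathbb R}\frac{d\tau}{(1+\tau^2)^{5/4}}=\sqrt\pi\,\frac{\Gamma(3/4)}{\Gamma(5/4)}.$$ $BV(0,1)$ denotes the functions of bounded variation on $(0,1)$. *)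

(* Defs.v *)
From HB Require Import structures.
From mathcomp Require Import all_boot all_order all_algebra.
From mathcomp Require Import all_classical all_reals all_analysis.

Set Implicit Arguments.
Unset Strict Implicit.
Unset Printing Implicit Defensive.

Import Order.TTheory GRing.Theory Num.Theory.
Import numFieldNormedType.Exports.

Local Open Scope classical_set_scope.
Local Open Scope ring_scope.

(* Functions on (0,1) or [0,1] are represented by total functions R -> R; no
   definition below depends on the values taken outside the interval. *)

(* C_c^oo(0,1): the closed support lies in (0,1), hence is compact. *)
Definition test_function (R : realType) (phi : R -> R) : Prop :=
  (forall (n : nat) (x : R), derivable (derive1n n phi) x 1) /\
  closure [set x | phi x != 0] `<=` `]0, 1[.

Definition weak_derivative (R : realType) (f g : R -> R) : Prop :=
  [/\ locally_integrable `]0, 1[ f,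
      locally_integrable `]0, 1[ g &
      forall phi : R -> R, test_function phi ->
        \int[lebesgue_measure]_(x in `]0, 1[) (f x * derive1 phi x) =
        - \int[lebesgue_measure]_(x in `]0, 1[) (g x * phi x)].

Definition weakly_differentiable (R : realType) (f : R -> R) : Prop :=
  exists g : R -> R, weak_derivative f g.

(* A weak derivative of f, chosen arbitrarily among those that exist; they all
   agree almost everywhere on (0,1). *)
Definition wderiv (R : realType) (f : R -> R) : R -> R :=
  xget (cst 0) [set g | weak_derivative f g].

Definition L2 (R : realType) (f : R -> R) : Prop :=
  f \_ `]0, 1[ \in Lfun (@lebesgue_measure R) 2%:E.

(* H^2(0,1), each class being represented by its member continuous on [0,1], so
   that pointwise conditions make sense. *)
Definition H2 (R : realType) (v : R -> R) : Prop :=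
  [/\ {within `[0, 1], continuous v},
      weakly_differentiable v,
      weakly_differentiable (wderiv v) &
      [/\ L2 v, L2 (wderiv v) & L2 (wderiv (wderiv v))]].

(* The boundary conditions on v' concern its continuous representative v1. *)
Definition H20 (R : realType) (v : R -> R) : Prop :=
  [/\ H2 v, v 0 = 0, v 1 = 0 &
      exists v1 : R -> R,
        [/\ {within `[0, 1], continuous v1}, weak_derivative v v1,
            v1 0 = 0 & v1 1 = 0]].

Definition elastica (R : realType) (v : R -> R) : \bar R :=
  (\int[lebesgue_measure]_(x in `]0%R, 1%R[)
     ((wderiv (wderiv v) x ^+ 2) /
      ((1 + wderiv v x ^+ 2) `^ (5 / 2)))%:E)%E.

Definition admissible (R : realType) (psi : R -> R) : set (R -> R) :=
  [set v | H20 v /\ forall x : R, x \in `[0, 1] -> psi x <= v x].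

Definition inf_elastica (R : realType) (psi : R -> R) : \bar R :=
  ereal_inf [set elastica v | v in admissible psi].

Definition c0 (R : realType) : R :=
  \int[lebesgue_measure]_(tau in [set: R])
    ((1 + tau ^+ 2) `^ (5 / 4))^-1.

(* C^k([0,1]): the derivatives up to order k exist in (0,1) and extend
   continuously to [0,1]. *)
Fixpoint Ck (R : realType) (k : nat) (f : R -> R) : Prop :=
  {within `[0, 1], continuous f} /\
  match k with
  | 0%N => True
  | j.+1 => exists2 g : R -> R,
      (forall x : R, x \in `]0, 1[ -> is_derive x 1 f (g x)) & Ck j g
  end.

(* BV(0,1), for functions defined up to null sets: some representative has
   bounded pointwise variation on the open interval. *)
Definition BV01 (R : realType) (f : R -> R) : Prop :=
  exists g : R -> R,
    {ae @lebesgue_measure R, forall x : R, x \in `]0, 1[ -> f x = g x} /\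
    exists M : R, forall a b : R, 0 < a -> a <= b -> b < 1 ->
      (total_variation a b g <= M%:E)%E.

(* Main.v *)
Require Import Defs.
From HB Require Import structures.
From mathcomp Require Import all_boot all_order all_algebra.
From mathcomp Require Import all_classical all_reals all_analysis.
From mathcomp Require Import measurable_realfun ring lra.

Import Order.TTheory GRing.Theory Num.Theory.
Import numFieldNormedType.Exports.

Local Open Scope classical_set_scope.
Local Open Scope ring_scope.

(* Let G be the primitive of (1 + s^2)^(-5/4) with G(0) = 0; its total variation over the line is
   c0. For v in H^2_0, Cauchy-Schwarz gives (2 G(v'))^2 <= W(v), since v' vanishes at both ends.
   Hence W < c0^2 bounds v' along a minimizing sequence, W becomes the squared L^2 norm of (G(v'))',
   and a limit along an ultrafilter is a minimizer.

For the regularity, let u be a minimizer, p = u', h(s) = (1 + s^2)^(-5/2), B = (u'')^2 h'(p) and D =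
   2 u'' h(p) - int_0^x B. The variational inequality, which is an equality near the ends where the
   obstacle is inactive, says that D is almost everywhere convex, and affine near 0 and near 1. So D
   is almost everywhere the primitive of a nondecreasing bounded function m; solving for u''
   expresses it through absolutely continuous functions, and one more differentiation expresses u'''
   by sums and products of m and Lipschitz functions. *)

(** * Absolutely continuous functions on [0, 1] *)

Section integral01.
Context {R : realType}.
Local Notation mu := (@lebesgue_measure R).
Implicit Types (f g F G : R -> R) (x y z : R).

(** The difficulty for existence is the decay of the weight [(1 + s^2)^(-5/2)]: steep slopes cost
    little, and W alone does not control v'. As G takes its values strictly between [- c0 / 2] and
    [c0 / 2], a bound on [2 |G(v')|] bounds v' only if it is strictly smaller than c0. On bounded
    slopes G is bi-Lipschitz, so that estimates pass back and forth between v' and G(v'). The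
    difficulty for regularity is that the variational inequality only makes D'' a nonnegative
    distribution, while D is known almost everywhere. No measure is constructed: the test functions
    have piecewise constant second derivatives, so the inequality speaks of averages of D over short
    intervals, and at density points these averages become values. The slope m stands for the
    distribution function of the measure D''. Convexity on the open interval alone would allow m to
    blow up at the ends; the inactive obstacle excludes this. B is at first merely integrable. It
    becomes bounded only after u'' has been identified with a continuous function, and this second
    pass gives the Lipschitz bounds. *)

Definition int01 f : Prop := mu.-integrable `[0, 1] (EFin \o f).

Lemma int01S {f x y} : int01 f -> 0 <= x -> y <= 1 ->
  mu.-integrable `[x, y] (EFin \o f).
Proof.
move=> fi x0 y1; apply: integrableS fi => //; apply: subset_itv; rewrite bnd_simp//.
Qed.

Lemma int01_measurable {f} : int01 f -> measurable_fun (`[0, 1] : set R) f.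
Proof. by move=> /integrableP[/measurable_EFinP]. Qed.

Lemma int01D {f g} : int01 f -> int01 g -> int01 (fun x => f x + g x).
Proof. by move=> fi gi; apply: eq_integrable (integrableD _ fi gi). Qed.

Lemma int01Z {f} k : int01 f -> int01 (fun x => k * f x).
Proof. by move=> fi; apply: eq_integrable (integrableZl _ k fi). Qed.

Lemma int01B {f g} : int01 f -> int01 g -> int01 (fun x => f x - g x).
Proof. by move=> fi gi; apply: eq_integrable (integrableB _ fi gi). Qed.

Lemma int01_norm {f} : int01 f -> int01 (fun x => `|f x|).
Proof. exact: integrable_norm. Qed.

Lemma eq_int01 {f} g : (forall x, 0 <= x -> x <= 1 -> f x = g x) -> int01 f -> int01 g.
Proof.
move=> fg; apply: eq_integrable => // x; rewrite inE/= in_itv/= => /andP[x0 x1].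
by rewrite fg.
Qed.

Definition bounded01 f := exists M : R, forall x, 0 <= x -> x <= 1 -> `|f x| <= M.

Lemma bounded01_near f M : (forall x, 0 <= x -> x <= 1 -> `|f x| <= M) ->
  [bounded f x | x in `[0, 1]].
Proof.
move=> fM; rewrite /bounded_near; near=> N => x /=.
by rewrite in_itv/= => /andP[x0 x1]; rewrite (le_trans (fM _ x0 x1)).
Unshelve. all: by end_near. Qed.

Lemma int01_bounded {f} : measurable_fun (`[0, 1] : set R) f -> bounded01 f -> int01 f.
Proof.
move=> mf [M fM]; apply: measurable_bounded_integrable => //.
  by rewrite /= lebesgue_measure_itv/= lte_fin ltr01 sube0 ltry.
exact: bounded01_near fM.
Qed.

Lemma int01M {f g} : int01 f -> measurable_fun (`[0, 1] : set R) g -> bounded01 g ->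
  int01 (fun x => f x * g x).
Proof.
move=> fi mg [M gM].
apply: (@integrableMl _ _ _ mu _ _ (EFin \o f) g fi mg).
  by [].
exact: bounded01_near gM.
Qed.

Definition bddmeas f := measurable_fun (`[0, 1] : set R) f /\ bounded01 f.

Lemma bddmeas_int01 f : bddmeas f -> int01 f.
Proof. by case; exact: int01_bounded. Qed.

Lemma bddmeasM f g : bddmeas f -> bddmeas g -> bddmeas (fun x => f x * g x).
Proof.
move=> [mf [M fM]] [mg [N gN]]; split; first exact: measurable_funM.
by exists (M * N) => x x0 x1; rewrite normrM ler_pM// ?fM ?gN.
Qed.

Lemma bddmeasD f g : bddmeas f -> bddmeas g -> bddmeas (fun x => f x + g x).
Proof.
move=> [mf [M fM]] [mg [N gN]]; split; first exact: measurable_funD.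
by exists (M + N) => x x0 x1; rewrite (le_trans (ler_normD _ _))// lerD ?fM ?gN.
Qed.

Lemma bddmeas_cst k : bddmeas (fun=> k).
Proof. by split=> //; exists `|k|. Qed.

Lemma bddmeas_norm f : bddmeas f -> bddmeas (fun x => `|f x|).
Proof.
move=> [mf [M fM]]; split; first exact: measurableT_comp.
by exists M => x x0 x1; rewrite normr_id fM.
Qed.

Lemma int01_cst k : int01 (cst k).
Proof. apply: int01_bounded => //; by exists `|k|. Qed.

Lemma int01_le {f g} : measurable_fun (`[0, 1] : set R) f ->
  (forall x, 0 <= x -> x <= 1 -> `|f x| <= g x) -> int01 g -> int01 f.
Proof.
move=> mf fg; apply: le_integrable => //; first exact/measurable_EFinP.
move=> x/=; rewrite in_itv/= => /andP[x0 x1]; rewrite lee_fin.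
by rewrite (le_trans (fg _ x0 x1))// ler_norm.
Qed.

(** Not oriented: for [y < x] the interval is empty and the value is 0. *)
Definition Rint x y f : R := \int[mu]_(t in `[x, y]) f t.

Lemma Rint_xx x f : Rint x x f = 0.
Proof. by rewrite /Rint set_itv1 Rintegral_set1. Qed.

Lemma Rint_cat f x y z : int01 f -> 0 <= x -> x <= z -> z <= y -> y <= 1 ->
  Rint x y f = Rint x z f + Rint z y f.
Proof.
move=> fi x0 xz zy y1; rewrite /Rint.
have := @Rintegral_itvB _ f (BLeft x) (BRight y) z (int01S fi x0 y1).
rewrite !bnd_simp => /(_ xz zy) /eqP; rewrite subr_eq addrC => /eqP ->.
by rewrite Rintegral_itv_obnd_cbnd//; apply: integrableS (int01S fi x0 y1) => //;
  apply: subset_itv; rewrite bnd_simp.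
Qed.

Lemma eq_Rint f g x y : (forall t, x <= t -> t <= y -> f t = g t) ->
  Rint x y f = Rint x y g.
Proof.
by move=> fg; apply: eq_Rintegral => t; rewrite inE/= in_itv/= => /andP[/fg h /h].
Qed.

Section linear.
Variables (f g : R -> R) (x y : R).
Hypotheses (fi : int01 f) (gi : int01 g) (x0 : 0 <= x) (y1 : y <= 1).
Let fxy := int01S fi x0 y1.
Let gxy := int01S gi x0 y1.

Lemma RintD : Rint x y (fun t => f t + g t) = Rint x y f + Rint x y g.
Proof. exact: RintegralD. Qed.

Lemma RintB : Rint x y (fun t => f t - g t) = Rint x y f - Rint x y g.
Proof. exact: RintegralB. Qed.

Lemma RintZ k : Rint x y (fun t => k * f t) = k * Rint x y f.
Proof. exact: RintegralZl. Qed.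

Lemma le_Rint : (forall t, x <= t -> t <= y -> f t <= g t) -> Rint x y f <= Rint x y g.
Proof.
by move=> fg; apply: le_Rintegral => // t; rewrite /= in_itv/= => /andP[/fg h /h].
Qed.

Lemma normr_Rint : `|Rint x y f| <= Rint x y (fun t => `|f t|).
Proof. exact: le_normr_Rintegral. Qed.
End linear.

Lemma Rint_ge0 f x y : (forall t, x <= t -> t <= y -> 0 <= f t) -> 0 <= Rint x y f.
Proof.
by move=> f0; apply: Rintegral_ge0 => t; rewrite /= in_itv/= => /andP[/f0 h /h].
Qed.

Lemma Rint_cst k x y : x <= y -> Rint x y (cst k) = k * (y - x).
Proof.
move=> xy; rewrite /Rint Rintegral_cst//= lebesgue_measure_itv/= lte_fin.
have [_|yx] := ltP x y; first by rewrite -EFinD.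
have -> : x = y by apply/le_anti; rewrite xy.
by rewrite subrr.
Qed.

(** With [c] the integral of [|f|] and [I] that of [f^2], integrating the square of
    [(y - x) |f| - c] gives [(y - x) ((y - x) I - c^2) >= 0]. *)
Lemma Rint_cauchy_schwarz f x y : int01 f -> int01 (fun t => f t ^+ 2) ->
  0 <= x -> x <= y -> y <= 1 ->
  Rint x y (fun t => `|f t|) ^+ 2 <= (y - x) * Rint x y (fun t => f t ^+ 2).
Proof.
move=> fi f2i x0 xy y1; move: (xy); rewrite le_eqVlt => /predU1P[->|xy'].
  by rewrite !Rint_xx expr2 !mulr0.
set c := Rint x y (fun t => `|f t|).
have yx : 0 < y - x by rewrite subr_gt0.
have h : 0 <= Rint x y (fun t => ((y - x) * `|f t| - c) ^+ 2).
  by apply: Rint_ge0 => t _ _; exact: sqr_ge0.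
have fai := int01_norm fi.
rewrite (eq_Rint _ (fun t => (y - x)^+2 * f t ^+ 2 - ((y - x) * c * 2) * `|f t|
     + cst (c ^+ 2) t)) in h; last first.
  by move=> t _ _; rewrite -[f t ^+ 2]real_normK ?num_real//= ; ring.
rewrite RintD// ?RintB// ?RintZ// ?Rint_cst// -/c in h;
  try exact: int01_cst; try exact: int01Z; try by apply: int01B; exact: int01Z.
set I := Rint x y _ in h *.
have {}h : 0 <= (y - x) * ((y - x) * I - c ^+ 2) by move: h; nra.
by move: h; rewrite pmulr_rge0// subr_ge0.
Qed.

(** Absolute continuity in integral form: [F] is determined at every point of [0, 1], its density
    [f] up to a null set. Working with this relation avoids pointwise derivatives of [F]. *)
Definition prim F f : Prop := int01 f /\
  forall x y, 0 <= x -> x <= y -> y <= 1 -> F y - F x = Rint x y f.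

Definition ucont01 F : Prop := forall e : R, 0 < e -> exists2 d : R, 0 < d &
  forall x y, 0 <= x -> x <= y -> y <= 1 -> y - x < d -> `|F y - F x| < e.

Lemma Rint_abs_cont f : int01 f -> forall e : R, 0 < e -> exists2 d : R, 0 < d &
  forall x y, 0 <= x -> x <= y -> y <= 1 -> y - x < d -> Rint x y (fun t => `|f t|) < e.
Proof.
move=> fi e e0.
have fTi : mu.-integrable setT (EFin \o (f \_ `[0, 1])).
  by rewrite -restrict_EFin; apply/(integrable_mkcond _ _).1.
have [d [d0 H]] := integral_normr_continuous fTi e0.
exists d => // x y x0 xy y1 yxd.
have /H : (mu `[x, y]%classic < d%:E)%E.
  by rewrite /= lebesgue_measure_itv/= lte_fin; case: ifP => // _; rewrite lte_fin.
move=> /(_ (measurable_itv _)); congr (_ < _).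
apply: eq_Rint => t xt ty; rewrite patchE mem_set//= in_itv/=.
by rewrite (le_trans x0 xt) (le_trans ty y1).
Qed.

Lemma prim_ucont {F f} : prim F f -> ucont01 F.
Proof.
move=> [fi FE] e e0; have [d d0 H] := Rint_abs_cont _ fi _ e0; exists d => //.
by move=> x y x0 xy y1 yxd; rewrite FE//; apply: le_lt_trans (H _ _ x0 xy y1 yxd);
  exact: normr_Rint.
Qed.

Lemma ucont01_sym F : ucont01 F -> forall e : R, 0 < e -> exists2 d : R, 0 < d &
  forall x y, 0 <= x <= 1 -> 0 <= y <= 1 -> `|y - x| < d -> `|F y - F x| < e.
Proof.
move=> uF e e0; have [d d0 H] := uF e e0; exists d => // x y /andP[x0 x1] /andP[y0 y1] xyd.
have [xy|/ltW xy] := leP x y.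
  by apply: H => //; rewrite (le_lt_trans (ler_norm _)).
by rewrite distrC; apply: H => //; rewrite (le_lt_trans (ler_norm _))// distrC.
Qed.

Lemma within01P F : {within `[0, 1], continuous F} <->
  forall x, 0 <= x <= 1 -> forall e : R, 0 < e -> exists2 d : R, 0 < d &
    forall y, 0 <= y <= 1 -> `|y - x| < d -> `|F y - F x| < e.
Proof.
rewrite subspace_continuousP; split=> H x.
  move=> x01 e e0; have /H : (`[0, 1]%classic x) by rewrite /= in_itv.
  move=> /cvgrPdist_lt/(_ e e0)[d/= d0 dH]; exists d => // y y01 xyd.
  rewrite distrC; apply: dH; last by rewrite /= in_itv.
  by rewrite /ball_/= distrC.
rewrite /= in_itv/= => x01; apply/cvgrPdist_lt => e e0.
have [d d0 dH] := H x x01 e e0; exists d => //= y /=; rewrite distrC => xyd.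
by rewrite in_itv/= => y01; rewrite distrC; exact: dH.
Qed.

Lemma ucont01_continuous {F} : ucont01 F -> {within `[0, 1], continuous F}.
Proof.
move=> /ucont01_sym uF; apply/within01P => x x01 e e0.
by have [d d0 H] := uF e e0; exists d => // y y01; exact: H.
Qed.

Lemma within01_measurable {F} : {within `[0, 1], continuous F} ->
  measurable_fun (`[0, 1] : set R) F.
Proof. exact: subspace_continuous_measurable_fun. Qed.

Lemma within01_bounded {F} : {within `[0, 1], continuous F} -> bounded01 F.
Proof.
move=> cF.
have [c _ Hc] := @EVT_max R F 0 1 ler01 cF.
have [d _ Hd] := @EVT_min R F 0 1 ler01 cF.
exists (`|F c| + `|F d|) => x x0 x1.
have xI : x \in `[0, 1] by rewrite in_itv/= x0.
have := Hc x xI; have := Hd x xI => h1 h2.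
have := ler_norm (F c); have := ler_norm (- F d); rewrite normrN => h3 h4.
rewrite ler_norml; have := normr_ge0 (F c); have := normr_ge0 (F d).
by move=> ? ?; apply/andP; split; lra.
Qed.

Lemma prim_continuous {F f} : prim F f -> {within `[0, 1], continuous F}.
Proof. by move=> /prim_ucont/ucont01_continuous. Qed.

Lemma bddmeas_prim F f : prim F f -> bddmeas F.
Proof.
move=> /prim_continuous cF.
by split; [exact: within01_measurable|exact: within01_bounded].
Qed.

Lemma within01_int01 {F} : {within `[0, 1], continuous F} -> int01 F.
Proof.
by move=> cF; apply: int01_bounded; [exact: within01_measurable|exact: within01_bounded].
Qed.

(* Comparing increments only over pairs of points of a dense set Omega allows the lemma to be used
   for functions known almost everywhere. *)
Lemma dense_constant (Om : set R) (P K : R -> R) :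
  (forall x y, 0 <= x -> x < y -> y <= 1 -> exists2 z, Om z & x < z < y) ->
  (forall e : R, 0 < e -> exists2 d : R, 0 < d &
    forall x y, Om x -> Om y -> 0 <= x -> x <= y -> y <= 1 -> y - x < d ->
      `|P y - P x| <= e * (K y - K x)) ->
  forall x y, Om x -> Om y -> 0 <= x -> x <= y -> y <= 1 -> P x = P y.
Proof.
move=> dOm H x y Omx Omy x0 xy y1.
suff S (e : R) : 0 < e -> `|P y - P x| <= e * (K y - K x).
  apply/eqP; rewrite eq_sym -subr_eq0 -normr_le0; apply/ler_addgt0Pl => e e0.
  rewrite addr0; have k0 : 0 < `|K y - K x| + 1 by rewrite ltr_wpDl.
  apply: (le_trans (S (e / (`|K y - K x| + 1)) _)); first by rewrite divr_gt0.
  rewrite mulrAC ler_pdivrMr// ler_wpM2l ?ltW//.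
  by rewrite (le_lt_trans (ler_norm _))// ltrDl.
move=> e0; have [d d0 Hd] := H e e0.
have [n nP] : exists n : nat, y - x < n%:R * (d / 2).
  exists (Num.bound ((y - x) / (d / 2))).
  by rewrite -ltr_pdivrMr ?divr_gt0// archi_boundP// divr_ge0 ?divr_ge0 ?subr_ge0// ltW.
elim: n x Omx x0 xy nP => [|n IH] x Omx x0 xy; first by rewrite mul0r subr_lt0 ltNge xy.
move=> nP; have [yxd|yxd] := ltP (y - x) d; first exact: Hd.
(* Each step advances by more than [d / 2], so that [n] steps suffice, and by less than [d], so that
   the local estimate applies. *)
have [z Omz /andP[xz zx]] : exists2 z, Om z & x + d / 2 < z < x + d by apply: dOm; lra.
have {}IH : `|P y - P z| <= e * (K y - K z).
  apply: IH => //; [lra|lra|].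
  move: nP; rewrite -natr1 mulrDl mul1r; lra.
have Hz : `|P z - P x| <= e * (K z - K x) by apply: Hd => //; lra.
rewrite (_ : P y - P x = (P y - P z) + (P z - P x)); last by ring.
by rewrite (le_trans (ler_normD _ _))//; lra.
Qed.

Lemma dense_setT : forall x y, 0 <= x -> x < y -> y <= 1 -> exists2 z, [set: R] z & x < z < y.
Proof. by move=> x y _ xy _; exists ((x + y) / 2) => //; rewrite !midf_lt. Qed.

(** An error that is an arbitrarily small multiple of an additive quantity remains so after
    summation over a subdivision; hence [F] minus the integral of [f] is constant. This replaces
    differentiation almost everywhere. *)
Lemma prim_approx F f k : int01 f -> int01 k ->
  (forall e : R, 0 < e -> exists2 d : R, 0 < d &
    forall x y, 0 <= x -> x <= y -> y <= 1 -> y - x < d ->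
      `|F y - F x - Rint x y f| <= e * Rint x y k) -> prim F f.
Proof.
move=> fi ki H; split=> // x y x0 xy y1.
have S : F x - Rint 0 x f = F y - Rint 0 y f.
  apply: (@dense_constant setT (fun x => F x - Rint 0 x f) (fun x => Rint 0 x k)) => //.
    exact: dense_setT.
  move=> e e0; have [d d0 Hd] := H e e0; exists d => // a b _ _ a0 ab b1 bad.
  move: (Hd a b a0 ab b1 bad).
  rewrite (Rint_cat f 0 b a)// (Rint_cat k 0 b a)// => h.
  rewrite (_ : _ - _ - _ = F b - F a - Rint a b f); last by ring.
  by rewrite (_ : _ - Rint 0 a k = Rint a b k); last by ring.
move: S; rewrite (Rint_cat f 0 y x)//; lra.
Qed.

Lemma eq_prim F f G g : (forall x, 0 <= x -> x <= 1 -> F x = G x) ->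
  (forall x, 0 <= x -> x <= 1 -> f x = g x) -> prim F f -> prim G g.
Proof.
move=> FG fg [fi FE]; split; first exact: eq_int01 fi.
move=> x y x0 xy y1; rewrite -!FG ?FE//; try lra.
by apply: eq_Rint => t xt ty; apply: fg; lra.
Qed.

Lemma primD F f G g : prim F f -> prim G g ->
  prim (fun x => F x + G x) (fun x => f x + g x).
Proof.
move=> [fi FE] [gi GE]; split; first exact: int01D.
by move=> x y x0 xy y1; rewrite RintD// -FE// -GE//; ring.
Qed.

Lemma primB F f G g : prim F f -> prim G g ->
  prim (fun x => F x - G x) (fun x => f x - g x).
Proof.
move=> [fi FE] [gi GE]; split; first exact: int01B.
by move=> x y x0 xy y1; rewrite RintB// -FE// -GE//; ring.
Qed.

Lemma primZ k F f : prim F f -> prim (fun x => k * F x) (fun x => k * f x).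
Proof.
move=> [fi FE]; split; first exact: int01Z.
by move=> x y x0 xy y1; rewrite RintZ// -FE//; ring.
Qed.

Lemma prim_shift c F f : prim F f -> prim (fun x => c + F x) f.
Proof. by move=> [fi FE]; split=> // x y x0 xy y1; rewrite -FE//; ring. Qed.

Lemma prim_Rint f : int01 f -> prim (fun x => Rint 0 x f) f.
Proof.
by move=> fi; split=> // x y x0 xy y1; rewrite (Rint_cat f 0 y x)//; ring.
Qed.

(** Lipschitz on bounded sets, which suffices because [r] is composed with functions bounded on
    [0, 1]. *)
Definition loclip (r : R -> R) : Prop := forall M : R, exists2 L : R, 0 <= L &
  forall s t, `|s| <= M -> `|t| <= M -> `|r s - r t| <= L * `|s - t|.

Lemma ucont01_comp r P : loclip r -> ucont01 P -> ucont01 (r \o P).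
Proof.
move=> lr uP e e0; have [M PM] := within01_bounded (ucont01_continuous uP).
have [L L0 rL] := lr M.
have e'0 : 0 < e / (L + 1) by rewrite divr_gt0// ltr_wpDl.
have [d d0 dP] := uP _ e'0; exists d => // x y x0 xy y1 yxd.
have Py := PM y (le_trans x0 xy) y1.
have Px := PM x x0 (le_trans xy y1).
rewrite /= (le_lt_trans (rL _ _ Py Px))//.
have := dP x y x0 xy y1 yxd; rewrite ltr_pdivlMr ?ltr_wpDl// mulrDr mulr1 mulrC.
by have := normr_ge0 (P y - P x); lra.
Qed.

(** A chain rule whose hypothesis has the shape of the mean value theorem, so that it works in both
    directions: with [Z = P] it differentiates a composition, and with [Z] the composition of
    [Euler] with [P] it recovers the density of [P] from that of [Z]. *)
Lemma prim_chain F (Z zeta P r : R -> R) : prim Z zeta -> ucont01 P -> loclip r ->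
  (forall x y, 0 <= x -> x <= y -> y <= 1 -> exists2 xi : R,
    `|xi - P x| <= `|P y - P x| & F y - F x = r xi * (Z y - Z x)) ->
  prim F (fun t => zeta t * r (P t)).
Proof.
move=> [zi ZE] uP lr H.
have cP := ucont01_continuous uP.
have crP := ucont01_continuous (ucont01_comp _ _ lr uP).
have [M PM] := within01_bounded cP.
have rPz : int01 (fun t => zeta t * r (P t)).
  exact: int01M zi (within01_measurable crP) (within01_bounded crP).
apply: (prim_approx _ _ (fun t => `|zeta t|)) => //; first exact: int01_norm.
(* [xi] lies within [|P y - P x| <= 2 M] of [P x], hence the radius [3 M]. On a short interval it
   lies within [2 e / (2 L + 1)] of every [P t], so that [r xi] and [r (P t)] differ by at most
   [e]. *)
move=> e e0; have [L L0 rL] := lr (3 * M).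
have e'0 : 0 < e / (2 * L + 1) by rewrite divr_gt0// ltr_wpDl// mulr_ge0.
have [d d0 dP] := uP _ e'0; exists d => // x y x0 xy y1 yxd.
have [xi xiP ->] := H x y x0 xy y1.
have M0 : 0 <= M by rewrite (le_trans _ (PM 0 _ _)).
rewrite ZE// -RintZ// -RintB//; last exact: int01Z.
have I1 : int01 (fun t => r xi * zeta t - zeta t * r (P t)).
  by apply: int01B => //; exact: int01Z.
apply: (le_trans (normr_Rint _ _ _ I1 x0 y1)); rewrite -RintZ//; last exact: int01_norm.
apply: le_Rint => //; first exact: int01_norm.
  by apply: int01Z; exact: int01_norm.
move=> t xt ty; rewrite [zeta t * _]mulrC -mulrBl normrM ler_wpM2r//.
have Px := PM x x0 (le_trans xy y1).
have Py := PM y (le_trans x0 xy) y1.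
have Pt := PM t (le_trans x0 xt) (le_trans ty y1).
have dyx := dP x y x0 xy y1 yxd.
have dtx : `|P t - P x| < e / (2 * L + 1) by apply: dP => //; lra.
have xiM : `|xi| <= 3 * M.
  rewrite (_ : xi = P x + (xi - P x)); last by ring.
  rewrite (le_trans (ler_normD _ _))//.
  have := le_trans xiP (ler_normB _ _); lra.
apply: (le_trans (rL _ _ xiM _)); first lra.
have : `|xi - P t| <= 2 * (e / (2 * L + 1)).
  rewrite (_ : xi - P t = (xi - P x) - (P t - P x)); last by ring.
  rewrite (le_trans (ler_normB _ _))//; lra.
have : (e / (2 * L + 1)) * (2 * L + 1) = e by rewrite divfK// gt_eqF// ltr_wpDl// mulr_ge0.
move: (e / (2 * L + 1)) e'0 => e' e'0 <- h.
by apply: (le_trans (ler_wpM2l L0 h)); nra.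
Qed.

Lemma is_derive_continuous (r r' : R -> R) :
  (forall x, is_derive x (1 : R) r (r' x)) -> continuous r.
Proof.
move=> dr x; apply: differentiable_continuous; apply/derivable1_diffP.
exact: (@ex_derive _ _ _ _ _ _ _ (dr x)).
Qed.

Lemma mvt_between (h h' : R -> R) a b : (forall x, is_derive x (1 : R) h (h' x)) ->
  exists2 c, h b - h a = h' c * (b - a) &
  `|c - a| <= `|b - a| /\ (forall N, `|a| <= N -> `|b| <= N -> `|c| <= N).
Proof.
move=> dh.
have cE A : {within A, continuous h} by apply: continuous_subspaceT; exact: is_derive_continuous dh.
have [ab|/ltW ba] := leP a b.
  have [c + E] := @MVT_segment R h h' a b ab (fun x _ => dh x) (cE _).
  rewrite in_itv/= => /andP[ac cb]; exists c => //; split.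
    by rewrite !ger0_norm ?subr_ge0// lerD2r.
  by move=> N; rewrite !ler_norml => /andP[? ?] /andP[? ?]; apply/andP; split; lra.
have [c + E] := @MVT_segment R h h' b a ba (fun x _ => dh x) (cE _).
rewrite in_itv/= => /andP[bc ca]; exists c.
  by rewrite -[LHS]opprK opprB E; ring.
split; first by rewrite !ler0_norm ?subr_le0// lerN2 lerD2r.
by move=> N; rewrite !ler_norml => /andP[? ?] /andP[? ?]; apply/andP; split; lra.
Qed.

Lemma loclip_derive (r r' : R -> R) : (forall x, is_derive x (1 : R) r (r' x)) ->
  continuous r' -> loclip r.
Proof.
move=> dr cr' M; have [M0|M0] := ltP M 0.
  by exists 0 => // s t /le_trans/(_ (ltW M0)); rewrite normr_le0 => /eqP -> /le_lt_trans/(_ M0); rewrite ltNge normr_ge0.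
have MM : - M <= M by lra.
have cw : {within `[- M, M], continuous r'} by exact: continuous_subspaceT.
have [c _ Hc] := @EVT_max R r' (- M) M MM cw.
have [d _ Hd] := @EVT_min R r' (- M) M MM cw.
exists (`|r' c| + `|r' d|); first by rewrite addr_ge0.
move=> s t; wlog st : s t / s <= t => [th sM tM|].
  by have [st|/ltW ts] := leP s t; [exact: th|rewrite distrC (distrC s); exact: th].
rewrite !ler_norml => /andP[s1 s2] /andP[t1 t2].
have [x xst] := @MVT_segment R r r' s t st (fun x _ => dr x)
  (continuous_subspaceT (is_derive_continuous _ _ dr)).
move=> E; rewrite -ler_norml distrC E normrM [`|s - t|]distrC ler_wpM2r//.
have xM : x \in `[- M, M].
  by move: xst; rewrite !in_itv/= => /andP[? ?]; apply/andP; split; lra.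
have := Hc _ xM; have := Hd _ xM => h1 h2.
have := ler_norm (r' c); have := ler_norm (- r' d); rewrite normrN => h3 h4.
rewrite ler_norml; have := normr_ge0 (r' c); have := normr_ge0 (r' d).
by move=> ? ?; apply/andP; split; lra.
Qed.

Lemma prim_comp (h h' : R -> R) F f : (forall x, is_derive x (1 : R) h (h' x)) ->
  loclip h' -> prim F f -> prim (h \o F) (fun t => f t * h' (F t)).
Proof.
move=> dh lh' Ff; apply: (prim_chain _ F f F h' Ff) => //; first exact: prim_ucont Ff.
move=> x y x0 xy y1; have [c cE [cx _]] := mvt_between h h' (F x) (F y) dh.
by exists c.
Qed.

Lemma is_derive_sqr (x : R) : is_derive x (1 : R) (fun s : R => s ^+ 2) (2 * x).
Proof.
have h := is_deriveX 2 (is_derive_id x (1 : R)).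
by apply: is_derive_eq h _; rewrite /= expr1 -[_ *: 1]/(_ * 1) mulr1.
Qed.

Lemma loclip_lin k : loclip (fun x => k * x).
Proof. by move=> M; exists `|k| => // s t _ _; rewrite -mulrBr normrM. Qed.

(** Polarization reduces the product rule to the chain rule for the square. *)
Lemma primM F f G g : prim F f -> prim G g ->
  prim (fun x => F x * G x) (fun x => f x * G x + F x * g x).
Proof.
move=> Ff Gg.
have H1 := prim_comp _ _ _ _ is_derive_sqr (loclip_lin 2) (primD _ _ _ _ Ff Gg).
have H2 := prim_comp _ _ _ _ is_derive_sqr (loclip_lin 2) (primB _ _ _ _ Ff Gg).
apply: eq_prim (primZ (1 / 4) _ _ (primB _ _ _ _ H1 H2)) => x _ _ /=; by field.
Qed.

End integral01.

(** * Test functions *)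

Section smooth.
Context {R : realType}.
Implicit Types (f g : R -> R) (x : R).

Lemma is_derive_add f g a b x : is_derive x (1 : R) f a -> is_derive x (1 : R) g b ->
  is_derive x (1 : R) (fun t => f t + g t) (a + b).
Proof. by move=> df dg; have := is_deriveD df dg. Qed.

Lemma is_derive_sub f g a b x : is_derive x (1 : R) f a -> is_derive x (1 : R) g b ->
  is_derive x (1 : R) (fun t => f t - g t) (a - b).
Proof. by move=> df dg; have := is_deriveB df dg. Qed.

Lemma is_derive_opp f a x : is_derive x (1 : R) f a ->
  is_derive x (1 : R) (fun t => - f t) (- a).
Proof. by move=> df; have := is_deriveN df. Qed.

Lemma is_derive_scale k f a x : is_derive x (1 : R) f a ->
  is_derive x (1 : R) (fun t => k * f t) (k * a).
Proof. by move=> df; have := is_deriveZ k df. Qed.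

Lemma is_derive_mul f g a b x : is_derive x (1 : R) f a -> is_derive x (1 : R) g b ->
  is_derive x (1 : R) (fun t => f t * g t) (a * g x + f x * b).
Proof.
move=> df dg; have H := is_deriveM df dg.
rewrite (_ : a * g x + f x * b = f x *: b + g x *: a); first exact: H.
by rewrite -[f x *: b]/(f x * b) -[g x *: a]/(g x * a) addrC [a * _]mulrC.
Qed.

Lemma is_derive_affine k c x : is_derive x (1 : R) (fun t : R => k * t + c) k.
Proof.
have := is_derive_add _ _ _ _ x (is_derive_scale k _ _ x (is_derive_id x (1 : R)))
  (is_derive_cst c x (1 : R)).
by rewrite mulr1 addr0.
Qed.

Lemma is_derive_ext f a b x : is_derive x (1 : R) f a -> a = b -> is_derive x (1 : R) f b.
Proof. by move=> df <-. Qed.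

Definition smooth f : Prop := forall n x, derivable (derive1n n f) x 1.

(** A class closed under differentiation contains all iterated derivatives of its members. The
    smoothness proofs below only exhibit such a class and need no formula for the n-th
    derivative. *)
Lemma smooth_coind (S : set (R -> R)) :
  (forall f, S f -> exists2 f', S f' & forall x, is_derive x (1 : R) f (f' x)) ->
  forall f, S f -> smooth f.
Proof.
move=> HS; have deriveS f : S f -> S (derive1 f).
  move=> /HS[f' Sf' df]; rewrite (_ : derive1 f = f')//.
  by apply/funext => x; rewrite derive1E; exact: derive_val.
have S_n f n : S f -> S (derive1n n f).
  by move=> Sf; elim: n => [//|n IH]; rewrite derive1nS; exact: deriveS.
move=> f Sf n x; have [f' _ df] := HS _ (S_n f n Sf).
exact: (@ex_derive _ _ _ _ _ _ _ (df x)).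
Qed.

Lemma smooth_is_derive f : smooth f -> forall x, is_derive x (1 : R) f (derive1 f x).
Proof. by move=> sf x; rewrite derive1E; apply: derivableP; exact: (sf 0%N). Qed.

Lemma smooth_derive1 f : smooth f -> smooth (derive1 f).
Proof. by move=> sf n x; rewrite -derive1Sn; exact: sf. Qed.

Lemma smooth_prim f f' : (forall x, is_derive x (1 : R) f (f' x)) -> smooth f' -> smooth f.
Proof.
move=> df sf' [|n] x; first exact: (@ex_derive _ _ _ _ _ _ _ (df x)).
rewrite derive1Sn (_ : derive1 f = f'); first exact: sf'.
by apply/funext => y; rewrite derive1E; exact: derive_val.
Qed.

Lemma smooth_continuous f : smooth f -> continuous f.
Proof. by move=> sf; apply: is_derive_continuous; exact: smooth_is_derive. Qed.

(** Products alone are not closed under differentiation; their sums are, by the product rule. *)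
Inductive prod_sums : set (R -> R) :=
| prod_sums_mul f g : smooth f -> smooth g -> prod_sums (fun x => f x * g x)
| prod_sums_add u v : prod_sums u -> prod_sums v -> prod_sums (fun x => u x + v x).

Lemma smoothM f g : smooth f -> smooth g -> smooth (fun x => f x * g x).
Proof.
move=> sf sg; apply: (smooth_coind prod_sums); last exact: prod_sums_mul.
move=> h; elim=> [u v su sv|u v _ [u' Su' du] _ [v' Sv' dv]].
  exists (fun x => derive1 u x * v x + u x * derive1 v x).
    exact: prod_sums_add (prod_sums_mul _ _ (smooth_derive1 _ su) sv) (prod_sums_mul _ _ su (smooth_derive1 _ sv)).
  by move=> x; exact: is_derive_mul (smooth_is_derive _ su x) (smooth_is_derive _ sv x).
exists (fun x => u' x + v' x); first exact: prod_sums_add.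
by move=> x; exact: is_derive_add (du x) (dv x).
Qed.

Lemma smooth_affine f c a b : smooth f -> smooth (fun x => c * f (a * x + b)).
Proof.
move=> sf; pose S := [set h : R -> R | exists2 g, smooth g & exists c,
  h = fun x => c * g (a * x + b)].
apply: (smooth_coind S); last by exists f => //; exists c.
move=> _ [g sg [k ->]]; exists (fun x => (k * a) * derive1 g (a * x + b)).
  by exists (derive1 g); [exact: smooth_derive1|exists (k * a)].
move=> x.
have H := @is_derive1_comp _ g (fun t => a * t + b) x _ _
  (smooth_is_derive _ sg (a * x + b)) (is_derive_affine a b x).
by apply: is_derive_ext (is_derive_scale k _ _ x H) _; ring.
Qed.

Lemma smoothB_scale f g k : smooth f -> smooth g -> smooth (fun x => f x - k * g x).
Proof.
move=> sf sg; pose S := [set h : R -> R | exists f g, [/\ smooth f, smooth g &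
  h = fun x => f x - k * g x]].
apply: (smooth_coind S); last by exists f, g.
move=> _ [u [v [su sv ->]]]; exists (fun x => derive1 u x - k * derive1 v x).
  by exists (derive1 u), (derive1 v); split; [exact: smooth_derive1 su|exact: smooth_derive1 sv|].
move=> x; apply: is_derive_sub; first exact: smooth_is_derive.
by apply: is_derive_scale; exact: smooth_is_derive.
Qed.

(** Induction on the polynomial for all rates [e] at once: one half of the rate absorbs the new
    factor, as [y <= (2 / e) exp (e y / 2)], and the other half is left to the smaller
    polynomial. *)
Lemma poly_expR_bound (p : {poly R}) (e : R) : 0 < e -> exists C : R,
  forall y, 0 <= y -> `|p.[y]| <= C * expR (e * y).
Proof.
elim/poly_ind: p e => [|p c IH] e e0.
  by exists 0 => y _; rewrite horner0 normr0 mul0r.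
have e20 : 0 < e / 2 by rewrite divr_gt0.
have [C HC] := IH _ e20.
exists (C * (2 / e) + `|c|) => y y0.
rewrite hornerMXaddC (le_trans (ler_normD _ _))// mulrDl lerD//; last first.
  by rewrite ler_peMr// -expR0 ler_expR mulr_ge0// ltW.
rewrite normrM (ger0_norm y0).
have h1 := HC y y0.
have h2 : y <= 2 / e * expR (e / 2 * y).
  have := expR_ge1Dx (e / 2 * y) => h.
  rewrite -ler_pdivrMl ?divr_gt0// invf_div; lra.
have -> : expR (e * y) = expR (e / 2 * y) * expR (e / 2 * y).
  by rewrite -expRD; congr expR; lra.
apply: (le_trans (ler_pM _ _ h1 h2)) => //.
by rewrite le_eqVlt; apply/orP; left; apply/eqP; ring.
Qed.

(* This family is closed under differentiation (is_derive_flat), whence the smoothness of bump0. *)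
Definition flat (p : {poly R}) x : R := if 0 < x then p.[x^-1] * expR (- x^-1) else 0.

Lemma flat_quadratic p : exists K : R, forall x, `|flat p x| <= K * x ^+ 2.
Proof.
have [K HK] := poly_expR_bound ('X^2 * p) 1 ltr01.
have K0 : 0 <= K by have := HK 0 (lexx _); rewrite mulr0 expR0 mulr1; exact: le_trans.
exists K => x; rewrite /flat; case: ifPn => x0; last first.
  by rewrite normr0 mulr_ge0 ?sqr_ge0.
have y0 : 0 < x^-1 by rewrite invr_gt0.
have := HK _ (ltW y0).
rewrite hornerM hornerXn normrM normrX (gtr0_norm y0) mul1r exprVn.
rewrite ler_pdivrMl ?exprn_gt0// => h.
rewrite normrM (gtr0_norm (expR_gt0 _)) expRN ler_pdivrMr ?expR_gt0//.
by rewrite (le_trans h)// le_eqVlt; apply/orP; left; apply/eqP; ring.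
Qed.

Lemma is_derive0_quadratic f K : (forall x, `|f x| <= K * x ^+ 2) -> is_derive (0 : R) (1 : R) f 0.
Proof.
move=> fK.
have f0 : f 0 = 0.
  by apply/eqP; rewrite -normr_le0 (le_trans (fK 0))// expr0n/= mulr0.
have c : h^-1 *: ((f \o shift (0 : R)) (h *: (1 : R)) - f 0) @[h --> (0 : R)^'] --> (0 : R).
  apply/cvgrPdist_lt => e e0.
  exists (e / (`|K| + 1)); first by rewrite /= divr_gt0// ltr_wpDl.
  move=> h /=; rewrite /ball_/= sub0r normrN => he hn0.
  rewrite sub0r normrN f0 subr0 addr0 -![_ *: _]/(_ * _) mulr1 normrM normfV.
  rewrite ltr_pdivrMl ?normr_gt0// (le_lt_trans (fK h))//.
  rewrite (le_lt_trans (ler_norm _))// normrM normrX expr2 mulrCA ltr_pM2l ?normr_gt0//.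
  move: he; rewrite ltr_pdivlMr ?ltr_wpDl// mulrDr mulr1 mulrC.
  by have := normr_ge0 h; lra.
by split; [apply/cvg_ex; exists 0|exact: cvg_lim].
Qed.

(** For positive [x] the polynomial and the exponential both contribute a factor [x^-2] when
    differentiated, so the derivative is again a polynomial in [x^-1] times the same exponential. *)
Lemma is_derive_flat p x : is_derive x (1 : R) (flat p) (flat ('X^2 * (p - p^`())) x).
Proof.
have [x0|x0|->] := ltgtP x 0; last first.
- have [K HK] := flat_quadratic p.
  by rewrite {2}/flat ltxx; exact: is_derive0_quadratic HK.
- have xn0 : x != 0 by rewrite gt_eqF.
  have -> : flat ('X^2 * (p - p^`())) x =
      p.[x^-1] * (expR (- x^-1) * x ^- 2) + (p^`().[x^-1] * (- x ^- 2)) * expR (- x^-1).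
    rewrite /flat x0 hornerM hornerXn hornerD hornerN -exprVn; ring.
  have dV : is_derive x (1 : R) (fun x => x^-1) (- x ^- 2).
    have H := @is_deriveV _ id x 1 1 xn0 (is_derive_id x (1 : R)).
    by apply: is_derive_ext H _; rewrite -[_ *: _]/(_ * _) mulr1.
  have dp := is_derive1_comp (is_derive_poly p x^-1) dV.
  have dE := @is_derive1_comp _ expR (fun t => - t^-1) x _ _
    (is_derive_expR (- x^-1)) (is_derive_opp _ _ _ dV).
  have H := is_derive_mul _ _ _ _ _ dp dE.
  apply: (near_eq_is_derive _ (is_derive_ext _ _ _ _ H _)).
  + near=> y; rewrite /flat ifT//.
    by near: y; apply: lt_nbhsr.
  + by rewrite /=; ring.
- rewrite /flat ltNge (ltW x0)/=.
  apply: (near_eq_is_derive _ (is_derive_cst (0 : R) x (1 : R))).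
  near=> y; rewrite /flat ltNge ifN// negbK ltW//.
  by near: y; apply: lt_nbhsl.
Unshelve. all: by end_near. Qed.

Definition bump0 : R -> R := flat 1.

Lemma smooth_bump0 : smooth bump0.
Proof.
apply: (smooth_coind [set flat p | p in [set: {poly R}]]); last by exists 1.
move=> _ [p _ <-]; exists (flat ('X^2 * (p - p^`()))); last exact: is_derive_flat.
by exists ('X^2 * (p - p^`())).
Qed.

Lemma bump0_ge0 x : 0 <= bump0 x.
Proof. by rewrite /bump0 /flat; case: ifP => // _; rewrite hornerC mul1r expR_ge0. Qed.

Lemma bump0_le1 x : bump0 x <= 1.
Proof.
rewrite /bump0 /flat; case: ifPn => // x0; rewrite hornerC mul1r -expR0 ler_expR.
by rewrite oppr_le0 invr_ge0 ltW.
Qed.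

Lemma bump0_eq0 x : x <= 0 -> bump0 x = 0.
Proof. by move=> x0; rewrite /bump0 /flat ltNge x0. Qed.

Lemma bump0_cvg x : 0 < x -> bump0 (n.+1%:R * x) @[n --> \oo] --> (1 : R).
Proof.
move=> x0; rewrite (_ : (fun n : nat => _) = expR \o (fun n : nat => - (x^-1 * harmonic n))); last first.
  apply/funext => n; rewrite /bump0 /flat /= mulr_gt0// hornerC mul1r.
  by rewrite /harmonic /= invfM mulrC.
rewrite -expR0; apply: continuous_cvg; first exact: continuous_expR.
rewrite -oppr0; apply: cvgN; rewrite -(mulr0 x^-1); apply: cvgMr.
exact: cvg_harmonic.
Qed.

(** Smooth functions with values in [0, 1] that vanish outside []a, b[] and tend to 1 at each of its
    points: approximations of the indicator by test functions. *)
Definition cutoff (a b : R) (n : nat) x : R :=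
  bump0 (n.+1%:R * (x - a)) * bump0 (n.+1%:R * (b - x)).

Lemma smooth_cutoff a b n : smooth (cutoff a b n).
Proof.
have h1 := smooth_affine _ 1 n.+1%:R (- n.+1%:R * a) smooth_bump0.
have h2 := smooth_affine _ 1 (- n.+1%:R) (n.+1%:R * b) smooth_bump0.
rewrite (_ : cutoff a b n = fun x => (1 * bump0 (n.+1%:R * x + (- n.+1%:R * a))) *
  (1 * bump0 (- n.+1%:R * x + n.+1%:R * b))); first exact: smoothM.
by apply/funext => x; rewrite /cutoff !mul1r; congr (bump0 _ * bump0 _); ring.
Qed.

Lemma cutoff_ge0 a b n x : 0 <= cutoff a b n x.
Proof. by rewrite mulr_ge0// bump0_ge0. Qed.

Lemma cutoff_le1 a b n x : cutoff a b n x <= 1.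
Proof. by rewrite mulr_ile1 ?bump0_ge0 ?bump0_le1. Qed.

Lemma cutoff_eq0 a b n x : ~~ (a < x < b) -> cutoff a b n x = 0.
Proof.
rewrite negb_and -!leNgt /cutoff => /orP[xa|bx].
  by rewrite [bump0 (_ * (x - a))]bump0_eq0 ?mul0r// pmulr_rle0// subr_le0.
by rewrite [bump0 (_ * (b - x))]bump0_eq0 ?mulr0// pmulr_rle0// subr_le0.
Qed.

Lemma cutoff_cvg a b x : a < x < b -> cutoff a b n x @[n --> \oo] --> (1 : R).
Proof.
move=> /andP[ax xb]; rewrite -[X in _ --> X]mulr1.
by apply: cvgM; apply: bump0_cvg; rewrite subr_gt0.
Qed.

Lemma smooth_test f a b : smooth f -> 0 < a -> b < 1 ->
  (forall x, ~~ (a < x < b) -> f x = 0) -> test_function f.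
Proof.
move=> sf a0 b1 f0; split=> //.
have : closure [set x | f x != 0] `<=` `[a, b].
  rewrite [X in _ `<=` X](closure_id _).1; last exact: interval_closed.
  apply: closure_subset => x /= fx; rewrite in_itv/=.
  have [/andP[/ltW -> /ltW ->]//|/f0 fx0] := boolP (a < x < b).
  by rewrite fx0 eqxx in fx.
move=> h x /h; rewrite /= !in_itv/= => /andP[ax xb].
by rewrite (lt_le_trans a0 ax) (le_lt_trans xb b1).
Qed.

Lemma test_functionP f : test_function f -> smooth f /\ exists a b,
  [/\ 0 < a, a <= b, b < 1 & forall x, ~~ (a < x < b) -> f x = 0].
Proof.
move=> [sf cf]; split=> //.
set S := [set x | f x != 0] in cf.
have [[x0 Sx0]|S0] := pselect (S !=set0); last first.
  exists (1 / 2), (1 / 2); split; [lra|exact: lexx|lra|] => x _; apply/eqP.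
  by apply: contra_notT S0 => fx; exists x.
have cS : compact (closure S).
  apply: (@subclosed_compact _ _ (`[0, 1]%classic : set R)); [exact: closed_closure|exact: segment_compact|].
  by move=> x /cf; rewrite /= !in_itv/= => /andP[/ltW -> /ltW ->].
have nS : closure S !=set0 by exists x0; exact: subset_closure.
have [m mS Hm] := compact_EVT_min nS cS (continuous_subspaceT (fun x => cvg_id)).
have [M MS HM] := compact_EVT_max nS cS (continuous_subspaceT (fun x => cvg_id)).
have := cf _ (set_mem mS); have := cf _ (set_mem MS).
rewrite /= !in_itv/= => /andP[M0 M1] /andP[m0 m1].
have mM : m <= M by apply: Hm.
(* The support is contained in [[m, M]]; moving strictly outside it makes [f] vanish at the new end
   points too. *)
exists (m / 2), ((M + 1) / 2); split; [lra|lra|lra|] => x.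
apply: contraNeq => fx; have Sx : x \in closure S by rewrite inE; exact: subset_closure.
by have := Hm x Sx; have := HM x Sx; rewrite /id; lra.
Qed.

End smooth.

(** * Weak derivatives *)

Section weak.
Context {R : realType}.
Local Notation mu := (@lebesgue_measure R).
Implicit Types (f g F G phi chi : R -> R) (x y z : R).

Lemma measurable01_oo f : measurable_fun (`]0, 1[ : set R) f ->
  measurable_fun (`[0, 1] : set R) f.
Proof. exact: measurable_fun_itv_cc. Qed.

Lemma int01_oo f : mu.-integrable `]0, 1[ (EFin \o f) <-> int01 f.
Proof.
split=> [fi|fi]; last by apply: integrableS fi => //; exact: subset_itvW.
have mf : measurable_fun (`[0, 1] : set R) f.
  by apply: measurable01_oo; apply/measurable_EFinP; exact: measurable_int fi.
apply/integrableP; split; first exact/measurable_EFinP.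
rewrite -integral_itv_obnd_cbnd ?itv_bndbnd_setU//; last first.
  apply/measurable_EFinP; apply: measurableT_comp => //.
  by apply: measurable_funS mf => //; apply: subset_itvr; rewrite bnd_simp.
rewrite -integral_itv_bndo_bndc; first by case/integrableP : fi.
apply/measurable_EFinP; apply: measurableT_comp => //.
by apply: measurable_funS mf => //; exact: subset_itvW.
Qed.

Lemma Rint_oo f : int01 f -> \int[mu]_(x in `]0, 1[) f x = Rint 0 1 f.
Proof.
move=> fi; rewrite /Rint -Rintegral_itv_obnd_cbnd; last first.
  by apply: integrableS fi => //; apply: subset_itvr; rewrite bnd_simp.
by rewrite -Rintegral_itv_bndo_bndc//; exact/int01_oo.
Qed.

Lemma ae_sub (P Q : R -> Prop) : (forall x, P x -> Q x) ->
  {ae mu, forall x, P x} -> {ae mu, forall x, Q x}.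
Proof. by move=> PQ; apply: (@filterS _ _ (ae_filter_ringOfSetsType mu)). Qed.

Lemma ae_and (P Q : R -> Prop) : {ae mu, forall x, P x} -> {ae mu, forall x, Q x} ->
  {ae mu, forall x, P x /\ Q x}.
Proof.
move=> HP HQ; apply: (@filterS2 _ _ (ae_filter_ringOfSetsType mu) _ _ _ _ HP HQ).
by move=> x.
Qed.

Definition ae01 (P : R -> Prop) : Prop := {ae mu, forall x, x \in `]0, 1[ -> P x}.

Lemma ae01_dense (P : R -> Prop) : ae01 P ->
  forall x y, 0 <= x -> x < y -> y <= 1 -> exists2 z, P z & x < z < y.
Proof.
move=> [N [mN N0 PN]] x y x0 xy y1; apply: contrapT => H.
have : (mu `]x, y[%classic <= mu N)%E.
  apply: le_measure; rewrite ?inE//; apply: subset_trans PN => z /=.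
  rewrite in_itv/= => xzy /(_ _) Pz; apply: H; exists z => //; apply: Pz.
  by rewrite in_itv/=; move: xzy => /andP[? ?]; apply/andP; split; lra.
by rewrite N0 lebesgue_measure_itv/= lte_fin xy -EFinD lee_fin subr_le0 leNgt xy.
Qed.

Lemma ae01_imp (P Q : R -> Prop) : (forall x, 0 < x -> x < 1 -> P x -> Q x) ->
  ae01 P -> ae01 Q.
Proof.
move=> PQ HP; apply: ae_sub HP => x Px x01; apply: PQ; last exact: Px.
  by move: x01; rewrite in_itv/= => /andP[].
by move: x01; rewrite in_itv/= => /andP[].
Qed.

Lemma ae01_and (P Q : R -> Prop) : ae01 P -> ae01 Q -> ae01 (fun x => P x /\ Q x).
Proof. move=> HP HQ; apply: ae_sub (ae_and _ _ HP HQ) => x [Px Qx] x01.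
by split; [exact: Px|exact: Qx]. Qed.

Lemma ae_int01 {f g} : ae01 (fun x => f x = g x) -> measurable_fun (`[0, 1] : set R) g ->
  int01 f -> int01 g.
Proof.
move=> fg mg fi; apply/int01_oo; move/int01_oo : fi => fi.
have mg' : measurable_fun (`]0, 1[ : set R) g.
  by apply: measurable_funS mg => //; exact: subset_itvW.
apply/integrableP; split; first exact/measurable_EFinP.
case/integrableP : fi => mf; apply: le_lt_trans; rewrite le_eqVlt; apply/orP; left; apply/eqP.
apply: ge0_ae_eq_integral => //.
- by apply/measurable_EFinP; apply: measurableT_comp.
- exact: measurableT_comp.
- by apply: ae_sub fg => x fgx x01 /=; rewrite fgx.
Qed.

Lemma ae_Rint f g x y : ae01 (fun x => f x = g x) -> int01 f -> int01 g ->
  0 <= x -> x <= y -> y <= 1 -> Rint x y f = Rint x y g.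
Proof.
move=> fg fi gi x0 xy y1.
have sub : (`]x, y[ : set R) `<=` `[x, y] by exact: subset_itvW.
have fi' := int01S fi x0 y1; have gi' := int01S gi x0 y1.
have oc (h : R -> R) : int01 h -> Rint x y h = \int[mu]_(t in `]x, y[) h t.
  move=> hi; have hi' := int01S hi x0 y1.
  rewrite /Rint -Rintegral_itv_obnd_cbnd; last first.
    by apply: integrableS hi' => //; apply: subset_itvr; rewrite bnd_simp.
  by rewrite -Rintegral_itv_bndo_bndc//; apply: integrableS hi'.
rewrite !oc//; congr fine; apply: ae_eq_integral => //.
- by apply: measurable_funS (measurable_int _ fi').
- by apply: measurable_funS (measurable_int _ gi').
- apply: ae_sub fg => t fgt xty; rewrite fgt//.
  by move: xty; rewrite /= !in_itv/= => /andP[? ?]; apply/andP; split; lra.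
Qed.

Lemma locally_integrable01 f : int01 f -> locally_integrable `]0, 1[ f.
Proof. by move=> /int01_oo fi; apply: open_integrable_locally => //; exact: interval_open. Qed.

Lemma locint_sub f a b : locally_integrable `]0, 1[ f -> 0 < a -> b < 1 ->
  mu.-integrable `[a, b] (EFin \o f).
Proof.
move=> [mf _ fi] a0 b1.
have sub : (`[a, b] : set R) `<=` `]0, 1[ by apply: subset_itv; rewrite bnd_simp.
apply/integrableP; split; last by apply: (fi _ sub); exact: segment_compact.
by apply/measurable_EFinP; apply: measurable_funS mf.
Qed.

Lemma int01_test g phi : locally_integrable `]0, 1[ g -> test_function phi ->
  int01 (fun x => g x * phi x).
Proof.
move=> lg /test_functionP[sphi [a [b [a0 ab b1 phi0]]]].
have gi := locint_sub _ _ _ lg a0 b1.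
have cphi := smooth_continuous _ sphi.
have [M _ HM] : exists2 M : R, True & forall x, 0 <= x -> x <= 1 -> `|phi x| <= M.
  by have [M HM] := within01_bounded (continuous_subspaceT cphi); exists M.
have bphi : [bounded phi x | x in `[a, b]].
  rewrite /bounded_near; near=> N => x /=.
  rewrite in_itv/= => /andP[ax xb]; rewrite (le_trans (HM x _ _))//; lra.
have gphi : mu.-integrable `[a, b] (EFin \o (fun x => g x * phi x)).
  have := @integrableMl _ _ _ mu `[a, b] _ (EFin \o g) phi gi.
  apply => //; apply: measurable_funTS; exact: continuous_measurable_fun.
have : mu.-integrable `[0, 1] ((EFin \o (fun x => g x * phi x)) \_ `[a, b]).
  apply/(integrable_restrict _ _ _ _).1 => //.
  by rewrite setIidr//; apply: subset_itv; rewrite bnd_simp ltW.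
apply: eq_integrable => // x _; rewrite patchE; case: ifPn => //.
rewrite notin_setE/= in_itv/= => /negP xab; rewrite phi0 ?mulr0//.
by apply: contra xab => /andP[/ltW -> /ltW ->].
Unshelve. all: by end_near. Qed.

Lemma test_derive phi : test_function phi -> test_function (derive1 phi).
Proof.
move=> /test_functionP[sphi [a [b [a0 ab b1 phi0]]]].
(* Outside the enlarged interval [phi] vanishes in a whole neighbourhood, so its derivative there is
   that of a constant. *)
apply: (smooth_test _ (a / 2) ((b + 1) / 2)); [exact: smooth_derive1|lra|lra|].
move=> x; rewrite negb_and -!leNgt => xab.
have H : is_derive x (1 : R) phi 0.
  apply: (near_eq_is_derive _ (is_derive_cst (0 : R) x (1 : R))).
  case/orP : xab => [xa|bx].
    near=> t; rewrite phi0// negb_and -!leNgt; apply/orP; left.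
    by apply/ltW; near: t; apply: lt_nbhsl; lra.
  near=> t; rewrite phi0// negb_and -!leNgt; apply/orP; right.
  by apply/ltW; near: t; apply: lt_nbhsr; lra.
by rewrite derive1E; exact: derive_val.
Unshelve. all: by end_near. Qed.

Lemma prim_smooth phi : smooth phi -> prim phi (derive1 phi).
Proof.
move=> sphi.
have pid : prim (@id R) (cst 1).
  split; first exact: int01_cst.
  by move=> x y x0 xy y1; rewrite Rint_cst// mul1r.
have lphi : loclip (derive1 phi).
  apply: (loclip_derive _ (derive1 (derive1 phi))).
    exact: smooth_is_derive (smooth_derive1 _ sphi).
  exact: smooth_continuous (smooth_derive1 _ (smooth_derive1 _ sphi)).
apply: eq_prim (prim_comp _ _ _ _ (smooth_is_derive _ sphi) lphi pid) => x _ _ //=.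
by rewrite mul1r.
Qed.

Lemma prim_weak_derivative F f : prim F f -> weak_derivative F f.
Proof.
move=> Ff; have [fi _] := Ff; have Fi := within01_int01 (prim_continuous Ff).
have lf := locally_integrable01 _ fi; have lF := locally_integrable01 _ Fi.
split=> // phi tphi; have [sphi [a [b [a0 ab b1 phi0]]]] := test_functionP _ tphi.
have I1 := int01_test _ _ lF (test_derive _ tphi).
have I2 := int01_test _ _ lf tphi.
rewrite !Rint_oo//.
have [_ /(_ 0 1 (lexx _) ler01 (lexx _))] := primM _ _ _ _ Ff (prim_smooth _ sphi).
rewrite RintD// !phi0 ?mulr0 ?subrr; last 2 first.
- by apply/negP => /andP[]; lra.
- by apply/negP => /andP[]; lra.
by move=> /eqP; rewrite eq_sym addrC addr_eq0 => /eqP ->.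
Qed.

(** Lebesgue differentiation: almost every value of [g] is the derivative of a constant integral.
    Since [g] is only locally integrable, this is done on [[c, 1 - c]] for countably many [c]
    tending to 0. *)
Lemma locint_ae0 g : locally_integrable `]0, 1[ g ->
  (forall a b, 0 < a -> a <= b -> b < 1 -> Rint a b g = 0) -> ae01 (fun x => g x = 0).
Proof.
move=> lg H.
have Hn (n : nat) : {ae mu, forall x, n.+2%:R^-1 < x < 1 - n.+2%:R^-1 -> g x = 0}.
  set c : R := n.+2%:R^-1.
  have c0 : 0 < c by rewrite invr_gt0.
  have gi := locint_sub _ c (1 - c) lg c0 ltac:(lra).
  have giT : mu.-integrable setT (EFin \o (g \_ `[c, 1 - c])).
    by rewrite -restrict_EFin; apply/(integrable_mkcond _ _).1.
  have giy : forall y : R, mu.-integrable [set` Interval (BLeft c) (BRight y)]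
      (EFin \o g \_ `[c, (1 - c)]) by move=> y; apply: integrableS giT.
  have := @FTC1 R (g \_ `[c, 1 - c]) (BLeft c) giy (integrable_locally (measurable_itv _) gi).
  apply: ae_sub => x Hx /andP[cx x1].
  have [_] := Hx (ltac:(by rewrite (@lte_fin R))).
  rewrite patchE mem_set/=; last by rewrite in_itv/= !ltW.
  move=> <-; rewrite derive1E.
  have : is_derive x (1 : R) (fun x => \int[mu]_(t in [set` Interval (BLeft c) (BRight x)])
      (g \_ `[c, (1 - c)]) t) 0.
    apply: (near_eq_is_derive _ (is_derive_cst (0 : R) x (1 : R))).
    near=> t.
    have ct : c < t by near: t; apply: lt_nbhsr.
    have t1 : t < 1 - c by near: t; apply: lt_nbhsl.
    rewrite -(H c t) ?ltW//; last by lra.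
    apply: eq_Rintegral => s; rewrite inE/= in_itv/= => /andP[cs st].
    by rewrite patchE mem_set//= in_itv/= cs (le_trans st)// ltW.
  by move=> h; exact: derive_val.
have := @ae_foralln _ _ _ _ _ Hn; apply: ae_sub => x Hx; rewrite in_itv/= => /andP[x0 x1].
have m0 : 0 < Order.min x (1 - x) by rewrite lt_min x0 subr_gt0.
have [n nP] : exists n : nat, n.+2%:R^-1 < Order.min x (1 - x).
  have [n _ /(_ _ (leqnn _))] := near_infty_natSinv_lt (PosNum m0) => /= h.
  exists n; apply: le_lt_trans h; rewrite lef_pV2 ?posrE// ler_nat//.
move: (n.+2%:R^-1) nP (Hx n) => c; rewrite lt_min => /andP[? ?]; apply.
by apply/andP; split; lra.
Unshelve. all: by end_near. Qed.

(** The fundamental lemma of the calculus of variations: testing with [cutoff a b n] and dominated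
    convergence show that [g] has integral 0 over every [[a, b]]. *)
Lemma vanish_ae0 g : locally_integrable `]0, 1[ g ->
  (forall phi, test_function phi -> Rint 0 1 (fun x => g x * phi x) = 0) ->
  ae01 (fun x => g x = 0).
Proof.
move=> lg H; apply: locint_ae0 => // a b a0 ab b1.
have gi := locint_sub _ _ _ lg a0 b1.
have tcut n : test_function (cutoff a b n).
  apply: (smooth_test _ a b) => //; first exact: smooth_cutoff.
  by move=> x; exact: cutoff_eq0.
have sub1 : (`]a, b[ : set R) `<=` `[a, b] by exact: subset_itvW.
have sub2 : (`[a, b] : set R) `<=` `[0, 1] by apply: subset_itv; rewrite bnd_simp ltW.
have gio : mu.-integrable `]a, b[ (EFin \o g) by apply: integrableS gi.
have mg : measurable_fun (`]a, b[ : set R) g.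
  by apply/measurable_EFinP; exact: measurable_int gio.
have cv : (\int[mu]_(x in `]a, b[) (g x * cutoff a b n x)%:E)%E @[n --> \oo] -->
    (\int[mu]_(x in `]a, b[) (g x)%:E)%E.
  apply: (@dominated_cvg _ _ _ mu _ _ _ _ (fun x => `|g x|%:E)) => //.
  - move=> n; apply/measurable_EFinP; apply: measurable_funM => //.
    apply: measurable_funTS; apply: continuous_measurable_fun.
    exact: smooth_continuous (smooth_cutoff a b n).
  - move=> x; rewrite /= in_itv/= => axb.
    apply/fine_cvgP; split; first exact: nearW.
    rewrite -[X in _ --> X]mulr1; apply: cvgM; first exact: cvg_cst.
    exact: cutoff_cvg.
  - exact: integrable_abse gio.
  - move=> n x _; rewrite lee_fin normrM ler_piMr//.
    by rewrite (ger0_norm (cutoff_ge0 _ _ _ _)) cutoff_le1.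
have cst0 n : (\int[mu]_(x in `]a, b[) (g x * cutoff a b n x)%:E)%E = 0%E.
  have I := int01_test _ _ lg (tcut n).
  rewrite -[LHS]fineK; last by apply: integrable_fin_num => //; apply: integrableS I => //;
    exact: subset_trans sub2.
  congr EFin; rewrite -[RHS](H _ (tcut n)) /Rint.
  rewrite [LHS]Rintegral_mkcond [RHS]Rintegral_mkcond; apply: eq_Rintegral => x _.
  rewrite !patchE; case: ifPn => [|xab]; case: ifPn => //.
    by move=> x01 xab; move: x01; rewrite notin_setE => /(_ _); case; apply/sub2/sub1/set_mem.
  move=> _; rewrite cutoff_eq0 ?mulr0//; apply: contra xab => xab.
  by rewrite inE/= in_itv.
move: cv; under eq_fun do rewrite cst0; move=> /cvg_lim => /(_ (@ereal_hausdorff R)).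
rewrite lim_cst; last exact: ereal_hausdorff.
move=> /(congr1 fine) /= I0; rewrite /Rint -Rintegral_itv_obnd_cbnd; last first.
  by apply: integrableS gi => //; apply: subset_itvr; rewrite bnd_simp.
by rewrite -Rintegral_itv_bndo_bndc// -[RHS]I0.
Qed.

Lemma weak_derivative_uniq f g1 g2 : weak_derivative f g1 -> weak_derivative f g2 ->
  ae01 (fun x => g1 x = g2 x).
Proof.
move=> [_ l1 H1] [_ l2 H2].
suff : ae01 (fun x => g1 x - g2 x = 0).
  by move=> h; apply: ae01_imp h => x _ _ /eqP; rewrite subr_eq0 => /eqP.
apply: (vanish_ae0 (fun x => g1 x - g2 x)); first exact: locally_integrableB.
move=> phi tphi; have I1 := int01_test _ _ l1 tphi; have I2 := int01_test _ _ l2 tphi.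
have := H1 _ tphi; rewrite (H2 _ tphi) !Rint_oo// => /oppr_inj E.
rewrite (_ : (fun x => _) = (fun x => g1 x * phi x - g2 x * phi x)).
  by rewrite RintB// E subrr.
by apply/funext => x; rewrite mulrBl.
Qed.

(** If every test function had integral 0, the fundamental lemma would make the constant 1 vanish
    almost everywhere. *)
Lemma exists_unit_test : exists2 eta : R -> R, test_function eta & Rint 0 1 eta = 1.
Proof.
have [phi [tphi phiN0]] : exists phi : R -> R, test_function phi /\ Rint 0 1 phi != 0.
  apply: contrapT => H.
  have l1 : locally_integrable `]0, 1[ (cst (1 : R)) by exact: locally_integrable01 (int01_cst _).
  have v phi : test_function phi -> Rint 0 1 (fun x => cst 1 x * phi x) = 0.
    move=> tphi; apply/eqP; apply: contrapT => /negP h; apply: H; exists phi; split=> //.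
    by move: h; rewrite (_ : (fun x => _) = phi)//; apply/funext => x; rewrite mul1r.
  have [z z0 _] := ae01_dense _ (vanish_ae0 (cst 1) l1 v) 0 1 (lexx _) ltr01 (lexx _).
  by move: (oner_neq0 R); rewrite [X in X != 0]z0 eqxx.
have [sphi [a [b [a0 ab b1 phi0]]]] := test_functionP _ tphi.
exists (fun x => (Rint 0 1 phi)^-1 * phi x).
  have H := smooth_affine _ (Rint 0 1 phi)^-1 1 0 sphi.
  rewrite (_ : (fun x => _) = (fun x => (Rint 0 1 phi)^-1 * phi x)) in H; last first.
    by apply/funext => x; rewrite mul1r addr0.
  by apply: (smooth_test _ a b H a0 b1) => x h; rewrite phi0 ?mulr0.
rewrite RintZ ?mulVf//.
exact: within01_int01 (continuous_subspaceT (smooth_continuous _ sphi)).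
Qed.

(** To the left of [a] the integral from 0 vanishes, also for negative arguments, where the interval
    is empty; to the right of [b] it is the total integral, assumed to be 0. Hence the primitive has
    compact support. *)
Lemma test_primitive chi : test_function chi -> Rint 0 1 chi = 0 ->
  exists2 phi, test_function phi & derive1 phi = chi.
Proof.
move=> /test_functionP[schi [a [b [a0 ab b1 chi0]]]] I0.
pose phi x := Rint 0 x chi.
have ci : int01 chi by exact: within01_int01 (continuous_subspaceT (smooth_continuous _ schi)).
have phi0 x : x <= a -> phi x = 0.
  move=> xa; rewrite /phi (eq_Rint chi (cst 0)).
    by rewrite /Rint Rintegral_cst// mul0r.
  move=> t t0 tx; rewrite chi0// negb_and -!leNgt; apply/orP; left; lra.
have phi1 x : b <= x -> phi x = 0.
  move=> bx; transitivity (Rint 0 1 chi); last exact: I0.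
  rewrite /phi /Rint.
  rewrite [LHS]Rintegral_mkcond [RHS]Rintegral_mkcond; apply: eq_Rintegral => t _.
  rewrite !patchE; have [bt|tb] := leP b t.
    rewrite chi0; first by do 2 case: ifPn.
    by rewrite negb_and -!leNgt bt orbT.
  have -> : (t \in `[0, x]%classic) = (t \in `[0, 1]%classic).
    apply/idP/idP; rewrite !inE/= !in_itv/= => /andP[-> _] /=; lra.
  by [].
have dphi x : is_derive x (1 : R) phi (chi x).
  have [xa|ax] := ltP x a.
    rewrite chi0; last by rewrite negb_and -!leNgt (ltW xa).
    apply: (near_eq_is_derive _ (is_derive_cst (0 : R) x (1 : R))).
    by near=> t; rewrite phi0//; apply/ltW; near: t; apply: lt_nbhsl.
  have cix : mu.-integrable `[0, x + 1] (EFin \o chi).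
    apply: continuous_compact_integrable; first exact: segment_compact.
    exact: continuous_subspaceT (smooth_continuous _ schi).
  have [dx <-] := @continuous_FTC1_closed R chi 0 x (x + 1) (ltac:(lra)) cix
    (ltac:(lra)) (smooth_continuous _ schi x).
  by rewrite derive1E; apply: derivableP.
have sphi := smooth_prim _ _ dphi schi.
exists phi; last by apply/funext => x; rewrite derive1E; exact: derive_val.
apply: (smooth_test _ (a / 2) ((b + 1) / 2)); [exact: sphi|lra|lra|].
move=> x; rewrite negb_and -!leNgt => /orP[h|h]; [apply: phi0|apply: phi1]; lra.
Unshelve. all: by end_near. Qed.

(** The du Bois-Reymond lemma. The difference [d] of [f] and the primitive of [g] integrates to 0
    against derivatives of test functions. For any test function [chi], subtracting its integral
    times the unit test function [eta] gives such a derivative; so [d] acts on [chi] as the constant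
    [c], the integral of [d eta]. *)
Lemma weak_derivative_prim f g : weak_derivative f g -> int01 g ->
  exists c, ae01 (fun x => f x = c + Rint 0 x g).
Proof.
move=> [lf lg H] gi; have Gg := prim_Rint g gi.
have [lG _ HG] := prim_weak_derivative _ _ Gg.
have [eta teta Ieta] := exists_unit_test.
pose d x := f x - Rint 0 x g; have ld : locally_integrable `]0, 1[ d by exact: locally_integrableB.
have Hd phi : test_function phi -> Rint 0 1 (fun x => d x * derive1 phi x) = 0.
  move=> tphi; have tdphi := test_derive _ tphi.
  have I1 := int01_test _ _ lf tdphi; have I2 := int01_test _ _ lG tdphi.
  rewrite (_ : (fun x => _) = (fun x => f x * derive1 phi x - Rint 0 x g * derive1 phi x)).
    by rewrite RintB// -!Rint_oo// H// HG// subrr.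
  by apply/funext => x; rewrite mulrBl.
pose c := Rint 0 1 (fun x => d x * eta x); exists c.
suff : ae01 (fun x => d x - cst c x = 0).
  move=> h; apply: ae01_imp h => x _ _ /eqP; rewrite subr_eq0 => /eqP /= <-.
  by rewrite /d subrK.
have lc : locally_integrable `]0, 1[ (cst c) by exact: locally_integrable01 (int01_cst _).
apply: (vanish_ae0 (fun x => d x - cst c x)); first exact: locally_integrableB.
move=> chi tchi.
have [schi [a [b [a0 ab b1 chi0]]]] := test_functionP _ tchi.
have [seta [a' [b' [a'0 ab' b'1 eta0]]]] := test_functionP _ teta.
have chii := within01_int01 (continuous_subspaceT (smooth_continuous _ schi)).
have etai := within01_int01 (continuous_subspaceT (smooth_continuous _ seta)).
pose k := Rint 0 1 chi.
have tz : test_function (fun x => chi x - k * eta x).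
  apply: (smooth_test _ (Order.min a a') (Order.max b b')).
  - exact: smoothB_scale.
  - by rewrite lt_min a0.
  - by rewrite gt_max b1.
  move=> x h; rewrite chi0 ?eta0 ?mulr0 ?subrr//; apply: contra h => /andP[h1 h2];
    by rewrite gt_min lt_max h1 h2 ?orbT.
have [|phi tphi dphi] := test_primitive _ tz.
  by rewrite RintB ?RintZ ?Ieta ?mulr1 ?subrr//; exact: int01Z.
have I1 := int01_test _ _ ld tchi; have I2 := int01_test _ _ ld teta.
have := Hd _ tphi; rewrite dphi.
rewrite (_ : (fun x => _) = (fun x => d x * chi x - k * (d x * eta x))); last first.
  by apply/funext => x; ring.
rewrite RintB ?RintZ//; last exact: int01Z.
rewrite -/c => E.
rewrite (_ : (fun x => _) = (fun x => d x * chi x - c * chi x)); last first.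
  by apply/funext => x /=; ring.
rewrite RintB ?RintZ//; last exact: int01Z.
by rewrite -/k mulrC.
Qed.

Lemma continuous_ae_eq F G : {within `[0, 1], continuous F} -> {within `[0, 1], continuous G} ->
  ae01 (fun x => F x = G x) -> forall x, 0 <= x -> x <= 1 -> F x = G x.
Proof.
move=> /within01P cF /within01P cG FG x x0 x1.
have x01 : 0 <= x <= 1 by rewrite x0.
apply/eqP; rewrite -subr_eq0 -normr_le0; apply/ler_addgt0Pl => e e0; rewrite addr0.
have e20 : 0 < e / 2 by lra.
have [d1 d10 H1] := cF x x01 _ e20; have [d2 d20 H2] := cG x x01 _ e20.
have [z FGz] : exists2 z, F z = G z & 0 <= z <= 1 /\ `|z - x| < Order.min d1 d2.
  have m0 : 0 < Order.min d1 d2 by rewrite lt_min d10.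
  have [xh|hx] := leP x (1 / 2).
    have [z FGz /andP[xz zx]] := ae01_dense _ FG x (Order.min 1 (x + Order.min d1 d2))
      x0 (ltac:(by rewrite lt_min; apply/andP; split; lra)) (ltac:(by rewrite ge_min lexx)).
    exists z => //; move: zx; rewrite lt_min => /andP[z1 zm].
    by rewrite gtr0_norm ?subr_gt0//; split; [apply/andP; split; lra|lra].
  have [z FGz /andP[xz zx]] := ae01_dense _ FG (Order.max 0 (x - Order.min d1 d2)) x
    (ltac:(by rewrite le_max lexx)) (ltac:(by rewrite gt_max; apply/andP; split; lra)) x1.
  exists z => //; move: xz; rewrite gt_max => /andP[z1 zm].
  by rewrite ltr0_norm ?subr_lt0//; split; [apply/andP; split; lra|lra].
rewrite lt_min => -[z01 /andP[zd1 zd2]].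
have := H1 z z01 zd1; have := H2 z z01 zd2; rewrite FGz => h1 h2.
rewrite (_ : F x - G x = (G z - G x) - (G z - F x)); last by ring.
by rewrite (le_trans (ler_normB _ _))//; lra.
Qed.

End weak.

(** * The space H^2_0 and the elastica functional in terms of primitives *)

Section H20_prim.
Context {R : realType}.
Local Notation mu := (@lebesgue_measure R).
Implicit Types (f g F G v p q : R -> R) (x y z s a b c : R).

Lemma L2_int01 f : L2 f -> int01 f /\ int01 (fun x => f x ^+ 2).
Proof.
move=> Lf; have := Lfun2_integrable_sqr Lf => i2.
have mf : measurable_fun (`]0, 1[ : set R) f.
  apply/(measurable_restrictT _ _).2 => //.
  by move: Lf; rewrite /L2 inE => /andP[]; rewrite inE.
have f2 : int01 (fun x => f x ^+ 2).
  apply/int01_oo; apply/(integrable_mkcond _ _).2 => //.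
  apply: eq_integrable i2 => // x _ /=; rewrite !patchE; case: ifPn => //= _.
  by rewrite expr0n.
split=> //; apply: (int01_le (g := fun x => 1 + f x ^+ 2)).
- exact: measurable01_oo.
- move=> x _ _; have := sqr_ge0 (`|f x| - 1); have := normr_ge0 (f x).
  by rewrite -[f x ^+ 2]real_normK ?num_real//; nra.
- by apply: int01D => //; exact: (int01_cst 1).
Qed.

Lemma L2_intro f : measurable_fun (`]0, 1[ : set R) f -> int01 (fun x => f x ^+ 2) -> L2 f.
Proof.
move=> mf f2; have mfT := (measurable_restrictT _ (measurable_itv _)).1 mf.
rewrite /L2 inE; apply/andP; split; rewrite inE//=.
rewrite /finite_norm unlock.
have : mu.-integrable setT ((EFin \o (fun x => f x ^+ 2)) \_ `]0, 1[).
  by apply/(integrable_mkcond _ _).1 => //; exact/int01_oo.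
move=> /integrableP[_ H]; apply: poweR_lty; apply: le_lt_trans H.
rewrite le_eqVlt; apply/orP; left; apply/eqP; apply: eq_integral => x _.
rewrite /= !patchE; case: ifPn => _ /=; last by rewrite normr0 powR0// normr0.
by rewrite powR_mulrn// real_normK ?num_real// ger0_norm// sqr_ge0.
Qed.

Lemma eq_weak_derivative f f' g : ae01 (fun x => f x = f' x) ->
  locally_integrable `]0, 1[ f' -> weak_derivative f g -> weak_derivative f' g.
Proof.
move=> ff' lf' [lf lg H]; split=> // phi tphi; rewrite -H// !Rint_oo//; last first.
- exact: int01_test lf' (test_derive _ tphi).
- exact: int01_test lf (test_derive _ tphi).
apply: ae_Rint => //.
- by apply: (ae01_imp _ _ _ ff') => x _ _ ->.
- exact: int01_test lf' (test_derive _ tphi).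
- exact: int01_test lf (test_derive _ tphi).
Qed.

Lemma wderivP f : weakly_differentiable f -> weak_derivative f (wderiv f).
Proof. by move=> [g fg]; rewrite /wderiv; case: xgetP => [y _ //|/(_ g)]. Qed.

Lemma wderiv_ae f g : weak_derivative f g -> ae01 (fun x => wderiv f x = g x).
Proof.
by move=> fg; apply: (weak_derivative_uniq f) => //; apply: wderivP; exists g.
Qed.

(** [p] is the continuous representative of v' and [q] a density of [p], that is v''. The analysis
    uses these explicit functions in place of [wderiv], an arbitrary choice among almost everywhere
    equal functions. *)
Definition H20_derivs v p q : Prop :=
  [/\ prim v p, prim p q, int01 (fun x => q x ^+ 2) & [/\ v 0 = 0, v 1 = 0, p 0 = 0 & p 1 = 0]].

Lemma ae01_sym f g : ae01 (fun x => f x = g x) -> ae01 (fun x => g x = f x).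
Proof. by apply: ae01_imp. Qed.

(** Weak derivatives give the integral identities up to null sets, and the continuity of [v] and [p]
    extends them to all of [0, 1]. Conversely, [wderiv] agrees almost everywhere with [p] and then
    with [q], so integrability carries over. *)
Lemma H20P v : H20 v <-> exists p q, H20_derivs v p q.
Proof.
split.
  move=> [[cv wv wwv [L0 L1 L2']] v0 v1 [p [cp vp p0 p1]]].
  exists p, (wderiv (wderiv v)).
  have [qi q2] := L2_int01 _ L2'.
  have aep : ae01 (fun x => wderiv v x = p x) by exact: wderiv_ae.
  have pi : int01 p by exact: within01_int01.
  have Vp : prim v p.
    have [c vc] := weak_derivative_prim _ _ vp pi.
    have P := prim_shift c _ _ (prim_Rint _ pi).
    apply: (eq_prim _ _ _ _ _ _ P) => // x x0 x1.
    by apply: (continuous_ae_eq _ _ (prim_continuous P) cv) x0 x1; exact: ae01_sym.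
  have Pq : prim p (wderiv (wderiv v)).
    have [c pc] := weak_derivative_prim _ _ (wderivP _ wwv) qi.
    have P := prim_shift c _ _ (prim_Rint _ qi).
    apply: (eq_prim _ _ _ _ _ _ P) => // x x0 x1.
    apply: (continuous_ae_eq _ _ (prim_continuous P) cp) x0 x1.
    by apply: (ae01_imp _ _ _ (ae01_and _ _ pc aep)) => y _ _ [<- <-].
  by split.
move=> [p [q [Vp Pq q2 [v0 v1 p0 p1]]]].
have wvp := prim_weak_derivative _ _ Vp; have wpq := prim_weak_derivative _ _ Pq.
have aep := wderiv_ae _ _ wvp.
have wdv : weakly_differentiable v by exists p.
have [_ lw _] := wderivP _ wdv.
have wwq : weak_derivative (wderiv v) q by apply: eq_weak_derivative wpq => //; exact: ae01_sym.
have aeq := wderiv_ae _ _ wwq.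
have wdw : weakly_differentiable (wderiv v) by exists q.
have [_ lww _] := wderivP _ wdw.
have cv := prim_continuous Vp; have cp := prim_continuous Pq.
have sq_int (f : R -> R) : {within `[0, 1], continuous f} -> int01 (fun x => f x ^+ 2).
  move=> cf; apply: int01M; [exact: within01_int01|exact: within01_measurable|].
  exact: within01_bounded.
have sq_loc (f g : R -> R) : ae01 (fun x => f x = g x) -> locally_integrable `]0, 1[ f ->
    int01 (fun x => g x ^+ 2) -> L2 f.
  move=> fg [mf _ _] g2; apply: L2_intro => //; apply: ae_int01 g2.
    by apply: (ae01_imp _ _ _ fg) => x _ _ ->.
  by apply: measurable_funX; exact: measurable01_oo.
split=> //; last by exists p.
split=> //; split.
- apply: L2_intro; last exact: sq_int.
  by apply: measurable_funS (within01_measurable cv) => //; exact: subset_itvW.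
- exact: sq_loc aep lw (sq_int _ cp).
- exact: sq_loc aeq lww q2.
Qed.

Lemma H20_derivs_wderiv v p q : H20_derivs v p q ->
  [/\ ae01 (fun x => wderiv v x = p x), ae01 (fun x => wderiv (wderiv v) x = q x),
     measurable_fun (`]0, 1[ : set R) (wderiv v) &
     measurable_fun (`]0, 1[ : set R) (wderiv (wderiv v))].
Proof.
move=> [Vp Pq q2 _].
have wvp := prim_weak_derivative _ _ Vp; have wpq := prim_weak_derivative _ _ Pq.
have aep := wderiv_ae _ _ wvp.
have wdv : weakly_differentiable v by exists p.
have [_ lw _] := wderivP _ wdv.
have wwq : weak_derivative (wderiv v) q by apply: eq_weak_derivative wpq => //; exact: ae01_sym.
have aeq := wderiv_ae _ _ wwq.
have wdw : weakly_differentiable (wderiv v) by exists q.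
have [_ lww _] := wderivP _ wdw.
by split=> //; [case: lw|case: lww].
Qed.

(** All weights of the proof belong to this family, on which multiplication adds exponents and
    differentiation lowers the exponent by 1 at the cost of a factor [2 a s]. *)
Definition pw (a s : R) : R := (1 + s ^+ 2) `^ a.

Lemma pw_base s : 0 < 1 + s ^+ 2.
Proof. by rewrite ltr_pwDl// sqr_ge0. Qed.

Lemma pw_gt0 a s : 0 < pw a s.
Proof. exact: powR_gt0 (pw_base s). Qed.

Lemma pwM a b s : pw a s * pw b s = pw (a + b) s.
Proof. by rewrite /pw -powRD//; apply/implyP => _; rewrite gt_eqF// pw_base. Qed.

Lemma pwN a s : pw (- a) s = (pw a s)^-1.
Proof. by rewrite /pw powRN. Qed.

Lemma pw_opp a s : pw a (- s) = pw a s.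
Proof. by rewrite /pw sqrrN. Qed.

Lemma is_derive_pw a s : is_derive s (1 : R) (pw a) (2 * a * s * pw (a - 1) s).
Proof.
have d1 : is_derive s (1 : R) (fun s : R => 1 + s ^+ 2) (0 + 2 * s).
  exact: (is_derive_add (cst 1) _ 0 _ s (is_derive_cst _ _ _) (is_derive_sqr s)).
have d2 : is_derive (1 + s ^+ 2) (1 : R) (fun x => x `^ a) (a * (1 + s ^+ 2) `^ (a - 1)).
  exact: is_derive1_powR (pw_base s).
have H := @is_derive1_comp _ (fun x => x `^ a) (fun s => 1 + s ^+ 2) s _ _ d2 d1.
by apply: (is_derive_ext _ _ _ _ H); rewrite /pw; ring.
Qed.

Lemma pw_continuous a : continuous (pw a).
Proof. exact: is_derive_continuous (is_derive_pw a). Qed.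

Lemma loclip_pw a : loclip (pw a).
Proof.
apply: loclip_derive (is_derive_pw a) _ => s.
apply: cvgM; last exact: pw_continuous.
by apply: cvgM; [exact: cvg_cst|exact: cvg_id].
Qed.

Lemma is_derive_idpw c a s : is_derive s (1 : R) (fun s => c * (s * pw a s))
  (c * (1 * pw a s + s * (2 * a * s * pw (a - 1) s))).
Proof.
exact: (is_derive_scale _ _ _ _ (is_derive_mul (@id R) (pw a) _ _ _ (is_derive_id s _) (is_derive_pw a s))).
Qed.

Lemma loclip_idpw c a : loclip (fun s => c * (s * pw a s)).
Proof.
apply: loclip_derive (is_derive_idpw c a) _ => s.
apply: cvgM; first exact: cvg_cst.
apply: cvgD; first by apply: cvgM; [exact: cvg_cst|exact: pw_continuous].
apply: cvgM; first exact: cvg_id.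
apply: cvgM; last exact: pw_continuous.
by apply: cvgM; [exact: cvg_cst|exact: cvg_id].
Qed.

Lemma bddmeas_comp r P p : prim P p -> loclip r -> bddmeas (fun x => r (P x)).
Proof.
move=> Pp lr; have := ucont01_continuous (ucont01_comp _ _ lr (prim_ucont Pp)) => c.
by split; [exact: within01_measurable|exact: within01_bounded].
Qed.

Lemma int01_comp f r P p : int01 f -> prim P p -> loclip r -> int01 (fun x => f x * r (P x)).
Proof.
by move=> fi Pp lr; have [m b] := bddmeas_comp _ _ _ Pp lr; exact: int01M.
Qed.

Lemma elasticaE v p q : H20_derivs v p q ->
  elastica v = (Rint 0 1 (fun x => q x ^+ 2 * pw (- (5 / 2)) (p x)))%:E.
Proof.
move=> vpq; have [aep aeq mp mq] := H20_derivs_wderiv _ _ _ vpq.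
have [Vp Pq q2 _] := vpq.
have I := int01_comp _ _ _ _ q2 Pq (loclip_pw (- (5 / 2))).
rewrite -Rint_oo// /Rintegral fineK; last by apply: integrable_fin_num => //; exact/int01_oo.
apply: ae_eq_integral => //.
- apply/measurable_EFinP; apply: measurable_funM; first exact: measurable_funX.
  have m : measurable_fun setT (fun s : R => ((1 + s ^+ 2) `^ (5 / 2))^-1 : R).
    under eq_fun do rewrite -/(pw _ _) -pwN.
    by apply: continuous_measurable_fun; exact: pw_continuous.
  exact: (measurableT_comp m mp).
- by apply: measurable_int; exact/int01_oo.
- apply: ae_sub (ae01_and _ _ aep aeq) => x H x01; have [-> ->] := H x01.
  by rewrite pwN.
Qed.

End H20_prim.

(** * The a priori bound *)

Section Euler.
Context {R : realType}.
Local Notation mu := (@lebesgue_measure R).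
Implicit Types (f g F G v p q : R -> R) (x y z s a b c : R).

(** The integrand of c0, which is also the square root of the weight of the functional. *)
Let g54 := pw (- (5 / 4)) : R -> R.

Lemma Rint_catT f x y z : continuous f -> x <= z -> z <= y ->
  Rint x y f = Rint x z f + Rint z y f.
Proof.
move=> cf xz zy; rewrite /Rint.
have fi a b : mu.-integrable `[a, b] (EFin \o f).
  apply: continuous_compact_integrable; first exact: segment_compact.
  exact: continuous_subspaceT.
have := @Rintegral_itvB _ f (BLeft x) (BRight y) z (fi x y).
rewrite !bnd_simp => /(_ xz zy) /eqP; rewrite subr_eq addrC => /eqP ->.
by rewrite Rintegral_itv_obnd_cbnd//; apply: integrableS (fi z y) => //;
  apply: subset_itv; rewrite bnd_simp.
Qed.

Lemma Rint_rev f x y : y <= x -> Rint x y f = 0.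
Proof.
rewrite le_eqVlt => /predU1P[->|yx]; first exact: Rint_xx.
by rewrite /Rint set_itv_ge ?Rintegral_set0// bnd_simp -ltNge.
Qed.

(* One of the two integrals is over the empty set, so this is the oriented integral from 0 to s. *)
Definition Euler s : R := Rint 0 s g54 - Rint s 0 g54.

Lemma is_derive_Euler s : is_derive s (1 : R) Euler (g54 s).
Proof.
have cg : continuous g54 by exact: pw_continuous.
(* A base point to the left of both 0 and [s]: near [s], [Euler] differs by a constant from the
   integral starting at [- B], to which the fundamental theorem of calculus applies. *)
pose B := `|s| + 1.
have Bs : - B < s by have := ler_norm (- s); rewrite normrN /B; lra.
have B0 : - B < 0 by have := normr_ge0 s; rewrite /B; lra.
have gi : mu.-integrable `[- B, s + 1] (EFin \o g54).
  by apply: continuous_compact_integrable; [exact: segment_compact|exact: continuous_subspaceT].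
have [dJ JE] := @continuous_FTC1_closed R g54 (- B) s (s + 1) (ltac:(lra)) gi Bs (cg s).
have H : is_derive s (1 : R) (fun t => Rint (- B) t g54) (g54 s).
  by rewrite -JE derive1E; exact: derivableP.
have H2 := is_derive_sub _ _ _ _ s H (is_derive_cst (Rint (- B) 0 g54) s (1 : R)).
rewrite subr0 in H2; apply: (near_eq_is_derive _ H2).
near=> t.
have Bt : - B < t by near: t; apply: lt_nbhsr.
rewrite /Euler /=; have [t0|t0] := leP 0 t.
  by rewrite (Rint_rev g54 t 0)// (Rint_catT g54 (- B) t 0) ?(ltW B0)//; ring.
rewrite (Rint_rev g54 0 t) ?(ltW t0)// (Rint_catT g54 (- B) 0 t) ?(ltW Bt) ?(ltW t0)//; ring.
Unshelve. all: by end_near. Qed.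

Lemma Euler0 : Euler 0 = 0.
Proof. by rewrite /Euler subrr. Qed.

Lemma Euler_opp s : Euler (- s) = - Euler s.
Proof.
have H x : is_derive x (1 : R) (fun t => Euler t + Euler (- t)) 0.
  have d1 := is_derive_opp _ _ _ (is_derive_id x (1 : R)).
  have d2 := @is_derive1_comp _ Euler (fun t => - t) x _ _ (is_derive_Euler (- x)) d1.
  apply: (is_derive_ext _ _ _ _ (is_derive_add _ _ _ _ _ (is_derive_Euler x) d2)).
  by rewrite /g54 pw_opp; ring.
have := is_derive_0_is_cst s 0 H.
by rewrite oppr0 Euler0 addr0 => /eqP; rewrite addrC addr_eq0 => /eqP.
Qed.

Lemma Euler_continuous : continuous Euler.
Proof. exact: is_derive_continuous is_derive_Euler. Qed.

Lemma Euler_le s t : s <= t -> Euler s <= Euler t.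
Proof.
move=> st; rewrite -subr_ge0.
have [c _ ->] := @MVT_segment R Euler g54 s t st (fun x _ => is_derive_Euler x)
  (continuous_subspaceT Euler_continuous).
by rewrite mulr_ge0 ?subr_ge0// ltW// pw_gt0.
Qed.

(** By evenness c0 is twice the integral over the positive half line, and this integral is the
    supremum of [Euler]. *)
Lemma c0_lt_Euler a : a < c0 R -> exists2 s, 0 <= s & a < 2 * Euler s.
Proof.
move=> ac; apply: contrapT => H.
have Ea s : Euler s <= a / 2.
  have [s0|/ltW s0] := leP 0 s.
    rewrite leNgt; apply/negP => h; apply: H; exists s => //; lra.
  apply: (le_trans (Euler_le _ _ s0)); rewrite leNgt; apply/negP => h; apply: H; exists 0 => //; lra.
have ub : has_ubound (range Euler) by exists (a / 2) => _ [s _ <-].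
have Ecv := nondecreasing_cvgr (fun s t => Euler_le s t) ub.
have g0 s : 0 <= g54 s by exact: ltW (pw_gt0 _ _).
have cg : continuous g54 by exact: pw_continuous.
have dE : forall x, 0 < x -> derivable Euler x 1.
  by move=> x _; exact: (@ex_derive _ _ _ _ _ _ _ (is_derive_Euler x)).
have E0 : Euler x @[x --> (0 : R)^'+] --> Euler 0.
  by apply: cvg_at_right_filter; exact: Euler_continuous.
have EE : {in `]0 : R, +oo[, derive1 Euler =1 g54}.
  by move=> x _; rewrite derive1E; exact: (@derive_val _ _ _ _ _ _ _ (is_derive_Euler x)).
have := @ge0_continuous_FTC2y R g54 Euler 0 _ (fun x _ => g0 x) (continuous_subspaceT cg)
  Ecv dE E0 EE.
rewrite Euler0 sube0 => I.
have := ge0_symfun_integralT g0 cg (fun s => esym (pw_opp _ s)).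
rewrite -set_itvcy I -EFinM => c0E.
move: ac; rewrite /c0 /Rintegral.
under eq_integral do rewrite -/(pw _ _) -pwN.
rewrite c0E /= ltNge => /negP; apply.
suff : sup (range Euler) <= a / 2 by lra.
by apply: ge_sup; [exists (Euler 0), 0|move=> _ [s _ <-]].
Qed.

(** The density [z] of [Euler (p x)] squares to the integrand of the functional. As [p] vanishes at
    0 and at 1, [|Euler (p x)|] is bounded by the integral of [|z|] over [[0, x]] and also by that
    over [[x, 1]]; adding the two gives the factor 2. *)
Lemma elastica_Euler_bound v p q : H20_derivs v p q -> forall x, 0 <= x -> x <= 1 ->
  (2 * Euler (p x)) ^+ 2 <= Rint 0 1 (fun t => q t ^+ 2 * pw (- (5 / 2)) (p t)).
Proof.
move=> [Vp Pq q2 [v0 v1 p0 p1]] x x0 x1.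
have Zz := prim_comp _ _ _ _ is_derive_Euler (loclip_pw _) Pq.
have [zi ZE] := Zz.
set z := fun t => _ in Zz zi ZE.
have sq t : q t ^+ 2 * pw (- (5 / 2)) (p t) = z t ^+ 2.
  rewrite /z exprMn [g54 _ ^+ 2]expr2 pwM; congr (_ * pw _ _); lra.
have z2 : int01 (fun t => z t ^+ 2).
  by apply: eq_int01 (int01_comp _ _ _ _ q2 Pq (loclip_pw (- (5 / 2)))) => t _ _; rewrite sq.
rewrite (eq_Rint _ (fun t => z t ^+ 2)); last by move=> t _ _; exact: sq.
have CS := Rint_cauchy_schwarz z 0 1 zi z2 (lexx _) ler01 (lexx _).
rewrite subr0 mul1r in CS; apply: le_trans CS.
have h1 := normr_Rint z 0 x zi (lexx _) x1; rewrite -ZE//= p0 Euler0 subr0 in h1.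
have h2 := normr_Rint z x 1 zi x0 (lexx _); rewrite -ZE//= p1 Euler0 sub0r normrN in h2.
rewrite -(@real_normK _ (2 * _)) ?num_real// ler_sqr ?nnegrE ?normr_ge0//; last first.
  by apply: Rint_ge0.
rewrite (Rint_cat (fun t => `|z t|) 0 1 x) ?lexx//; last exact: int01_norm.
by rewrite normrM ger0_norm//; lra.
Qed.

End Euler.

(** * Existence of a minimizer *)

Import HBNNSimple HBSimple.

Section weak_compactness.
Context {R : realType}.
Local Notation mu := (@lebesgue_measure R).
Implicit Types (f g F G v p q s : R -> R) (x y z a b c : R).
Variable U : set_system nat.
Hypothesis UU : UltraFilter U.

(** In a compact interval an ultrafilter converges to any of its cluster points. A single [U] thus
    serves for all points [x] and all measurable sets at once, without extraction of
    subsequences. *)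
Lemma ultra_cvg (a : nat -> R) (M : R) : (forall k, `|a k| <= M) ->
  exists l : R, a k @[k --> U] --> l.
Proof.
move=> aM; have cK := @segment_compact R (- M) M.
have UF : ProperFilter (a k @[k --> U]) by exact: fmap_proper_filter.
have Ua : U (a @^-1` `[- M, M]%classic).
  by apply: filterE => k; rewrite /= in_itv/= -ler_norml; exact: aM.
have [l [_ cl]] := cK (a k @[k --> U]) UF Ua.
exists l => V Vl; have [//|h] := in_ultra_setVsetC (a @^-1` V) UU.
have [x [Vx Wx]] := cl (~` V) V h Vl.
by case: (Vx Wx).
Qed.

Lemma ultra_lim (a : nat -> R) (M : R) : (forall k, `|a k| <= M) ->
  a k @[k --> U] --> lim (a k @[k --> U]).
Proof. by move=> /ultra_cvg[l al]; apply/cvg_ex; exists l. Qed.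

Variables (z_ : nat -> R -> R) (C : R).
Hypothesis z_int : forall k, int01 (z_ k).
Hypothesis z2_int : forall k, int01 (fun x => z_ k x ^+ 2).
Hypothesis z2_le : forall k, Rint 0 1 (fun x => z_ k x ^+ 2) <= C.

Let I01 : set R := `[0, 1]%classic.
Let mI : measurable (I01 : set (measurableTypeR R)) := measurable_itv _.

Lemma int01I f (A : set (measurableTypeR R)) : measurable A -> int01 f ->
  mu.-integrable (A `&` I01) (EFin \o f).
Proof.
by move=> mA fi; apply: integrableS fi => //; exact: measurableI.
Qed.

Lemma Rint_setI_le f (A : set (measurableTypeR R)) : measurable A -> int01 f ->
  (forall x, 0 <= f x) -> \int[mu]_(x in A `&` I01) f x <= Rint 0 1 f.
Proof.
move=> mA fi f0; rewrite Rintegral_mkcondl -/I01; apply: le_Rintegral => //.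
- rewrite -restrict_EFin; apply/(integrable_restrict _ _ _ _).1 => //.
  by rewrite setIC; exact: int01I.
- by move=> x _; rewrite patchE; case: ifPn.
Qed.

Let m (A : set (measurableTypeR R)) : R := fine (mu (A `&` I01)).

Let m_fin A : measurable A -> mu (A `&` I01) \is a fin_num.
Proof.
move=> mA; rewrite ge0_fin_numE//; apply: (@le_lt_trans _ _ (mu I01)).
  by apply: le_measure; rewrite ?inE//; exact: measurableI.
by rewrite /I01 lebesgue_measure_itv/= lte_fin ltr01 -EFinD ltry.
Qed.

Let zA k A := \int[mu]_(x in A `&` I01) z_ k x.

(** From [|z| <= t z^2 + 1 / t]: the first term is controlled uniformly in [k] by the L^2 bound, the
    second by the measure of [A]. This is uniform integrability with a free parameter [t]. *)
Let zA_le k A t : measurable A -> 0 < t -> `|zA k A| <= t * C + m A / t.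
Proof.
move=> mA t0.
have i1 := int01I _ _ mA (z_int k); have i2 := int01I _ _ mA (z2_int k).
have i3 : mu.-integrable (A `&` I01) (EFin \o (fun x => t * z_ k x ^+ 2)).
  by apply: int01I => //; exact: int01Z.
have i4 : mu.-integrable (A `&` I01) (EFin \o (fun x => cst t^-1 x)).
  by apply: int01I => //; exact: int01_cst.
apply: (le_trans (le_normr_Rintegral _ i1)); first exact: measurableI.
have := @RintegralD _ _ _ mu _ _ _ (measurableI _ _ mA mI) i3 i4.
rewrite RintegralZl//; last exact: measurableI.
rewrite Rintegral_cst; last exact: measurableI.
move=> E; apply: (@le_trans _ _ (t * \int[mu]_(x in A `&` I01) z_ k x ^+ 2 + t^-1 * m A)).
  rewrite -[X in _ <= X]E; apply: le_Rintegral; first exact: measurableI.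
  - exact: integrable_norm.
  - by apply: int01I => //; apply: int01D; [exact: int01Z|exact: int01_cst].
  move=> x _ /=; rewrite -[z_ k x ^+ 2]real_normK ?num_real//.
  rewrite -subr_ge0 (_ : _ - _ = t^-1 * (t * `|z_ k x| - 1) ^+ 2 + `|z_ k x|); last first.
    by field; rewrite gt_eqF.
  by rewrite addr_ge0// mulr_ge0 ?sqr_ge0// invr_ge0 ltW.
rewrite [t^-1 * _]mulrC lerD2r ler_pM2l//.
by apply: le_trans (z2_le k); apply: Rint_setI_le => // x; exact: sqr_ge0.
Qed.

Let zA_add k A B : measurable A -> measurable B -> A `&` B = set0 ->
  zA k (A `|` B) = zA k A + zA k B.
Proof.
move=> mA mB AB; rewrite /zA setIUl Rintegral_setU//; try exact: measurableI.
- by rewrite -setIUl; apply: int01I => //; exact: measurableU.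
- by apply/eqP; rewrite setIACA AB set0I.
Qed.

Let nu (A : set (measurableTypeR R)) : R := lim (zA k A @[k --> U]).

Let nu_cvg A : measurable A -> zA k A @[k --> U] --> nu A.
Proof. by move=> mA; apply: (@ultra_lim _ (1 * C + m A / 1)) => k; exact: zA_le. Qed.

Let nu_le A t : measurable A -> 0 < t -> `|nu A| <= t * C + m A / t.
Proof.
move=> mA t0; apply: (cvgr_to_le (cvg_norm (nu_cvg _ mA))).
by apply: nearW => k; exact: zA_le.
Qed.

Let nu_add A B : measurable A -> measurable B -> A `&` B = set0 -> nu (A `|` B) = nu A + nu B.
Proof.
move=> mA mB AB.
have h := cvgD (nu_cvg _ mA) (nu_cvg _ mB).
have E : (fun k => zA k (A `|` B)) = (fun k => zA k A + zA k B).
  by apply/funext => k; exact: zA_add.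
by apply: cvg_lim; [exact: Rhausdorff|rewrite E; exact: h].
Qed.

Let nu0 : nu set0 = 0.
Proof. by have := nu_add _ _ measurable0 measurable0 (setI0 _); rewrite setU0; lra. Qed.

Let nu_bigcup (F : nat -> set (measurableTypeR R)) n : (forall i, measurable (F i)) ->
  trivIset setT F -> \sum_(0 <= i < n) nu (F i) = nu (\big[setU/set0]_(i < n) F i).
Proof.
move=> mF tF; elim: n => [|n IH]; first by rewrite big_nil big_ord0 nu0.
rewrite big_nat_recr//= IH big_ord_recr/= nu_add//.
  exact: bigsetU_measurable.
by apply: (@trivIset_bigsetUI _ xpredT F _ n n) => //; apply: sub_trivIset tF.
Qed.

Let C0 : 0 <= C.
Proof. by apply: le_trans (z2_le 0); apply: Rint_ge0 => t _ _; exact: sqr_ge0. Qed.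

Let nu_sigma : semi_sigma_additive (EFin \o nu).
Proof.
move=> F mF tF mUF.
rewrite (_ : (fun n => _) = EFin \o (fun n => nu (\big[setU/set0]_(i < n) F i))); last first.
  by apply/funext => n; rewrite /= sumEFin nu_bigcup.
apply/fine_cvgP; split; first exact: nearW.
pose G n := \big[setU/set0]_(i < n) F i `&` I01.
have mG n : measurable (\big[setU/set0]_(i < n) F i) by exact: bigsetU_measurable.
have cG : mu (G n) @[n --> \oo] --> mu (\bigcup_n F n `&` I01).
  have -> : \bigcup_n F n `&` I01 = \bigcup_n G n.
    rewrite /G -setI_bigcupl -bigcup_bigsetU_bigcup; congr (_ `&` _).
    apply/seteqP; split => x [n _ Fx]; first by exists n.+1.
    by exists n => //; rewrite big_ord_recr/=; left.
  apply: nondecreasing_cvg_mu.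
  - by move=> n; exact: measurableI.
  - by apply: bigcup_measurable => n _; exact: measurableI.
  - move=> i j ij; apply/subsetPset; apply: setSI; exact: subset_bigsetU.
apply/cvgrPdist_le => e e0 /=.
(* With this [t] the first term of [nu_le] is at most [e / 2]; far enough in the sequence, the
   measure of the remainder [B] is at most [t e / 2], which settles the second term. *)
pose t := e / (2 * (C + 1)).
have t0 : 0 < t by rewrite divr_gt0// mulr_gt0// ltr_wpDl.
have tC : t * C <= e / 2.
  by rewrite /t invfM mulrA mulrAC ler_pdivrMr ?ltr_wpDl// ler_wpM2l ?divr_ge0 ?ltW// ltrDl.
have te0 : 0 < e / 2 * t by rewrite mulr_gt0// divr_gt0.
have cGr : fine (mu (G n)) @[n --> \oo] --> m (\bigcup_n F n).
  by apply: fine_cvg; rewrite fineK//; exact: m_fin.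
have /cvgrPdist_le/(_ _ te0)[N _ HN] := cGr.
exists N => // n Nn; have := HN n Nn; rewrite /G -/(m _) => h.
pose B := \bigcup_n F n `\` \big[setU/set0]_(i < n) F i.
have mB : measurable B by exact: measurableD.
have sub : \big[setU/set0]_(i < n) F i `<=` \bigcup_n F n by exact: bigsetU_bigcup.
have DE : \bigcup_n F n = \big[setU/set0]_(i < n) F i `|` B by rewrite setDUK.
have disj : \big[setU/set0]_(i < n) F i `&` B = set0 by rewrite setDIK.
rewrite {1}DE nu_add// [X in `|X|](_ : _ = nu B); last by ring.
have mE : m (\bigcup_n F n) = m (\big[setU/set0]_(i < n) F i) + m B.
  have dI : (\big[setU/set0]_(i < n) F i `&` I01) `&` (B `&` I01) = set0.
    by rewrite setIACA disj set0I.
  rewrite {1}DE /m setIUl.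
  rewrite (@measureU _ _ _ mu _ _ (measurableI _ _ (mG n) mI) (measurableI _ _ mB mI) dI).
  by apply: fineD; [exact: (m_fin _ (mG n))|exact: (m_fin _ mB)].
rewrite (le_trans (nu_le _ _ mB t0))//.
have : m B / t <= e / 2.
  by rewrite ler_pdivrMr//; move: h; rewrite mE addrAC subrr add0r; exact: le_trans (ler_norm _).
lra.
Qed.

(* The limits of the set functions A |-> int_A z_k along U form a charge (the L^2 bound gives
   countable additivity), and z is its Radon-Nikodym derivative. *)
Lemma weak_limit : exists2 z : R -> R, int01 z & forall A : set (measurableTypeR R), measurable A ->
  \int[mu]_(x in A `&` I01) z_ k x @[k --> U] --> \int[mu]_(x in A `&` I01) z x.
Proof.
have nu0' : (EFin \o nu) set0 = 0%E by rewrite /= nu0.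
have nuf : forall A : set (measurableTypeR R), measurable A -> (EFin \o nu) A \is a fin_num by [].
pose nuc : {charge set (measurableTypeR R) -> \bar R} :=
  HB.pack (EFin \o nu) (isCharge.Build _ _ _ _ nu0' nuf nu_sigma).
have dom : nuc `<< mu.
  apply/null_content_dominatesP => A mA A0.
  have mA0 : m A = 0.
    apply/eqP; rewrite eq_le fine_ge0//= andbT -lee_fin fineK; last exact: m_fin.
    have h : (mu (A `&` I01) <= mu A)%E.
      by apply: le_measure; rewrite ?inE//; exact: measurableI.
    by rewrite (le_trans h)// A0.
  rewrite /nuc/=; congr EFin; apply/eqP; rewrite -normr_le0; apply/ler_addgt0Pl => e e0.
  have t0 : 0 < e / (C + 1) by rewrite divr_gt0// ltr_wpDl.
  rewrite addr0 (le_trans (nu_le _ _ mA t0))// mA0 mul0r addr0 mulrAC.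
  by rewrite ler_pdivrMr ?ltr_wpDl// ler_wpM2l ?ltW// ltrDl.
pose z x := fine (Radon_Nikodym nuc mu x).
have Ez : EFin \o z = Radon_Nikodym nuc mu.
  by apply/funext => x; rewrite /= fineK//; exact: Radon_Nikodym_fin_num.
have zi : mu.-integrable setT (EFin \o z) by rewrite Ez; exact: Radon_Nikodym_integrable.
exists z; first by apply: integrableS zi.
move=> A mA; have := nu_cvg _ (measurableI _ _ mA mI).
rewrite (_ : nu (A `&` I01) = \int[mu]_(x in A `&` I01) z x).
  by rewrite /zA -setIA setIid.
have := @Radon_Nikodym_integral _ _ _ nuc mu (A `&` I01) dom (measurableI _ _ mA mI).
by rewrite -Ez => /(congr1 fine).
Qed.

Lemma le_nnsfun_approx (f : R -> R) (mf : measurable_fun (I01 : set (measurableTypeR R)) (EFin \o f)) n x :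
  (forall x, 0 <= f x) -> I01 x -> nnsfun_approx mI mf n x <= f x.
Proof.
move=> f0 Ix; rewrite -lee_fin nnsfun_approxE.
by apply: le_approx => // t _; rewrite /= lee_fin.
Qed.

(** That [z^2] is integrable is part of the claim, so [z] cannot serve as its own test function. A
    simple [s] with [s^2 <= z s] can: integrating [2 z_k s - s^2 <= z_k^2] and passing to the limit
    bounds the integral of [s^2] by [L]. Such functions converge to [z], and Fatou's lemma
    concludes. *)
Lemma weak_lsc (L : R) : Rint 0 1 (fun x => z_ k x ^+ 2) @[k --> U] --> L ->
  exists z : R -> R, [/\ int01 z, int01 (fun x => z x ^+ 2), Rint 0 1 (fun x => z x ^+ 2) <= L &
    forall x y, 0 <= x -> x <= y -> y <= 1 -> Rint x y (z_ k) @[k --> U] --> Rint x y z].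
Proof.
move=> zL; have [z zi zA_cvg] := weak_limit.
have zxy : forall x y, 0 <= x -> x <= y -> y <= 1 -> Rint x y (z_ k) @[k --> U] --> Rint x y z.
  move=> x y x0 xy y1; have := zA_cvg `[x, y]%classic (measurable_itv _).
  have -> : `[x, y]%classic `&` I01 = `[x, y]%classic; last exact.
  by apply: setIidl; apply: subset_itv; rewrite bnd_simp.
pose good (s : R -> R) := [/\ measurable_fun (`[0, 1] : set R) s, bounded01 s &
  Rint 0 1 (fun x => z_ k x * s x) @[k --> U] --> Rint 0 1 (fun x => z x * s x)].
have good_indic (A : set (measurableTypeR R)) : measurable A -> good \1_A.
  move=> mA; have mi : measurable_fun (`[0, 1] : set R) (\1_A : R -> R).
    by apply: measurable_funTS; exact: measurable_indic.
  split=> //.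
    by exists 1 => x _ _; rewrite indicE; case: (x \in A) => /=; rewrite ?normr1 ?normr0.
  have E f : Rint 0 1 (fun x => f x * \1_A x) = \int[mu]_(x in A `&` I01) f x.
    rewrite Rintegral_mkcondl /Rint; apply: eq_Rintegral => x _.
    by rewrite patchE indicE; case: ifPn => _; rewrite ?mulr1 ?mulr0.
  by rewrite E; under eq_fun do rewrite E; exact: zA_cvg.
have good_lin (c : R) s t : good s -> good t -> good (fun x => s x + c * t x).
  move=> [ms [M sM] cs] [mt [N tN] ct]; split.
  - by apply: measurable_funD => //; apply: measurable_funM.
  - exists (M + `|c| * N) => x x0 x1; rewrite (le_trans (ler_normD _ _))// lerD ?sM//.
    by rewrite normrM ler_wpM2l// tN.
  have E f : int01 f -> Rint 0 1 (fun x => f x * (s x + c * t x)) =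
      Rint 0 1 (fun x => f x * s x) + c * Rint 0 1 (fun x => f x * t x).
    move=> fi; have i1 : int01 (fun x => f x * s x) by apply: int01M => //; exists M.
    have i2 : int01 (fun x => f x * t x) by apply: int01M => //; exists N.
    rewrite -RintZ// -RintD//; last exact: int01Z.
    by apply: eq_Rint => x _ _; ring.
  rewrite E//; under eq_fun do rewrite E//.
  by apply: cvgD => //; apply: cvgM => //; exact: cvg_cst.
have good0 : good (fun=> 0).
  split; [exact: measurable_cst|by exists 0 => x _ _; rewrite normr0|].
  have E f : Rint 0 1 (fun x => f x * 0) = 0.
    by rewrite (eq_Rint _ (cst 0)) ?Rint_cst ?mul0r// => t _ _; rewrite mulr0.
  by rewrite E; under eq_fun do rewrite E; exact: cvg_cst.
have good_nnsfun (s : {nnsfun (measurableTypeR R) >-> R}) : good s.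
  have -> : (s : R -> R) = fun x => \sum_(y <- finmap.enum_fset (fset_set (range s))) (y * \1_(s @^-1` [set y]) x).
    by apply/funext => x; rewrite [LHS]fimfunE fsbig_finite.
  elim: (finmap.enum_fset _) => [|y l IH].
    by under eq_fun do rewrite big_nil.
  under eq_fun do rewrite big_cons addrC.
  apply: good_lin => //; apply: good_indic.
  by rewrite -[X in measurable X]setTI; exact: measurable_funP.
have key s : good s -> (forall x, I01 x -> s x ^+ 2 <= z x * s x) -> Rint 0 1 (fun x => s x ^+ 2) <= L.
  move=> [ms [M sM] cs] szs.
  have s2 : int01 (fun x => s x ^+ 2).
    apply: int01_bounded; first exact: measurable_funX.
    by exists (M ^+ 2) => x x0 x1; rewrite normrX lerXn2r ?nnegrE ?sM// (le_trans _ (sM 0 _ _)).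
  have zs f : int01 f -> int01 (fun x => f x * s x) by move=> fi; apply: int01M => //; exists M.
  have h1 : Rint 0 1 (fun x => s x ^+ 2) <= Rint 0 1 (fun x => z x * s x).
    apply: le_Rint => //; [exact: zs|move=> t t0 t1; apply: szs].
    by rewrite /I01 /= in_itv/= t0.
  have h2 k : 2 * Rint 0 1 (fun x => z_ k x * s x) - Rint 0 1 (fun x => s x ^+ 2) <=
      Rint 0 1 (fun x => z_ k x ^+ 2).
    have i1 := zs _ (z_int k).
    rewrite -RintZ// -RintB//; last exact: int01Z.
    apply: le_Rint => //; first by apply: int01B => //; exact: int01Z.
    by move=> t _ _; have := sqr_ge0 (z_ k t - s t); nra.
  have h3 : 2 * Rint 0 1 (fun x => z x * s x) - Rint 0 1 (fun x => s x ^+ 2) <= L.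
    apply: (ler_cvg_to _ zL (nearW _ h2)).
    by apply: cvgB; [apply: cvgM => //; exact: cvg_cst|exact: cvg_cst].
  lra.
have mz := int01_measurable zi.
have mp : measurable_fun (I01 : set (measurableTypeR R)) (EFin \o (fun x => Num.max (z x) 0)).
  by apply/measurable_EFinP; apply: measurable_maxr.
have mn : measurable_fun (I01 : set (measurableTypeR R)) (EFin \o (fun x => Num.max (- z x) 0)).
  by apply/measurable_EFinP; apply: measurable_maxr => //; exact: measurableT_comp.
(* The positive and the negative part are approximated from below, so [s n] never has the sign
   opposite to [z] nor exceeds it in modulus: hence [s^2 <= z s]. *)
pose s n x := nnsfun_approx mI mp n x - nnsfun_approx mI mn n x.
have gs n : good (s n).
  rewrite (_ : s n = fun x => nnsfun_approx mI mp n x + (- 1) * nnsfun_approx mI mn n x).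
    by apply: good_lin; exact: good_nnsfun.
  by apply/funext => x; rewrite mulN1r.
have ps n x : I01 x -> nnsfun_approx mI mp n x <= Num.max (z x) 0.
  by apply: le_nnsfun_approx => t; rewrite le_max lexx orbT.
have ns n x : I01 x -> nnsfun_approx mI mn n x <= Num.max (- z x) 0.
  by apply: le_nnsfun_approx => t; rewrite le_max lexx orbT.
have szs n x : I01 x -> s n x ^+ 2 <= z x * s n x.
  move=> Ix; have h1 := ps n x Ix; have h2 := ns n x Ix; rewrite /s.
  have g1 : 0 <= nnsfun_approx mI mp n x by [].
  have g2 : 0 <= nnsfun_approx mI mn n x by [].
  move: h1 h2 g1 g2; move: (nnsfun_approx mI mp n x) (nnsfun_approx mI mn n x) => a b.
  have [z0|z0] := leP 0 (z x).
    rewrite (max_r (_ : - z x <= 0)) ?oppr_le0// => h1 h2 h3 h4.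
    have -> : b = 0 by lra.
    nra.
  rewrite (max_l (_ : 0 <= - z x)) ?oppr_ge0 ?(ltW z0)// => h1 h2 h3 h4.
  have -> : a = 0 by lra.
  nra.
have sL n := key _ (gs n) (szs n).
have s2i n : int01 (fun x => s n x ^+ 2).
  have [ms [M sM] _] := gs n; apply: int01_bounded; first exact: measurable_funX.
  by exists (M ^+ 2) => x x0 x1; rewrite normrX lerXn2r ?nnegrE ?sM// (le_trans _ (sM 0 _ _)).
have scv x : I01 x -> s n x @[n --> \oo] --> z x.
  move=> Ix.
  have c1 : nnsfun_approx mI mp n x @[n --> \oo] --> Num.max (z x) 0.
    have := @cvg_nnsfun_approx _ _ _ _ mI _ mp _ x Ix.
    by move=> /(_ (fun t _ => ltac:(by rewrite /= lee_fin le_max lexx orbT)))/fine_cvgP[].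
  have c2 : nnsfun_approx mI mn n x @[n --> \oo] --> Num.max (- z x) 0.
    have := @cvg_nnsfun_approx _ _ _ _ mI _ mn _ x Ix.
    by move=> /(_ (fun t _ => ltac:(by rewrite /= lee_fin le_max lexx orbT)))/fine_cvgP[].
  have -> : z x = Num.max (z x) 0 - Num.max (- z x) 0.
    have [z0|z0] := leP 0 (z x).
      by rewrite (max_r (_ : - z x <= 0)) ?oppr_le0// subr0.
    by rewrite (max_l (_ : 0 <= - z x)) ?oppr_ge0 ?(ltW z0)// sub0r opprK.
  exact: cvgB c1 c2.
have fat : (\int[mu]_(x in I01) (z x ^+ 2)%:E <= L%:E)%E.
  have ms2 n : measurable_fun (I01 : set (measurableTypeR R)) (fun x => (s n x ^+ 2)%:E).
    by apply/measurable_EFinP; apply: measurable_funX; have [] := gs n.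
  have := @fatou _ _ _ mu I01 mI (fun n x => (s n x ^+ 2)%:E) ms2
    (fun n x _ => ltac:(by rewrite lee_fin sqr_ge0)).
  rewrite (@eq_integral _ _ _ mu I01 (fun x => (z x ^+ 2)%:E)); last first.
    move=> x; rewrite inE => Ix; apply: (cvg_limn_einf_sup _).1.
    apply/fine_cvgP; split; first exact: nearW.
    exact: cvgM (scv x Ix) (scv x Ix).
  move=> /le_trans; apply; rewrite limn_einf_lim; apply: lime_le; first exact: is_cvg_einfs.
  apply: nearW => n; apply: (@le_trans _ _ (\int[mu]_(x in I01) (s n x ^+ 2)%:E)%E).
    by apply: ereal_inf_lbound; exists n => /=.
  by rewrite -(fineK (integrable_fin_num mI (s2i n))) lee_fin; exact: sL.
have z2 : int01 (fun x => z x ^+ 2).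
  apply/integrableP; split; first by apply/measurable_EFinP; exact: measurable_funX.
  apply: le_lt_trans (ltry L); apply: le_trans fat; rewrite le_eqVlt; apply/orP; left; apply/eqP.
  by apply: eq_integral => x _; rewrite /= ger0_norm// sqr_ge0.
exists z; split=> //.
by rewrite -lee_fin /Rint /Rintegral fineK//; exact: integrable_fin_num.
Qed.

End weak_compactness.

(** * Lower semicontinuity of the elastica functional under a slope bound *)

Section limit.
Context {R : realType}.
Implicit Types (f g F G v p q : R -> R) (x y z s a b c : R).
Variable U : set_system nat.
Hypothesis UU : UltraFilter U.
Lemma cvg_lim_eq (a : nat -> R) (l1 l2 : R) : a k @[k --> U] --> l1 ->
  a k @[k --> U] --> l2 -> l1 = l2.
Proof.
move=> h1 h2; transitivity (lim (a k @[k --> U])).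
  by apply: esym; apply: cvg_lim => //; exact: Rhausdorff.
by apply: cvg_lim => //; exact: Rhausdorff.
Qed.

Lemma cvg_dist_le (f g : nat -> R) (a b c : R) : f k @[k --> U] --> a ->
  g k @[k --> U] --> b -> (forall k, `|f k - g k| <= c) -> `|a - b| <= c.
Proof.
move=> fa gb fg; have cv : (fun k => `|f k - g k|) k @[k --> U] --> `|a - b|.
  by apply: cvg_norm; apply: cvgB.
by apply: (cvgr_to_le cv); apply: nearW => k; exact: fg.
Qed.

Variables (v_ p_ q_ : nat -> R -> R) (C s0 L : R).
Hypothesis vpq : forall k, H20_derivs (v_ k) (p_ k) (q_ k).
Hypothesis p_le : forall k x, 0 <= x -> x <= 1 -> `|p_ k x| <= s0.
Hypothesis W_le : forall k, Rint 0 1 (fun t => q_ k t ^+ 2 * pw (- (5 / 2)) (p_ k t)) <= C.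
Hypothesis W_cvg :
  Rint 0 1 (fun t => q_ k t ^+ 2 * pw (- (5 / 2)) (p_ k t)) @[k --> U] --> L.

Let z_ k t := q_ k t * pw (- (5 / 4)) (p_ k t).

Let Zz k : prim (Euler \o p_ k) (z_ k).
Proof. by have [_ Pq _ _] := vpq k; exact: prim_comp _ _ _ _ is_derive_Euler (loclip_pw _) Pq. Qed.

Let z2E k t : z_ k t ^+ 2 = q_ k t ^+ 2 * pw (- (5 / 2)) (p_ k t).
Proof. rewrite /z_ exprMn [pw _ _ ^+ 2]expr2 pwM; congr (_ * pw _ _); lra. Qed.

Let z2_int k : int01 (fun t => z_ k t ^+ 2).
Proof.
have [Vp Pq q2 _] := vpq k.
by apply: eq_int01 (int01_comp _ _ _ _ q2 Pq (loclip_pw (- (5 / 2)))) => t _ _; rewrite z2E.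
Qed.

Let z2W k : Rint 0 1 (fun t => z_ k t ^+ 2) =
  Rint 0 1 (fun t => q_ k t ^+ 2 * pw (- (5 / 2)) (p_ k t)).
Proof. by apply: eq_Rint => t _ _; rewrite z2E. Qed.

Let s0_ge0 : 0 <= s0.
Proof. exact: le_trans (p_le 0%N 0 (lexx _) ler01). Qed.

(** Bounded slopes keep the derivative of [Euler] away from 0, so increments of [Euler (p_ k x)]
    control those of [p_ k x]. *)
Let gmin : exists2 m : R, 0 < m & forall s, `|s| <= s0 -> m <= pw (- (5 / 4)) s.
Proof.
exists (pw (- (5 / 4)) s0); first exact: pw_gt0.
move=> s ss0; rewrite !pwN lef_pV2 ?posrE ?pw_gt0//.
have s2 : s ^+ 2 <= s0 ^+ 2.
  by rewrite -[s ^+ 2]real_normK ?num_real// lerXn2r ?nnegrE.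
have h1 := pw_base s; have h2 := pw_base s0.
apply: ge0_ler_powR; rewrite ?nnegrE; lra.
Qed.

Let v_le k x : 0 <= x -> x <= 1 -> `|v_ k x| <= s0.
Proof.
move=> x0 x1; have [[pi VE] Pq _ [v0 _ _ _]] := vpq k.
have := VE 0 x (lexx _) x0 x1; rewrite v0 subr0 => ->.
apply: (le_trans (normr_Rint _ _ _ pi (lexx _) x1)).
apply: (@le_trans _ _ (Rint 0 x (cst s0))).
  apply: le_Rint => //; [exact: int01_norm|exact: int01_cst|].
  by move=> t t0 tx; apply: p_le => //; lra.
by rewrite Rint_cst// subr0 ler_piMr.
Qed.

Let v x := lim (v_ k x @[k --> U]).
Let p x := lim (p_ k x @[k --> U]).

Let v_cvg x : 0 <= x -> x <= 1 -> v_ k x @[k --> U] --> v x.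
Proof. by move=> x0 x1; apply: (@ultra_lim _ _ UU _ s0) => k; exact: v_le. Qed.

Let p_cvg x : 0 <= x -> x <= 1 -> p_ k x @[k --> U] --> p x.
Proof. by move=> x0 x1; apply: (@ultra_lim _ _ UU _ s0) => k; exact: p_le. Qed.

(** By Cauchy-Schwarz the increments of [Euler (p_ k x)] are at most the square root of [C (y - x)],
    whatever [k]; division by the lower bound [m] of the weight gives the modulus for [p_ k]. *)
Let equicont (e : R) : 0 < e -> exists2 d : R, 0 < d & forall k x y,
  0 <= x -> x <= y -> y <= 1 -> y - x < d -> `|p_ k y - p_ k x| <= e.
Proof.
move=> e0; have [m m0 Hm] := gmin.
have C0 : 0 <= C by apply: le_trans (W_le 0%N); rewrite -z2W; apply: Rint_ge0 => t _ _; exact: sqr_ge0.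
exists ((e * m) ^+ 2 / (C + 1)); first by rewrite divr_gt0 ?exprn_gt0 ?mulr_gt0 ?ltr_wpDl.
move=> k x y x0 xy y1; rewrite ltr_pdivlMr ?ltr_wpDl// => yxd.
have [zi ZE] := Zz k.
have h1 := normr_Rint _ _ _ zi x0 y1; rewrite -ZE//= in h1.
have h2 := Rint_cauchy_schwarz _ _ _ zi (z2_int k) x0 xy y1.
have h3 : Rint x y (fun t => z_ k t ^+ 2) <= C.
  apply: le_trans (W_le k); rewrite -z2W.
  rewrite (Rint_cat _ 0 1 x (z2_int k))//; last lra.
  rewrite (Rint_cat _ x 1 y (z2_int k))//.
  have g1 : 0 <= Rint 0 x (fun t => z_ k t ^+ 2) by apply: Rint_ge0 => t _ _; exact: sqr_ge0.
  have g2 : 0 <= Rint y 1 (fun t => z_ k t ^+ 2) by apply: Rint_ge0 => t _ _; exact: sqr_ge0.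
  lra.
have h4 : Rint x y (fun t => `|z_ k t|) <= e * m.
  rewrite -(@ler_sqr _ (Rint _ _ _)) ?nnegrE; last 2 first.
    by apply: Rint_ge0.
    by rewrite mulr_ge0 ?ltW.
  apply: (le_trans h2); apply: le_trans (ltW yxd).
  by rewrite ler_wpM2l ?subr_ge0//; lra.
have [c cE [_ cs]] := mvt_between _ _ (p_ k x) (p_ k y) is_derive_Euler.
have {}cs : `|c| <= s0 by apply: cs; apply: p_le; lra.
rewrite -(ler_pM2r m0); apply: le_trans h4; apply: le_trans h1.
rewrite cE normrM mulrC (gtr0_norm (pw_gt0 _ _)) ler_wpM2r//.
exact: Hm.
Qed.

(** In the variable [Euler (p x)] the functional is quadratic, so [weak_lsc] applies as it stands.
    The weak limit [z] is the density of [Euler (p x)], and the inverse weight [pw (5 / 4)] turns it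
    into a density of [p]. *)
Lemma elastica_lsc : exists v p q, [/\ H20_derivs v p q,
  Rint 0 1 (fun t => q t ^+ 2 * pw (- (5 / 2)) (p t)) <= L &
  forall x, 0 <= x -> x <= 1 -> v_ k x @[k --> U] --> v x].
Proof.
have zL : Rint 0 1 (fun t => z_ k t ^+ 2) @[k --> U] --> L.
  by under eq_fun do rewrite z2W.
have z2C k : Rint 0 1 (fun t => z_ k t ^+ 2) <= C by rewrite z2W.
have [z [zi z2 zL2 zcv]] := weak_lsc _ UU z_ C (fun k => (Zz k).1) z2_int z2C L zL.
have Zp x : 0 <= x -> x <= 1 -> Euler (p_ k x) @[k --> U] --> Euler (p x).
  by move=> x0 x1; apply: continuous_cvg; [exact: Euler_continuous|exact: p_cvg].
have PZ : prim (Euler \o p) z.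
  split=> // x y x0 xy y1.
  apply: (cvg_lim_eq (fun k => Rint x y (z_ k))); last exact: (zcv x y x0 xy y1).
  have -> : (fun k => Rint x y (z_ k)) = (fun k => Euler (p_ k y) - Euler (p_ k x)).
    by apply/funext => k; have [_ <-] := Zz k.
  by apply: cvgB; apply: Zp; lra.
have up : ucont01 p.
  move=> e e0; have e20 : 0 < e / 2 by lra.
  have [d d0 Hd] := equicont _ e20; exists d => // x y x0 xy y1 yxd.
  apply: (@le_lt_trans _ _ (e / 2)); last lra.
  apply: (cvg_dist_le _ _ _ _ _ (p_cvg y (le_trans x0 xy) y1) (p_cvg x x0 (le_trans xy y1))).
  by move=> k; exact: Hd.
pose q t := z t * pw (5 / 4) (p t).
have Pq : prim p q.
  apply: (prim_chain p _ z p _ PZ up (loclip_pw _)) => x y x0 xy y1.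
  have [c cE [cx _]] := mvt_between _ _ (p x) (p y) is_derive_Euler; exists c => //.
  rewrite /= cE mulrA pwM (_ : 5 / 4 - 5 / 4 = 0); last by ring.
  by rewrite /pw powRr0 mul1r.
have q2E t : q t ^+ 2 * pw (- (5 / 2)) (p t) = z t ^+ 2.
  rewrite /q exprMn -mulrA [pw _ _ ^+ 2]expr2 !pwM (_ : _ + _ + _ = 0); last by lra.
  by rewrite /pw powRr0 mulr1.
have cp := prim_continuous Pq.
have Vp : prim v p.
  have pi := within01_int01 cp.
  (* Equicontinuity gives first order expansions of the [v_ k] that are uniform in [k]; they survive
     the limit along [U], so limit and integral need not be exchanged. *)
  apply: (prim_approx v p (cst 1) pi (int01_cst 1)) => e e0.
  have e20 : 0 < e / 2 by lra.
  have [d d0 Hd] := equicont _ e20; exists d => // x y x0 xy y1 yxd.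
  rewrite Rint_cst// mul1r.
  have x1 := le_trans xy y1; have y0 := le_trans x0 xy.
  have lin (f : R -> R) c : int01 f -> (forall t, x <= t -> t <= y -> `|f t - c| <= e / 2) ->
      `|Rint x y f - c * (y - x)| <= e / 2 * (y - x).
    move=> fi fc; rewrite -!Rint_cst// -RintB//; last exact: int01_cst.
    have fci : int01 (fun t => f t - cst c t) by apply: int01B => //; exact: int01_cst.
    apply: (le_trans (normr_Rint _ _ _ fci x0 y1)).
    apply: le_Rint => //; [exact: int01_norm|exact: int01_cst].
  have h1 : `|v y - v x - p x * (y - x)| <= e / 2 * (y - x).
    apply: (cvg_dist_le (fun k => v_ k y - v_ k x) (fun k => p_ k x * (y - x))).
    - by apply: cvgB; apply: v_cvg.
    - by apply: cvgM; [exact: p_cvg|exact: cvg_cst].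
    move=> k.
    have [[pki VE] _ _ _] := vpq k; rewrite VE//; apply: lin => // t xt ty.
    by apply: Hd => //; lra.
  have h2 : `|Rint x y p - p x * (y - x)| <= e / 2 * (y - x).
    apply: lin => // t xt ty.
    have t0 := le_trans x0 xt; have t1 := le_trans ty y1.
    apply: (cvg_dist_le _ _ _ _ _ (p_cvg t t0 t1) (p_cvg x x0 x1)) => k.
    by apply: Hd => //; lra.
  rewrite (_ : _ - _ = (v y - v x - p x * (y - x)) - (Rint x y p - p x * (y - x))); last by ring.
  rewrite (le_trans (ler_normB _ _))//; lra.
have lim0 (a : nat -> R) l : a k @[k --> U] --> l -> (forall k, a k = 0) -> l = 0.
  move=> al a0; apply: cvg_lim_eq al _.
  by rewrite (_ : a = cst 0); [exact: cvg_cst|apply/funext => k; rewrite a0].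
exists v, p, q; split=> //.
  split=> //.
    have [mm [M bM]] := bddmeas_comp _ _ _ Pq (loclip_pw (5 / 2)).
    apply: eq_int01 (int01M z2 mm _) => [t _ _|]; last by exists M.
    rewrite /q exprMn [pw _ _ ^+ 2]expr2 pwM; congr (_ * pw _ _); lra.
  split.
  - by apply: (lim0 _ _ (v_cvg 0 (lexx _) ler01)) => k; have [_ _ _ []] := vpq k.
  - by apply: (lim0 _ _ (v_cvg 1 ler01 (lexx _))) => k; have [_ _ _ []] := vpq k.
  - by apply: (lim0 _ _ (p_cvg 0 (lexx _) ler01)) => k; have [_ _ _ []] := vpq k.
  - by apply: (lim0 _ _ (p_cvg 1 ler01 (lexx _))) => k; have [_ _ _ []] := vpq k.
by rewrite (eq_Rint _ (fun t => z t ^+ 2)).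
Qed.

End limit.

(** * The minimizing sequence *)

Section existence.
Context {R : realType}.

Lemma elastica_ge0 (psi v : R -> R) : admissible psi v -> (0 <= elastica v)%E.
Proof.
move=> [/H20P[p [q vpq]] _]; rewrite (elasticaE _ _ _ vpq) lee_fin.
by apply: Rint_ge0 => t _ _; rewrite mulr_ge0 ?sqr_ge0// ltW// pw_gt0.
Qed.

Lemma minimizer_exists (psi : R -> R) : (inf_elastica psi < (c0 R ^+ 2)%:E)%E ->
  exists2 v, admissible psi v & elastica v = inf_elastica psi.
Proof.
move=> Ic0; have I0 : (0 <= inf_elastica psi)%E.
  by apply: le_ereal_inf_tmp => _ [v /elastica_ge0 ? <-].
have Ifin : inf_elastica psi \is a fin_num.
  by rewrite ge0_fin_numE// (lt_trans Ic0)// ltry.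
pose r := fine (inf_elastica psi).
have rE : inf_elastica psi = r%:E by rewrite /r fineK.
have r0 : 0 <= r by rewrite -lee_fin -rE.
have rc0 : r < c0 R ^+ 2 by rewrite -lte_fin -rE.
(* An energy level strictly between the infimum and c0^2. Keeping the whole sequence below it yields
   one slope bound [s0] for all [k]. *)
pose C := (r + c0 R ^+ 2) / 2.
have rC : r < C by rewrite /C; lra.
have Cc0 : C < c0 R ^+ 2 by rewrite /C; lra.
have C0 : 0 <= C by lra.
have c00 : 0 <= c0 R.
  by apply: Rintegral_ge0 => x _; rewrite invr_ge0 ltW// (pw_gt0 (5 / 4)).
have sCc0 : Num.sqrt C < c0 R.
  by rewrite -(ger0_norm c00) -sqrtr_sqr ltr_sqrt// (le_lt_trans C0).
have [s0 s00 Es0] := c0_lt_Euler _ sCc0.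
have Hk (k : nat) : exists vpq : (R -> R) * (R -> R) * (R -> R),
    [/\ H20_derivs vpq.1.1 vpq.1.2 vpq.2, admissible psi vpq.1.1,
       Rint 0 1 (fun t => vpq.2 t ^+ 2 * pw (- (5 / 2)) (vpq.1.2 t)) < C &
       r <= Rint 0 1 (fun t => vpq.2 t ^+ 2 * pw (- (5 / 2)) (vpq.1.2 t)) < r + k.+1%:R^-1].
  have : (inf_elastica psi < (Num.min C (r + k.+1%:R^-1))%:E)%E.
    by rewrite rE lte_fin lt_min rC/= ltrDl invr_gt0.
  move=> /ereal_inf_lt[_ [v av <-]] Wlt; have [vH _] := av; have [p [q vpq]] := (H20P v).1 vH.
  have rle : (r%:E <= elastica v)%E by rewrite -rE; apply: ereal_inf_lbound; exists v.
  move: Wlt rle; rewrite (elasticaE _ _ _ vpq) lte_fin lee_fin lt_min => /andP[h1 h2] rle.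
  by exists (v, p, q); split; [exact: vpq|exact: av|exact: h1|rewrite /= rle].
have [f Hf] := choice Hk.
(* [U] refines the filter at infinity, so the energies still converge to the infimum along it. *)
have [U [UU ooU]] := ultraFilterLemma (eventually_filter).
pose W k := Rint 0 1 (fun t => (f k).2 t ^+ 2 * pw (- (5 / 2)) ((f k).1.2 t)).
have Wr : W k @[k --> U] --> r.
  have : W k @[k --> \oo] --> r.
    apply: (@squeeze_cvgr _ _ _ _ (cst r) (fun k => r + k.+1%:R^-1)).
    - by apply: nearW => k; have [_ _ _ /andP[h1 /ltW h2]] := Hf k; rewrite /= h1.
    - exact: cvg_cst.
    - rewrite -[X in _ --> X]addr0; apply: cvgD; first exact: cvg_cst.
      exact: cvg_harmonic.
  by move=> h V /h; exact: ooU.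
have ple k x : 0 <= x -> x <= 1 -> `|(f k).1.2 x| <= s0.
  move=> x0 x1; have [vpq _ WC _] := Hf k.
  have h := le_lt_trans (elastica_Euler_bound _ _ _ vpq x x0 x1) WC.
  have h2 : `|2 * Euler ((f k).1.2 x)| < 2 * Euler s0.
    apply: le_lt_trans Es0; rewrite -sqrtr_sqr; exact: ler_wsqrtr (ltW h).
  rewrite leNgt; apply/negP => sp.
  have : Euler s0 <= Euler `|(f k).1.2 x| by apply: Euler_le; exact: ltW.
  move: h2; have [p0|p0] := leP 0 ((f k).1.2 x).
    rewrite (ger0_norm p0); have := ler_norm (2 * Euler ((f k).1.2 x)); lra.
  rewrite (ltr0_norm p0) Euler_opp; have := ler_norm (- (2 * Euler ((f k).1.2 x))).
  rewrite normrN; lra.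
have [v [p [q [vpq Wv vcv]]]] := elastica_lsc U UU (fun k => (f k).1.1) (fun k => (f k).1.2)
  (fun k => (f k).2) C s0 r (fun k => let: And4 h _ _ _ := Hf k in h) ple
  (fun k => ltW (let: And4 _ _ h _ := Hf k in h)) Wr.
have av : admissible psi v.
  split; first by apply/H20P; exists p, q.
  move=> x; rewrite in_itv/= => /andP[x0 x1].
  apply: (cvgr_to_ge (vcv x x0 x1)); apply: nearW => k.
  by have [_ [_ h] _ _] := Hf k; apply: h; rewrite in_itv/= x0.
exists v => //; apply/eqP; rewrite eq_le; apply/andP; split.
  by rewrite (elasticaE _ _ _ vpq) rE lee_fin.
by apply: ereal_inf_lbound; exists v.
Qed.

End existence.

(** * Convexity on a dense set *)

Section monotone.
Context {R : realType}.
Local Notation mu := (@lebesgue_measure R).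
Implicit Types (f g F G m : R -> R) (x y z s a b c e : R).

Lemma nondecreasing_bddmeas m : {homo m : x y / x <= y} -> bddmeas m.
Proof.
move=> hm; split; first by apply: nondecreasing_measurable.
exists (`|m 0| + `|m 1|) => x x0 x1.
have h1 := hm _ _ x0; have h2 := hm _ _ x1.
have := ler_norm (m 1); have := ler_norm (- m 0); rewrite normrN => h3 h4.
have := normr_ge0 (m 0); have := normr_ge0 (m 1) => h5 h6.
by rewrite ler_norml; apply/andP; split; lra.
Qed.

Lemma nondecreasing_int01 m : {homo m : x y / x <= y} -> int01 m.
Proof. by move=> /nondecreasing_bddmeas/bddmeas_int01. Qed.

(** The increment of [F] and the integral of [m] lie between the same two bounds, so they differ by
    at most [(m y - m x) (y - x)]. On short intervals this is a small multiple of an increment of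
    [m], which is additive. *)
Lemma monotone_Rint (Om : set R) F m :
  (forall x y, 0 <= x -> x < y -> y <= 1 -> exists2 z, Om z & x < z < y) ->
  {homo m : x y / x <= y} ->
  (forall x y, Om x -> Om y -> 0 <= x -> x <= y -> y <= 1 ->
    m x * (y - x) <= F y - F x <= m y * (y - x)) ->
  forall x y, Om x -> Om y -> 0 <= x -> x <= y -> y <= 1 -> F y - F x = Rint x y m.
Proof.
move=> dOm hm HF x y Omx Omy x0 xy y1; have mi := nondecreasing_int01 _ hm.
have S := dense_constant Om (fun x => F x - Rint 0 x m) m dOm.
have : F x - Rint 0 x m = F y - Rint 0 y m.
  apply: S => // e e0; exists e => // s t Oms Omt s0' st t1 tse.
  have /andP[h1 h2] := HF s t Oms Omt s0' st t1.
  have h3 : m s * (t - s) <= Rint s t m.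
    rewrite -Rint_cst//; apply: le_Rint => //; first exact: int01_cst.
    by move=> r sr _; exact: hm.
  have h4 : Rint s t m <= m t * (t - s).
    rewrite -Rint_cst//; apply: le_Rint => //; first exact: int01_cst.
    by move=> r _ rt; exact: hm.
  have mst := hm _ _ st.
  have h5 : (m t - m s) * (t - s) <= e * (m t - m s).
    by rewrite mulrC; apply: ler_wpM2r; [rewrite subr_ge0|exact: ltW].
  rewrite (Rint_cat m 0 t s)//.
  rewrite (_ : _ - _ - _ = F t - F s - Rint s t m); last by ring.
  by rewrite ler_norml; apply/andP; split; move: h5; rewrite mulrBl; lra.
rewrite (Rint_cat m 0 y x)//; lra.
Qed.

Lemma monotone_prim F m : {homo m : x y / x <= y} ->
  (forall x y, x <= y -> m x * (y - x) <= F y - F x <= m y * (y - x)) -> prim F m.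
Proof.
move=> hm HF; split; first exact: nondecreasing_int01.
move=> x y x0 xy y1; apply: (monotone_Rint setT) => //; first exact: dense_setT.
by move=> s t _ _ _ st _; exact: HF.
Qed.

(* The hypotheses say that D, restricted to the dense set Om, is convex, and affine near 0 and near
   1; the latter bounds its slopes. *)
Lemma convex_dense (Om : set R) (D : R -> R) del : 0 < del -> del < 1 / 2 ->
  (forall x, Om x -> 0 < x < 1) ->
  (forall x y, 0 <= x -> x < y -> y <= 1 -> exists2 z, Om z & x < z < y) ->
  (forall a b c, Om a -> Om b -> Om c -> a < b -> b < c ->
    0 <= (c - b) * D a - (c - a) * D b + (b - a) * D c) ->
  (forall a b c, Om a -> Om b -> Om c -> a < b -> b < c -> c < del \/ 1 - del < a ->
    (c - b) * D a - (c - a) * D b + (b - a) * D c = 0) ->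
  exists2 m : R -> R, {homo m : x y / x <= y} &
    forall x y, Om x -> Om y -> x <= y -> m x * (y - x) <= D y - D x <= m y * (y - x).
Proof.
move=> del0 del1 Om01 dOm Hc Ha.
pose S x y := (D y - D x) / (y - x).
have SE x y : x < y -> D y - D x = S x y * (y - x).
  by move=> xy; rewrite /S divfK// gt_eqF// subr_gt0.
have S3 a b c : Om a -> Om b -> Om c -> a < b -> b < c -> S a b <= S b c.
  move=> oa ob oc ab bc; have h := Hc a b c oa ob oc ab bc.
  have E1 := SE _ _ ab; have E2 := SE _ _ bc.
  have : 0 <= (S b c - S a b) * ((b - a) * (c - b)).
    have -> : (S b c - S a b) * ((b - a) * (c - b)) =
      S b c * (c - b) * (b - a) - S a b * (b - a) * (c - b) by ring.
    by rewrite -E1 -E2; move: h; nra.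
  by rewrite pmulr_lge0 ?subr_ge0// mulr_gt0// subr_gt0.
have S3e a b c : Om a -> Om b -> Om c -> a < b -> b < c -> c < del \/ 1 - del < a -> S a b = S b c.
  move=> oa ob oc ab bc ends; have h := Ha a b c oa ob oc ab bc ends.
  have E1 := SE _ _ ab; have E2 := SE _ _ bc.
  have : (S b c - S a b) * ((b - a) * (c - b)) = 0.
    have -> : (S b c - S a b) * ((b - a) * (c - b)) =
      S b c * (c - b) * (b - a) - S a b * (b - a) * (c - b) by ring.
    by rewrite -E1 -E2; move: h; lra.
  move=> /eqP; rewrite mulf_eq0 subr_eq0 => /orP[/eqP->//|].
  by rewrite mulf_eq0 !subr_eq0 (gt_eqF ab) (gt_eqF bc).
(* Two points in each end strip: the slope [S x1 x2] will bound all slopes from below, and [S x3 x4]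
   from above. *)
have [x1 o1 /andP[x10 x11]] := dOm 0 (del / 2) (lexx _) (ltac:(lra)) (ltac:(lra)).
have [x2 o2 /andP[x12 x2d]] := dOm x1 del (ltac:(lra)) (ltac:(lra)) (ltac:(lra)).
have [x3 o3 /andP[x3d x31]] := dOm (1 - del) (1 - del / 2) (ltac:(lra)) (ltac:(lra)) (ltac:(lra)).
have [x4 o4 /andP[x34 x41]] := dOm x3 1 (ltac:(lra)) (ltac:(lra)) (ltac:(lra)).
have lo y z : Om y -> Om z -> y < z -> S x1 x2 <= S y z.
  move=> oy oz yz; have /andP[y0 y1] := Om01 y oy.
  have mp : 0 < Num.min x1 y by rewrite lt_min x10.
  have m1 : Num.min x1 y <= x1 by rewrite ge_min lexx.
  have m2 : Num.min x1 y <= y by rewrite ge_min lexx orbT.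
  (* [y] may lie to the left of [x1]. Affinity near 0 transports the slope [S x1 x2] to [w1 < w2],
     to the left of both, where convexity compares it with [S y z]. *)
  have [w2 p2 /andP[w20 w2m]] := dOm 0 (Num.min x1 y) (lexx _) mp (ltac:(lra)).
  have [w1 p1 /andP[w10 w12]] := dOm 0 w2 (lexx _) w20 (ltac:(lra)).
  have e1 : S w1 w2 = S w2 x1 by apply: S3e => //; [lra|left; lra].
  have e2 : S w2 x1 = S x1 x2 by apply: S3e => //; [lra|left; lra].
  rewrite -e2 -e1; apply: (@le_trans _ _ (S w2 y)); apply: S3 => //; lra.
have hi y z : Om y -> Om z -> y < z -> S y z <= S x3 x4.
  move=> oy oz yz; have /andP[z0 z1] := Om01 z oz; have /andP[x40 x4lt] := Om01 x4 o4.
  have mp : Num.max x4 z < 1 by rewrite gt_max x41.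
  have m1 : x4 <= Num.max x4 z by rewrite le_max lexx.
  have m2 : z <= Num.max x4 z by rewrite le_max lexx orbT.
  have [w1 p1 /andP[w10 w1m]] := dOm (Num.max x4 z) 1 (ltac:(lra)) mp (lexx _).
  have [w2 p2 /andP[w20 w21]] := dOm w1 1 (ltac:(lra)) w1m (lexx _).
  have e1 : S x3 x4 = S x4 w1 by apply: S3e => //; [lra|right; lra].
  have e2 : S x4 w1 = S w1 w2 by apply: S3e => //; [lra|right; lra].
  rewrite e1 e2; apply: (@le_trans _ _ (S z w1)); apply: S3 => //; lra.
(* The slopes over pairs of points up to [x]. Including [S x1 x2] keeps the set nonempty for every
   real [x], and [S x3 x4] bounds it, so its supremum is monotone on the whole line. *)
pose E x := [set s | s = S x1 x2 \/ exists y z, [/\ Om y, Om z, y < z, z <= x & s = S y z]].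
have Enon x : E x !=set0 by exists (S x1 x2); left.
have Eub x : ubound (E x) (S x3 x4).
  by move=> s [->|[y [z [oy oz yz _ ->]]]]; [apply: lo|apply: hi].
have Ehas x : has_sup (E x) by split; [exact: Enon|exists (S x3 x4); exact: Eub].
exists (fun x => sup (E x)).
  move=> x y xy; apply: ge_sup; first exact: Enon.
  move=> s Es; apply: (ub_le_sup (Ehas y).2).
  case: Es => [->|[a [b [oa ob ab bx ->]]]]; first by left.
  by right; exists a, b; split=> //; exact: le_trans bx xy.
move=> x y ox oy; rewrite le_eqVlt => /predU1P[->|xy]; first by rewrite !subrr !mulr0 lexx.
rewrite SE// !ler_pM2r ?subr_gt0//; apply/andP; split.
  apply: ge_sup; first exact: Enon.
  move=> s [->|[a [b [oa ob ab bx ->]]]]; first exact: lo.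
  have [bx'|xb] := ltP b x; first by apply: (@le_trans _ _ (S b x)); apply: S3.
  have ebx : b = x by apply/le_anti; rewrite bx xb.
  by rewrite -ebx; apply: S3 => //; rewrite ebx.
by apply: (ub_le_sup (Ehas y).2); right; exists x, y; split.
Qed.

Definition heaviside y : R := if 0 < y then 1 else 0.
Definition ramp y : R := Num.max y 0.

Lemma prim_ramp a : prim (fun x => ramp (x - a)) (fun x => heaviside (x - a)).
Proof.
apply: monotone_prim => x y xy; rewrite /heaviside /ramp.
  by do 2 case: ifPn => //; rewrite -?leNgt; lra.
have [h1|h1] := ltP 0 (x - a); have [h2|h2] := ltP 0 (y - a);
  rewrite ?mul0r ?mul1r; apply/andP; split; lra.
Qed.

(* A primitive of a primitive of the indicator of ]0, e]. *)
Definition bump2 e y : R := (ramp y ^+ 2 - ramp (y - e) ^+ 2) / 2.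
Definition bump1 e y : R := ramp y - ramp (y - e).

Lemma bump1_mono e : 0 < e -> {homo bump1 e : x y / x <= y}.
Proof.
move=> e0 x y xy; rewrite /bump1 /ramp.
have [h1|h1] := leP x 0; have [h2|h2] := leP y 0;
  have [h3|h3] := leP (x - e) 0; have [h4|h4] := leP (y - e) 0; lra.
Qed.

Lemma bump2_mono e x y : 0 < e -> x <= y ->
  bump1 e x * (y - x) <= bump2 e y - bump2 e x <= bump1 e y * (y - x).
Proof.
move=> e0 xy; rewrite /bump1 /bump2 /ramp.
have [h1|h1] := leP x 0; have [h2|h2] := leP y 0;
  have [h3|h3] := leP (x - e) 0; have [h4|h4] := leP (y - e) 0;
  apply/andP; split; nra.
Qed.

Lemma prim_bump2 e a : 0 < e -> prim (fun x => bump2 e (x - a)) (fun x => bump1 e (x - a)).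
Proof.
move=> e0; apply: monotone_prim => x y xy; first by apply: bump1_mono => //; lra.
have := @bump2_mono e (x - a) (y - a) e0 (ltac:(lra)).
by rewrite (_ : y - a - (x - a) = y - x)//; ring.
Qed.

Lemma prim_bump1 e a :
  prim (fun x => bump1 e (x - a)) (fun x => heaviside (x - a) - heaviside (x - (a + e))).
Proof.
have := primB _ _ _ _ (prim_ramp a) (prim_ramp (a + e)).
by apply: eq_prim => // x _ _; rewrite /bump1 opprD addrA.
Qed.

Lemma bump2_eq0 e y : 0 < e -> y <= 0 -> bump2 e y = 0.
Proof.
move=> e0 y0; rewrite /bump2 /ramp (max_r y0) max_r; last lra.
by rewrite subrr mul0r.
Qed.

Lemma bump1_eq0 e y : 0 < e -> y <= 0 -> bump1 e y = 0.
Proof. by move=> e0 y0; rewrite /bump1 /ramp (max_r y0) max_r ?subrr//; lra. Qed.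

Lemma bump2_lin e y : 0 < e -> e <= y -> bump2 e y = e * y - e ^+ 2 / 2.
Proof. by move=> e0 ey; rewrite /bump2 /ramp !max_l; [field|lra|lra]. Qed.

Lemma bump1_cst e y : 0 < e -> e <= y -> bump1 e y = e.
Proof. by move=> e0 ey; rewrite /bump1 /ramp !max_l; [ring|lra|lra]. Qed.

Lemma bump2_subgrad e x y : 0 < e -> bump1 e x * (y - x) <= bump2 e y - bump2 e x.
Proof.
move=> e0; have [xy|/ltW yx] := leP x y; first by have /andP[] := bump2_mono e x y e0 xy.
have /andP[_] := bump2_mono e y x e0 yx; lra.
Qed.

Lemma Rint_heaviside f a : int01 f -> 0 <= a -> a <= 1 ->
  int01 (fun t => f t * heaviside (t - a)) /\
  Rint 0 1 (fun t => f t * heaviside (t - a)) = Rint a 1 f.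
Proof.
move=> fi a0 a1.
have hi : int01 (fun t => f t * heaviside (t - a)).
  apply: int01M => //; first exact: int01_measurable (prim_ramp a).1.
  by exists 1 => x _ _; rewrite /heaviside; case: ifP => _; rewrite ?normr1 ?normr0.
split=> //; rewrite (Rint_cat _ 0 1 a)//.
rewrite (eq_Rint _ (cst 0)); last first.
  by move=> t _ ta; rewrite /heaviside subr_gt0 ltNge ta mulr0.
rewrite Rint_cst// mul0r add0r.
have E h : int01 h -> Rint a 1 h = \int[mu]_(t in `]a, 1]) h t.
  move=> hh; rewrite /Rint Rintegral_itv_obnd_cbnd//.
  by apply: integrableS (int01S hh a0 (lexx _)) => //; apply: subset_itvr; rewrite bnd_simp.
rewrite !E//; apply: eq_Rintegral => t; rewrite inE/= in_itv/= => /andP[h _].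
by rewrite /heaviside subr_gt0 h mulr1.
Qed.

End monotone.

(** * First variation *)

Section variation.
Context {R : realType}.
Local Notation mu := (@lebesgue_measure R).
Implicit Types (f g F G m : R -> R) (x y z s a b c e : R).

Lemma loclip_taylor (h h' : R -> R) : (forall x, is_derive x (1 : R) h (h' x)) -> loclip h' ->
  forall N, exists2 K : R, 0 <= K & forall a s, `|a| <= N -> `|a + s| <= N ->
    h (a + s) <= h a + s * h' a + K * s ^+ 2.
Proof.
move=> dh lh' N; have [K K0 HK] := lh' N; exists K => // a s aN asN.
have [c cE [cs cN]] := mvt_between h h' a (a + s) dh.
rewrite (_ : a + s - a = s) in cE cs; last by ring.
have h1 := HK c a (cN N aN asN) aN.
have h2 : `|h' c - h' a| <= K * `|s| by apply: (le_trans h1); rewrite ler_wpM2l.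
have h3 : (h' c - h' a) * s <= K * s ^+ 2.
  rewrite (le_trans (ler_norm _))// normrM -[s ^+ 2]real_normK ?num_real// expr2 mulrA.
  by rewrite ler_wpM2r.
by move: h3; rewrite mulrBl -cE [s * _]mulrC; lra.
Qed.

Let h s : R := pw (- (5 / 2)) s.
Let h1 s : R := (- 5) * (s * pw (- (7 / 2)) s).

Lemma is_derive_weight s : is_derive s (1 : R) h (h1 s).
Proof.
apply: is_derive_ext (is_derive_pw (- (5 / 2)) s) _.
by rewrite /h1 (_ : - (5 / 2) - 1 = - (7 / 2)); [field|lra].
Qed.

(* The correction terms of order t^2 are crude on purpose: only their integrability is used. *)
Lemma second_order_bound (Q A B H G K hv t : R) : 0 <= t -> t <= 1 -> 0 <= K ->
  hv <= H + t * B * G + K * (t * B) ^+ 2 ->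
  (Q + t * A) ^+ 2 * hv <= Q ^+ 2 * H + t * (2 * Q * H * A + Q ^+ 2 * G * B) +
    t ^+ 2 * ((A * A * H + A * B * G * (A * B * G) + `|A * A * B * G| +
      A * K * B * B * (A * K * B * B) + A * A * K * B * B) + Q ^+ 2 * (2 + K * B * B)).
Proof.
move=> t0 t1 K0 hvle; apply: (le_trans (ler_wpM2l (sqr_ge0 _) hvle)).
rewrite -subr_ge0; set Z := A * A * B * G; set rhs := (X in 0 <= X).
have -> : rhs = t ^+ 2 * ((Q - A * B * G) ^+ 2 + (Q - t * (A * K * B * B)) ^+ 2 +
    (1 - t ^+ 2) * (A * K * B * B) ^+ 2 + (`|Z| - t * Z) + (1 - t ^+ 2) * (A * B) ^+ 2 * K).
  by rewrite /rhs /Z; ring.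
rewrite mulr_ge0 ?sqr_ge0//.
have t2 : 0 <= 1 - t ^+ 2 by rewrite subr_ge0 expr_le1.
have tZ : 0 <= `|Z| - t * Z.
  rewrite subr_ge0 (le_trans (ler_norm _))// normrM (ger0_norm t0).
  by rewrite ler_piMl.
have g1 : 0 <= (1 - t ^+ 2) * (A * K * B * B) ^+ 2 by rewrite mulr_ge0 ?sqr_ge0.
have g2 : 0 <= (1 - t ^+ 2) * (A * B) ^+ 2 * K.
  exact: mulr_ge0 (mulr_ge0 t2 (sqr_ge0 _)) K0.
exact: addr_ge0 (addr_ge0 (addr_ge0 (addr_ge0 (sqr_ge0 _) (sqr_ge0 _)) g1) tZ) g2.
Qed.

Variables (psi u p q : R -> R) (del : R).
Hypothesis upq : H20_derivs u p q.
Hypothesis u_adm : admissible psi u.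
Hypothesis u_min : elastica u = inf_elastica psi.
Hypothesis gap : exists2 c : R, 0 < c & forall x, 0 <= x -> x <= 1 -> x <= del \/ 1 - del <= x ->
  psi x + c <= u x.

(** For small positive [t], [u + t phi] is admissible: the gap absorbs [t phi] on the end strips,
    where [phi] may have either sign, and [phi] is nonnegative in between. Minimality then gives
    [0 <= t L + t^2 C] with a constant [C], and small [t] forces [0 <= L]. *)
Lemma first_variation phi phi1 phi2 : prim phi phi1 -> prim phi1 phi2 -> bounded01 phi2 ->
  phi 0 = 0 -> phi 1 = 0 -> phi1 0 = 0 -> phi1 1 = 0 ->
  (forall x, 0 <= x -> x <= 1 -> del <= x -> x <= 1 - del -> 0 <= phi x) ->
  int01 (fun x => 2 * q x * h (p x) * phi2 x + q x ^+ 2 * h1 (p x) * phi1 x) /\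
  0 <= Rint 0 1 (fun x => 2 * q x * h (p x) * phi2 x + q x ^+ 2 * h1 (p x) * phi1 x).
Proof.
move=> Ph Ph1 b2 ph0 ph1 ph10 ph11 phge0.
have [Up Pq q2 [u0 u1 p0 p1]] := upq; have qi := Pq.1.
have bphi1 := bddmeas_prim _ _ Ph1.
have bphi2 : bddmeas phi2 by split=> //; exact: int01_measurable Ph1.1.
have lh : loclip h := loclip_pw _.
have lh1 : loclip h1 := loclip_idpw _ _.
have bh := bddmeas_comp _ _ _ Pq lh; have bh1 := bddmeas_comp _ _ _ Pq lh1.
have Li : int01 (fun x => 2 * q x * h (p x) * phi2 x + q x ^+ 2 * h1 (p x) * phi1 x).
  have [m1 d1] := bddmeasM _ _ bh bphi2; have [m2 d2] := bddmeasM _ _ bh1 bphi1.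
  apply: int01D; last by apply: eq_int01 (int01M q2 m2 d2) => x _ _; ring.
  by apply: eq_int01 (int01Z 2 (int01M qi m1 d1)) => x _ _; ring.
split=> //.
have [N1 pN] := (bddmeas_prim _ _ Pq).2; have [N2 phN] := bphi1.2.
have [K K0 HK] := loclip_taylor _ _ is_derive_weight lh1 (N1 + N2).
pose M x := (phi2 x * phi2 x * h (p x) + phi2 x * phi1 x * h1 (p x) * (phi2 x * phi1 x * h1 (p x)) +
  `|phi2 x * phi2 x * phi1 x * h1 (p x)| +
  phi2 x * K * phi1 x * phi1 x * (phi2 x * K * phi1 x * phi1 x) + phi2 x * phi2 x * K * phi1 x * phi1 x) +
  q x ^+ 2 * (2 + K * phi1 x * phi1 x).
have Mi : int01 M.
  have bK := bddmeas_cst K; have b2' := bddmeas_cst 2.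
  have [mm dd] : bddmeas (fun x => 2 + K * phi1 x * phi1 x).
    by apply: bddmeasD => //; apply: bddmeasM => //; exact: bddmeasM.
  apply: int01D; last exact: int01M.
  have bX := bddmeasM _ _ (bddmeasM _ _ bphi2 bphi1) bh1.
  have bY := bddmeasM _ _ (bddmeasM _ _ (bddmeasM _ _ bphi2 bK) bphi1) bphi1.
  have bZ := bddmeas_norm _ (bddmeasM _ _ (bddmeasM _ _ (bddmeasM _ _ bphi2 bphi2) bphi1) bh1).
  have bV := bddmeasM _ _ (bddmeasM _ _ (bddmeasM _ _ (bddmeasM _ _ bphi2 bphi2) bK) bphi1) bphi1.
  apply: bddmeas_int01; apply: bddmeasD => //; apply: bddmeasD; last exact: bddmeasM.
  apply: bddmeasD => //; apply: bddmeasD; last exact: bddmeasM.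
  by apply: bddmeasM => //; exact: bddmeasM.
have [c cgt0 Hgap] := gap; have [N3 phiN] := (bddmeas_prim _ _ Ph).2.
have N30 : 0 <= N3 by exact: le_trans (phiN 0 (lexx _) ler01).
(* [t <= 1] is needed for the second order bound, and [t N3 <= c] for admissibility on the end
   strips; adding 1 avoids a zero denominator. *)
pose t0 := Num.min 1 (c / (N3 + 1)).
have t00 : 0 < t0 by rewrite lt_min ltr01 divr_gt0// ltr_wpDl.
set L := Rint _ _ _.
have key t : 0 < t -> t <= t0 -> 0 <= t * L + t ^+ 2 * Rint 0 1 M.
  move=> tgt0 tt0.
  have t1 : t <= 1 by rewrite (le_trans tt0)// ge_min lexx.
  have tN : t * N3 <= c.
    apply: (@le_trans _ _ (c / (N3 + 1) * N3)).
      by rewrite ler_wpM2r// (le_trans tt0)// ge_min lexx orbT.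
    by rewrite mulrAC ler_pdivrMr ?ltr_wpDl// ler_wpM2l ?(ltW cgt0)// lerDl.
  pose v x := u x + t * phi x; pose pv x := p x + t * phi1 x; pose qv x := q x + t * phi2 x.
  have Vp : prim v pv by exact: primD Up (primZ t _ _ Ph).
  have Vq : prim pv qv by exact: primD Pq (primZ t _ _ Ph1).
  have vpq : H20_derivs v pv qv.
    split=> //; last by rewrite /v /pv u0 u1 p0 p1 ph0 ph1 ph10 ph11 !mulr0 !addr0.
    have q2p : int01 (fun x => q x * phi2 x) by exact: int01M qi bphi2.1 bphi2.2.
    have p22 : int01 (fun x => phi2 x * phi2 x) by apply: bddmeas_int01; exact: bddmeasM.
    apply: eq_int01 (int01D q2 (int01D (int01Z (2 * t) q2p) (int01Z (t ^+ 2) p22))) => x _ _.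
    by rewrite /qv; ring.
  have v_adm : admissible psi v.
    split; first by apply/H20P; exists pv, qv.
    move=> x x01; have ux := u_adm.2 x x01; move: x01; rewrite in_itv/= => /andP[x0 x1].
    have tphi : `|t * phi x| <= c.
      by rewrite normrM (gtr0_norm tgt0) (le_trans _ tN)// ler_wpM2l ?(ltW tgt0)// phiN.
    have [xd|xd] := leP x del.
      have := Hgap x x0 x1 (or_introl xd); move: tphi; rewrite ler_norml /v; lra.
    have [xd'|xd'] := leP (1 - del) x.
      have := Hgap x x0 x1 (or_intror xd'); move: tphi; rewrite ler_norml /v; lra.
    by rewrite (le_trans ux)// lerDl mulr_ge0 ?(ltW tgt0)// phge0// ltW.
  have Wle : Rint 0 1 (fun x => q x ^+ 2 * h (p x)) <= Rint 0 1 (fun x => qv x ^+ 2 * h (pv x)).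
    have : (elastica u <= elastica v)%E by rewrite u_min; apply: ereal_inf_lbound; exists v.
    by rewrite (elasticaE _ _ _ upq) (elasticaE _ _ _ vpq) lee_fin.
  have W1i : int01 (fun x => q x ^+ 2 * h (p x)) by exact: int01_comp q2 Pq lh.
  have W2i : int01 (fun x => qv x ^+ 2 * h (pv x)).
    by have [_ _ qv2 _] := vpq; exact: int01_comp qv2 Vq lh.
  have tLi := int01Z t Li; have tMi := int01Z (t ^+ 2) Mi.
  have Wge : Rint 0 1 (fun x => qv x ^+ 2 * h (pv x)) <=
      Rint 0 1 (fun x => q x ^+ 2 * h (p x)) + t * L + t ^+ 2 * Rint 0 1 M.
    rewrite -!RintZ// -!RintD//; last exact: int01D.
    apply: le_Rint => //; first by apply: int01D => //; exact: int01D.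
    move=> x x0 x1.
    apply: (second_order_bound (q x) (phi2 x) (phi1 x) (h (p x)) (h1 (p x)) K (h (pv x)) t
      (ltW tgt0) t1 K0).
    apply: HK.
      by rewrite (le_trans (pN x x0 x1))// lerDl (le_trans _ (phN x x0 x1)).
    rewrite (le_trans (ler_normD _ _))// lerD ?pN// normrM (gtr0_norm tgt0).
    by rewrite (le_trans _ (phN x x0 x1))// ler_piMl.
  by have := le_trans Wle Wge; rewrite -addrA lerDl.
rewrite leNgt; apply/negP => Lneg.
set m := Rint 0 1 M in key.
(* Chosen so that [t |m|] is less than half of [- L], which makes [L + t m] negative. *)
pose t := Num.min t0 (- L / (2 * (`|m| + 1))).
have m10 : 0 < 2 * (`|m| + 1) by rewrite mulr_gt0// ltr_wpDl.
have tgt0 : 0 < t by rewrite lt_min t00 divr_gt0// oppr_gt0.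
have := key t tgt0 (ltac:(by rewrite ge_min lexx)).
have tm : t * (2 * (`|m| + 1)) <= - L.
  by rewrite -ler_pdivlMr// ge_min lexx orbT.
rewrite (_ : t * L + t ^+ 2 * m = t * (L + t * m)); last by ring.
rewrite pmulr_rge0// => h2.
have : t * m <= t * `|m| by rewrite ler_wpM2l ?(ltW tgt0)// ler_norm.
have : 0 <= t * `|m| by rewrite mulr_ge0// ltW.
move: tm; rewrite mulrDr mulr1; lra.
Qed.

End variation.

(** * Regularity *)

Section regularity.
Context {R : realType}.
Local Notation mu := (@lebesgue_measure R).
Implicit Types (f g F G D m : R -> R) (x y z s a b c e : R).

(* A one-sided Lebesgue point. *)
Definition right_density D x : Prop := 0 < x < 1 /\
  forall e, 0 < e -> exists2 d : R, 0 < d & forall s, 0 < s -> s < d -> x + s <= 1 ->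
    `|Rint x (x + s) D - s * D x| <= e * s.

Lemma ae_right_density D : int01 D -> ae01 (right_density D).
Proof.
move=> Di.
have giT : mu.-integrable setT (EFin \o (D \_ `[0, 1])).
  by rewrite -restrict_EFin; apply/(integrable_mkcond _ _).1.
have giy : forall y : R, mu.-integrable [set` Interval (BLeft 0) (BRight y)]
    (EFin \o D \_ `[0, 1]) by move=> y; apply: integrableS giT.
have := @FTC1 R (D \_ `[0, 1]) (BLeft 0) giy (integrable_locally (measurable_itv _) Di).
apply: ae_sub => x Hx; rewrite in_itv/= => /andP[x0 x1]; split; first by rewrite x0.
have [dF] := Hx (ltac:(by rewrite (@lte_fin R))).
rewrite patchE mem_set/=; last by rewrite in_itv/= !ltW.
rewrite derive1E => DE e e0; move: (dF); rewrite /derivable -[lim _]/('D_1 _ x) DE.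
move=> /cvgrPdist_le/(_ e e0)[d /= d0 Hd]; exists d => // s s0 sd xs1.
have := Hd s; rewrite /= sub0r normrN gtr0_norm// => /(_ sd (lt0r_neq0 s0)).
rewrite -[s *: 1]/(s * 1) mulr1.
have FE y : 0 <= y -> y <= 1 ->
    \int[mu]_(t in [set` Interval (BLeft 0) (BRight y)]) (D \_ `[0, 1]) t = Rint 0 y D.
  move=> y0 y1; apply: eq_Rint => t t0 ty.
  by rewrite patchE mem_set//= in_itv/= t0 (le_trans ty).
rewrite !FE ?(ltW x0) ?(ltW x1)//; last 2 first.
- by rewrite addr_ge0// ltW.
- by rewrite addrC.
rewrite [s + x]addrC (Rint_cat D 0 (x + s) x)//; try lra.
rewrite addrAC subrr add0r -[_ *: _]/(_ * _) => h.
rewrite distrC; have -> : s * D x - Rint x (x + s) D = (D x - s^-1 * Rint x (x + s) D) * s.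
  by field; rewrite gt_eqF.
by rewrite normrM (gtr0_norm s0) ler_wpM2r// ltW.
Qed.

(** Division by [s] turns the integrals into averages, which tend to the values of [D] as [s] tends
    to 0. The same window length at all three points is essential. *)
Lemma density_second_difference D (w1 w2 w3 x1 x2 x3 : R) :
  0 <= w1 -> 0 <= w2 -> 0 <= w3 ->
  right_density D x1 -> right_density D x2 -> right_density D x3 ->
  (exists2 d : R, 0 < d & forall s, 0 < s -> s < d ->
    0 <= w1 * Rint x1 (x1 + s) D - w2 * Rint x2 (x2 + s) D + w3 * Rint x3 (x3 + s) D) ->
  0 <= w1 * D x1 - w2 * D x2 + w3 * D x3.
Proof.
move=> w10 w20 w30 [/andP[_ x11] H1] [/andP[_ x21] H2] [/andP[_ x31] H3] [d d0 H].
apply/ler_addgt0Pr => e e0.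
have W : 0 < w1 + w2 + w3 + 1 by lra.
have [d1 d10 {}H1] := H1 _ (divr_gt0 e0 W).
have [d2 d20 {}H2] := H2 _ (divr_gt0 e0 W).
have [d3 d30 {}H3] := H3 _ (divr_gt0 e0 W).
set e' := e / _ in H1 H2 H3.
have e'E : e' * (w1 + w2 + w3 + 1) = e by rewrite divfK// gt_eqF.
have e'0 : 0 < e' by exact: divr_gt0.
pose M := Num.min d (Num.min (Num.min d1 d2) (Num.min d3 (Num.min (1 - x1) (Num.min (1 - x2) (1 - x3))))).
have M0 : 0 < M by rewrite !lt_min d0 d10 d20 d30 !subr_gt0 x11 x21.
pose s := M / 2; have s0 : 0 < s by rewrite divr_gt0.
have : s < M by rewrite /s; lra.
rewrite !lt_min => /and5P[sd /andP[sd1 sd2] sd3 sx1 /andP[sx2 sx3]].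
have {}H := H s s0 sd.
have /ler_normlP[_ h1] := H1 s s0 sd1 (ltac:(lra)).
have /ler_normlP[h2 _] := H2 s s0 sd2 (ltac:(lra)).
have /ler_normlP[_ h3] := H3 s s0 sd3 (ltac:(lra)).
have k1 := ler_wpM2l w10 h1; have k2 := ler_wpM2l w20 h2; have k3 := ler_wpM2l w30 h3.
suff : 0 <= (w1 * D x1 - w2 * D x2 + w3 * D x3 + e) * s by rewrite pmulr_lge0.
have es := mulr_gt0 e'0 s0.
rewrite -e'E; move: H k1 k2 k3 es; clear; nra.
Qed.

(** At density points [k = 1] gives convexity. Near an end [k = - 1] is allowed as well and gives
    the opposite inequality, so [D] is affine there. *)
Lemma convex_increments D del : int01 D -> 0 < del -> del < 1 / 2 ->
  (forall e a b c k, 0 < e -> 0 <= a -> a < b -> b < c -> c + e <= 1 ->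
    (0 <= k \/ c + e <= del \/ 1 - del <= a) ->
    0 <= k * ((c - b) * Rint a (a + e) D - (c - a) * Rint b (b + e) D +
      (b - a) * Rint c (c + e) D)) ->
  exists d0 m, {homo m : x y / x <= y} /\ ae01 (fun x => D x = d0 + Rint 0 x m).
Proof.
move=> Di del0 del1 H; have aeO := ae_right_density _ Di; have dO := ae01_dense _ aeO.
have O01 x : right_density D x -> 0 < x < 1 by case.
have Hc a b c : right_density D a -> right_density D b -> right_density D c -> a < b -> b < c ->
    0 <= (c - b) * D a - (c - a) * D b + (b - a) * D c.
  move=> oa ob oc ab bc; apply: density_second_difference => //; try lra.
  have /andP[a0 _] := O01 a oa; have /andP[_ c1] := O01 c oc.
  exists (1 - c); first lra.
  move=> s s0 sc; have := H s a b c 1 s0 (ltW a0) ab bc (ltac:(lra)) (or_introl ler01).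
  by rewrite mul1r.
have Ha a b c : right_density D a -> right_density D b -> right_density D c -> a < b -> b < c ->
    c < del \/ 1 - del < a -> (c - b) * D a - (c - a) * D b + (b - a) * D c = 0.
  move=> oa ob oc ab bc ends; apply/le_anti; rewrite Hc// andbT -oppr_ge0.
  have oN x : right_density D x -> right_density (fun t => - 1 * D t) x.
    move=> [x01 Hx]; split=> // e e0; have [d d0 Hd] := Hx e e0; exists d => // s s0 sd xs.
    have /andP[x0 _] := x01.
    rewrite RintZ//; last lra.
    by rewrite mulrCA -mulrBr normrM normrN1 mul1r Hd.
  have -> : - ((c - b) * D a - (c - a) * D b + (b - a) * D c) =
    (c - b) * (- 1 * D a) - (c - a) * (- 1 * D b) + (b - a) * (- 1 * D c) by ring.
  apply: (density_second_difference (fun t => - 1 * D t)); try lra; try exact: oN.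
  have /andP[a0 _] := O01 a oa; have /andP[_ c1] := O01 c oc.
  (* Near 0 the window [[c, c + s]] must also stay inside the end strip; near 1 it only has to stay
     inside [0, 1]. *)
  exists (if c < del then Num.min (1 - c) (del - c) else 1 - c).
    by case: ifP => ?; rewrite ?lt_min; [apply/andP; split|]; lra.
  move=> s s0 sd.
  have sc : s < 1 - c by move: sd; case: ifP => // _; rewrite lt_min => /andP[].
  have := H s a b c (- 1) s0 (ltW a0) ab bc (ltac:(lra)).
  rewrite !RintZ//; try lra.
  have ends' : c + s <= del \/ 1 - del <= a.
    case: ends => [cd|ad]; last by right; lra.
    by left; move: sd; rewrite cd lt_min => /andP[]; lra.
  by move=> /(_ (or_intror ends')); lra.
have [m hm Hm] := convex_dense (right_density D) D del del0 del1 O01 dO Hc Ha.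
have HR := monotone_Rint (right_density D) D m dO hm (fun x y ox oy _ xy _ => Hm x y ox oy xy).
have mi := nondecreasing_int01 _ hm.
have [z oz /andP[z0 z1]] := dO 0 1 (lexx _) ltr01 (lexx _).
exists (D z - Rint 0 z m), m; split=> //.
apply: ae01_imp aeO => x x0 x1 ox.
have [xz|/ltW zx] := leP x z.
  have := HR x z ox oz (ltW x0) xz (ltW z1).
  rewrite (Rint_cat m 0 z x)//; try lra.
have := HR z x oz ox (ltW z0) zx (ltW x1).
rewrite (Rint_cat m 0 x z)//; lra.
Qed.

Definition lip01 f : Prop := exists2 L : R, 0 <= L &
  forall x y, 0 <= x -> x <= y -> y <= 1 -> `|f y - f x| <= L * (y - x).

Lemma prim_lip01 F f : prim F f -> bounded01 f -> lip01 F.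
Proof.
move=> [fi FE] [M fM]; exists M; first exact: le_trans (normr_ge0 _) (fM 0 (lexx _) ler01).
move=> x y x0 xy y1; rewrite FE// -Rint_cst//.
apply: (le_trans (normr_Rint _ _ _ fi x0 y1)).
apply: le_Rint => //; [exact: int01_norm|exact: int01_cst|].
by move=> t xt ty; apply: fM; lra.
Qed.

Lemma lip01_comp r F : loclip r -> bounded01 F -> lip01 F -> lip01 (r \o F).
Proof.
move=> lr [M FM] [L L0 FL]; have [K K0 HK] := lr M; exists (K * L); first exact: mulr_ge0.
move=> x y x0 xy y1; apply: (@le_trans _ _ (K * `|F y - F x|)); first by apply: HK; apply: FM; lra.
by rewrite -mulrA ler_wpM2l// FL.
Qed.

(** A Jordan decomposition. Nonnegativity at 0 makes both parts nonnegative on [0, 1], so that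
    products of parts are again monotone and the class is stable under multiplication. *)
Definition monotone_diff f : Prop := exists f1 f2 : R -> R,
  [/\ forall x y, 0 <= x -> x <= y -> y <= 1 -> f1 x <= f1 y /\ f2 x <= f2 y,
      0 <= f1 0, 0 <= f2 0 & forall x, 0 <= x -> x <= 1 -> f x = f1 x - f2 x].

Lemma monotone_diff_nondecreasing f : {homo f : x y / x <= y} -> monotone_diff f.
Proof.
move=> hf; exists (fun x => f x + `|f 0|), (cst `|f 0|); split=> //.
- by move=> x y _ xy _; rewrite lerD2r hf.
- by rewrite addrC -lerBlDr sub0r -normrN ler_norm.
- by move=> x _ _ /=; rewrite addrK.
Qed.

Lemma monotone_diff_lip f : lip01 f -> monotone_diff f.
Proof.
move=> [L L0 fL]; exists (fun x => f x + L * x + `|f 0|), (fun x => L * x + `|f 0|); split.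
- move=> x y x0 xy y1; have := fL x y x0 xy y1; rewrite ler_norml mulrBr => /andP[h1 h2].
  have := ler_wpM2l L0 xy; split; lra.
- by rewrite mulr0 addr0 addrC -lerBlDr sub0r -normrN ler_norm.
- by rewrite mulr0 add0r.
- by move=> x _ _; ring.
Qed.

Lemma monotone_diffD f g : monotone_diff f -> monotone_diff g ->
  monotone_diff (fun x => f x + g x).
Proof.
move=> [f1 [f2 [fh f10 f20 fE]]] [g1 [g2 [gh g10 g20 gE]]].
exists (fun x => f1 x + g1 x), (fun x => f2 x + g2 x); split; [|exact: addr_ge0|exact: addr_ge0|].
- move=> x y x0 xy y1; have [? ?] := fh x y x0 xy y1; have [? ?] := gh x y x0 xy y1.
  by split; exact: lerD.
- by move=> x x0 x1; rewrite fE// gE//; ring.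
Qed.

Lemma monotone_diffM f g : monotone_diff f -> monotone_diff g ->
  monotone_diff (fun x => f x * g x).
Proof.
move=> [f1 [f2 [fh f10 f20 fE]]] [g1 [g2 [gh g10 g20 gE]]].
exists (fun x => f1 x * g1 x + f2 x * g2 x), (fun x => f1 x * g2 x + f2 x * g1 x).
split; [|by rewrite addr_ge0// mulr_ge0|by rewrite addr_ge0// mulr_ge0|].
- move=> x y x0 xy y1; have [? ?] := fh x y x0 xy y1; have [? ?] := gh x y x0 xy y1.
  have [? ?] := fh 0 x (lexx _) x0 (ltac:(lra)); have [? ?] := gh 0 x (lexx _) x0 (ltac:(lra)).
  by split; apply: lerD; apply: ler_pM => //; lra.
- by move=> x x0 x1; rewrite fE// gE//; ring.
Qed.

Lemma monotone_diff_BV01 f g : ae01 (fun x => f x = g x) -> monotone_diff g -> BV01 f.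
Proof.
move=> fg [g1 [g2 [gh g10 g20 gE]]]; exists (g1 \+ (\- g2)); split.
  by apply: ae01_imp fg => x x0 x1 ->; rewrite gE// ltW.
exists ((g1 1 - g1 0) + (g2 1 - g2 0)) => a b a0 ab b1.
apply: (le_trans (total_variation_le _ _ ab)).
rewrite total_variationN EFinD; apply: leeD; rewrite nondecreasing_total_variation//.
- have [? _] := gh b 1 (ltac:(lra)) (ltac:(lra)) (lexx _).
  have [? _] := gh 0 a (lexx _) (ltac:(lra)) (ltac:(lra)).
  by rewrite lee_fin; lra.
- move=> x y; rewrite !in_itv/= => /andP[? ?] /andP[? ?] xy.
  by have [] := gh x y (ltac:(lra)) xy (ltac:(lra)).
- have [_ ?] := gh b 1 (ltac:(lra)) (ltac:(lra)) (lexx _).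
  have [_ ?] := gh 0 a (lexx _) (ltac:(lra)) (ltac:(lra)).
  by rewrite lee_fin; lra.
- move=> x y; rewrite !in_itv/= => /andP[? ?] /andP[? ?] xy.
  by have [] := gh x y (ltac:(lra)) xy (ltac:(lra)).
Qed.

Lemma prim_is_derive F f : prim F f -> {within `[0, 1], continuous f} ->
  forall x, 0 < x -> x < 1 -> is_derive x (1 : R) F (f x).
Proof.
move=> [fi FE] cf x x0 x1.
have cx : {for x, continuous f}.
  by apply: within_continuous_continuous ltr01 cf _; rewrite in_itv/= x0.
have [dx E] := @continuous_FTC1_closed R f 0 x 1 x1 fi x0 cx.
have dI : is_derive x (1 : R) (fun y => F 0 + Rint 0 y f) (f x).
  have dR : is_derive x (1 : R) (fun y => Rint 0 y f) (f x).
    by rewrite -E derive1E; exact: derivableP.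
  by have := is_derive_add _ _ _ _ _ (is_derive_cst (F 0) x (1 : R)) dR; rewrite add0r.
apply: near_eq_is_derive dI; near=> y.
have y0 : 0 < y by near: y; exact: lt_nbhsr.
have y1 : y < 1 by near: y; exact: lt_nbhsl.
by rewrite -(FE 0 y (lexx _) (ltW y0) (ltW y1)) addrC subrK.
Unshelve. all: by end_near. Qed.

End regularity.

(** * Convexity and bootstrap for a minimizer *)

Section minimizer.
Context {R : realType}.
Local Notation mu := (@lebesgue_measure R).
Implicit Types (f g F G m : R -> R) (x y z s a b c e : R).

Lemma Rint_heaviside_window f a e : int01 f -> 0 <= a -> 0 <= e -> a + e <= 1 ->
  int01 (fun x => f x * (heaviside (x - a) - heaviside (x - (a + e)))) /\
  Rint 0 1 (fun x => f x * (heaviside (x - a) - heaviside (x - (a + e)))) = Rint a (a + e) f.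
Proof.
move=> fi a0 e0 ae1.
have [i1 E1] := Rint_heaviside f a fi a0 (ltac:(lra)).
have [i2 E2] := Rint_heaviside f (a + e) fi (ltac:(lra)) ae1.
split; first by apply: eq_int01 (int01B i1 i2) => x _ _; rewrite mulrBr.
rewrite (eq_Rint _ (fun x => f x * heaviside (x - a) - f x * heaviside (x - (a + e)))); last first.
  by move=> x _ _; rewrite mulrBr.
by rewrite RintB// E1 E2 (Rint_cat f a 1 (a + e))//; [ring|lra].
Qed.

(* For F = bump2 e this is a nonnegative function supported in [a, c + e], whose second derivative
   is a combination of three indicators of intervals of length e: testing the first variation with
   it makes the second differences of D nonnegative. *)
Definition second_diff (F : R -> R) a b c x : R :=
  (c - b) * F (x - a) - (c - a) * F (x - b) + (b - a) * F (x - c).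

(** Convexity of [bump2 e]: in the subgradient inequalities at [x - b], the weights [c - b] and
    [b - a] make the linear terms cancel. *)
Lemma second_diff_bump2_ge0 e a b c x : 0 < e -> a < b -> b < c ->
  0 <= second_diff (bump2 e) a b c x.
Proof.
move=> e0 ab bc.
have h1 := bump2_subgrad e (x - b) (x - a) e0; have h2 := bump2_subgrad e (x - b) (x - c) e0.
have k1 : 0 <= c - b by lra.
have k2 : 0 <= b - a by lra.
have := ler_wpM2l k1 h1; have := ler_wpM2l k2 h2; rewrite /second_diff; lra.
Qed.

Lemma second_diff_left (F : R -> R) a b c x : (forall y, y <= 0 -> F y = 0) ->
  a < b -> b < c -> x <= a -> second_diff F a b c x = 0.
Proof. by move=> F0 ab bc xa; rewrite /second_diff !F0; [ring|lra|lra|lra]. Qed.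

Lemma second_diff_bump2_right e a b c x : 0 < e -> a < b -> b < c -> c + e <= x ->
  second_diff (bump2 e) a b c x = 0.
Proof. by move=> e0 ab bc cx; rewrite /second_diff !bump2_lin//; [field|lra|lra|lra]. Qed.

Lemma second_diff_bump1_right e a b c x : 0 < e -> a < b -> b < c -> c + e <= x ->
  second_diff (bump1 e) a b c x = 0.
Proof. by move=> e0 ab bc cx; rewrite /second_diff !bump1_cst//; [ring|lra|lra|lra]. Qed.

Lemma prim_second_diff_bump2 e a b c : 0 < e ->
  prim (second_diff (bump2 e) a b c) (second_diff (bump1 e) a b c).
Proof.
move=> e0; have P y := prim_bump2 e y e0.
exact: primD (primB _ _ _ _ (primZ (c - b) _ _ (P a)) (primZ (c - a) _ _ (P b))) (primZ (b - a) _ _ (P c)).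
Qed.

Lemma prim_second_diff_bump1 e a b c : prim (second_diff (bump1 e) a b c)
  (fun x => (c - b) * (heaviside (x - a) - heaviside (x - (a + e))) -
    (c - a) * (heaviside (x - b) - heaviside (x - (b + e))) +
    (b - a) * (heaviside (x - c) - heaviside (x - (c + e)))).
Proof.
have P y := prim_bump1 e y.
exact: primD (primB _ _ _ _ (primZ (c - b) _ _ (P a)) (primZ (c - a) _ _ (P b))) (primZ (b - a) _ _ (P c)).
Qed.

Variables (psi u p q : R -> R) (del : R).
Hypothesis upq : H20_derivs u p q.
Hypothesis u_adm : admissible psi u.
Hypothesis u_min : elastica u = inf_elastica psi.
Hypotheses (del0 : 0 < del) (del1 : del < 1 / 2).
Hypothesis gap : exists2 c : R, 0 < c & forall x, 0 <= x -> x <= 1 -> x <= del \/ 1 - del <= x ->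
  psi x + c <= u x.

Let h s : R := pw (- (5 / 2)) s.
Let h1 s : R := (- 5) * (s * pw (- (7 / 2)) s).
(** The reciprocal of [2 h], by which [2 u'' h(p)] is solved for u''. *)
Let kappa s : R := 2^-1 * pw (5 / 2) s.
Let kappa' s : R := (5 / 2) * (s * pw (3 / 2) s).

Let is_derive_kappa s : is_derive s (1 : R) kappa (kappa' s).
Proof.
apply: is_derive_ext (is_derive_scale _ _ _ _ (is_derive_pw (5 / 2) s)) _.
by rewrite /kappa' (_ : 5 / 2 - 1 = 3 / 2); [field|lra].
Qed.

Let B x := q x ^+ 2 * h1 (p x).
Let beta x := Rint 0 x B.
(* Integrating by parts the terms containing phi', the first variation in a direction phi vanishing
   to first order at 0 and 1 is int D phi''. *)
Let D x := 2 * q x * h (p x) - beta x.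

Let Pq : prim p q. Proof. by case: upq. Qed.

Let Bi : int01 B.
Proof. by have [_ _ q2 _] := upq; exact: int01_comp q2 Pq (loclip_idpw _ _). Qed.

Let Pbeta : prim beta B. Proof. exact: prim_Rint. Qed.

Let Ai : int01 (fun x => 2 * q x * h (p x)).
Proof.
by apply: eq_int01 (int01Z 2 (int01_comp _ _ _ _ Pq.1 Pq (loclip_pw (- (5 / 2))))) => x _ _; rewrite mulrA.
Qed.

Let Di : int01 D.
Proof. exact: int01B Ai (within01_int01 (prim_continuous Pbeta)). Qed.

(** The first variation is tested with [k * second_diff (bump2 e) a b c x]. Its sign matters only
    between the end strips: there it is nonnegative if [k] is, and zero if the support [[a, c + e]]
    lies in one strip. *)
Lemma second_difference e a b c k : 0 < e -> 0 <= a -> a < b -> b < c -> c + e <= 1 ->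
  (0 <= k \/ c + e <= del \/ 1 - del <= a) ->
  0 <= k * ((c - b) * Rint a (a + e) D - (c - a) * Rint b (b + e) D +
      (b - a) * Rint c (c + e) D).
Proof.
move=> e0 a0 ab bc ce kk.
have K2 := primZ k _ _ (prim_second_diff_bump2 e a b c e0).
have K1 := primZ k _ _ (prim_second_diff_bump1 e a b c).
set phi2 := (X in prim _ X) in K1.
have bphi2 : bounded01 phi2.
  exists (`|k| * (`|c - b| + `|c - a| + `|b - a|)) => x _ _.
  have H y : `|heaviside (x - y) - heaviside (x - (y + e))| <= 1.
    by rewrite /heaviside; do 2 case: ifP => _; rewrite ?subrr ?subr0 ?sub0r ?normrN ?normr1 ?normr0.
  have M w y : `|w * (heaviside (x - y) - heaviside (x - (y + e)))| <= `|w|.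
    by rewrite normrM ler_piMr.
  rewrite normrM ler_wpM2l// (le_trans (ler_normD _ _))// lerD//.
  by rewrite (le_trans (ler_normB _ _))// lerD.
have l0 (F : R -> R) : (forall y, y <= 0 -> F y = 0) -> k * second_diff F a b c 0 = 0.
  by move=> F0; rewrite second_diff_left ?mulr0.
have r2 : k * second_diff (bump2 e) a b c 1 = 0 by rewrite second_diff_bump2_right ?mulr0.
have r1 : k * second_diff (bump1 e) a b c 1 = 0 by rewrite second_diff_bump1_right ?mulr0.
have pos x : 0 <= x -> x <= 1 -> del <= x -> x <= 1 - del -> 0 <= k * second_diff (bump2 e) a b c x.
  move=> _ _ dx xd; case: kk => [k0|[cd|ad]].
  - by rewrite mulr_ge0// second_diff_bump2_ge0.
  - by rewrite second_diff_bump2_right ?mulr0//; exact: le_trans cd dx.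
  - rewrite second_diff_left ?mulr0//; last exact: le_trans xd ad.
    by move=> y; exact: bump2_eq0.
have [Li L0] := first_variation psi u p q del upq u_adm u_min gap _ _ _ K2 K1 bphi2
  (l0 _ (fun y => bump2_eq0 e y e0)) r2 (l0 _ (fun y => bump1_eq0 e y e0)) r1 pos.
(* Integration by parts without boundary terms: the integrals of [B phi1] and [beta phi2] add up to
   0, since [phi1] vanishes at 0 and 1. *)
have [_ E0] := primM _ _ _ _ Pbeta K1.
have {E0} := E0 0 1 (lexx _) ler01 (lexx _).
rewrite second_diff_bump1_right// second_diff_left//; last by move=> y; exact: bump1_eq0.
rewrite !mulr0 subrr => E0.
have Dphi : Rint 0 1 (fun x => D x * phi2 x) = k * ((c - b) * Rint a (a + e) D -
    (c - a) * Rint b (b + e) D + (b - a) * Rint c (c + e) D).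
  have [i1 E1] := Rint_heaviside_window D a e Di (ltac:(lra)) (ltac:(lra)) (ltac:(lra)).
  have [i2 E2] := Rint_heaviside_window D b e Di (ltac:(lra)) (ltac:(lra)) (ltac:(lra)).
  have [i3 E3] := Rint_heaviside_window D c e Di (ltac:(lra)) (ltac:(lra)) (ltac:(lra)).
  rewrite -E1 -E2 -E3 -!RintZ//; try exact: int01Z.
  rewrite -RintB//; try exact: int01Z.
  rewrite -RintD//; [|by apply: int01B; exact: int01Z|exact: int01Z].
  rewrite -RintZ//; last by apply: int01D; [apply: int01B|]; exact: int01Z.
  by apply: eq_Rint => x _ _; rewrite /phi2; ring.
rewrite -Dphi; have [I0 _] := primM _ _ _ _ Pbeta K1.
rewrite (_ : Rint 0 1 (fun x => D x * phi2 x) = Rint 0 1 (fun x => D x * phi2 x) +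
  Rint 0 1 (fun x => B x * (k * second_diff (bump1 e) a b c x) + beta x * phi2 x)); last first.
  by rewrite -E0 addr0.
rewrite -RintD//; last by apply: int01M => //; exact: int01_measurable K1.1.
apply: (le_trans L0); rewrite le_eqVlt; apply/orP; left; apply/eqP.
by apply: eq_Rint => x _ _; rewrite /D /B /h /h1; ring.
Qed.

(** A bootstrap in two passes. The first uses only the integrability of [B] and replaces [q] by the
    continuous [qs]. The second replaces [B] by the bounded [Bs], which makes [p] and [Astar]
    Lipschitz; in the density of [qs], only [m] may then jump. *)
Lemma regular_second_derivative : exists qs g, [/\ prim p qs, prim qs g & monotone_diff g].
Proof.
have [d0 [m [hm Dm]]] := convex_increments D del Di del0 del1 second_difference.
have mi := nondecreasing_int01 _ hm; have Pm := prim_Rint _ mi.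
(* [Astar] is the absolutely continuous representative of [D + beta], that is of [2 u'' h(p)]. *)
pose Astar x := beta x + (d0 + Rint 0 x m); pose qs x := Astar x * kappa (p x).
have PA : prim Astar (fun x => B x + m x) by exact: primD Pbeta (prim_shift d0 _ _ Pm).
have lk' : loclip kappa' := loclip_idpw _ _.
have Pk := prim_comp _ _ _ _ is_derive_kappa lk' Pq.
have cqs : {within `[0, 1], continuous qs} := prim_continuous (primM _ _ _ _ PA Pk).
have qsi := within01_int01 cqs.
have qqs : ae01 (fun x => q x = qs x).
  apply: ae01_imp Dm => x _ _ Dx.
  have -> : qs x = (D x + beta x) * kappa (p x) by rewrite Dx /qs /Astar; ring.
  have : h (p x) * pw (5 / 2) (p x) = 1 by rewrite /h pwM addNr /pw powRr0.
  rewrite /D /kappa subrK => hk.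
  rewrite (_ : _ * _ = q x * (h (p x) * pw (5 / 2) (p x))); last by field.
  by rewrite hk mulr1.
have Ppqs : prim p qs.
  split=> // x y x0 xy y1; have [qi pE] := Pq.
  by rewrite pE//; exact: ae_Rint.
pose Bs x := qs x ^+ 2 * h1 (p x).
have bm1 := bddmeas_prim _ _ (primM _ _ _ _ PA Pk).
have bmh1 : bddmeas (fun x => h1 (p x)) := bddmeas_comp _ _ _ Pq (loclip_idpw _ _).
have bmBs : bddmeas Bs by exact: bddmeasM (bddmeasM _ _ bm1 bm1) bmh1.
have PAs : prim Astar (fun x => Bs x + m x).
  split; first by apply: int01D => //; exact: bddmeas_int01.
  move=> x y x0 xy y1; have [i E] := PA; rewrite E//.
  apply: ae_Rint => //; first by apply: ae01_imp qqs => t _ _ tE; rewrite /B /Bs tE.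
  by apply: int01D => //; exact: bddmeas_int01.
have Pks := prim_comp _ _ _ _ is_derive_kappa lk' Ppqs.
have Pqsg := primM _ _ _ _ PAs Pks.
have bmm := nondecreasing_bddmeas _ hm.
have lipp : lip01 p := prim_lip01 _ _ Ppqs bm1.2.
have lipA : lip01 Astar := prim_lip01 _ _ PAs (bddmeasD _ _ bmBs bmm).2.
have bp := (bddmeas_prim _ _ Pq).2.
have lip_p r : loclip r -> monotone_diff (fun x => r (p x)).
  by move=> lr; apply: monotone_diff_lip; exact: lip01_comp lr bp lipp.
have lkappa : loclip kappa.
  move=> N; have [L L0 HL] := loclip_pw (5 / 2) N; exists (2^-1 * L); first by rewrite mulr_ge0.
  by move=> s t sN tN; rewrite -mulrBr normrM gtr0_norm// -mulrA ler_wpM2l// HL.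
have dA : monotone_diff Astar by exact: monotone_diff_lip.
have dq : monotone_diff qs by apply: monotone_diffM => //; exact: lip_p.
exists qs, (fun x => (Bs x + m x) * kappa (p x) + Astar x * (qs x * kappa' (p x))).
split=> //; apply: monotone_diffD; apply: monotone_diffM => //.
- apply: monotone_diffD; last exact: monotone_diff_nondecreasing.
  by apply: monotone_diffM; [exact: monotone_diffM|exact: lip_p (loclip_idpw _ _)].
- exact: lip_p.
- by apply: monotone_diffM => //; exact: lip_p.
Qed.

End minimizer.

Lemma minimizer_regular (R : realType) (psi u : R -> R)
    (psi_cont : {within `[0, 1], continuous psi})
    (psi0 : psi 0 < 0) (psi1 : psi 1 < 0) :
  admissible psi u -> elastica u = inf_elastica psi ->
  [/\ Ck 2 u, weakly_differentiable (derive1n 2 u) & BV01 (wderiv (derive1n 2 u))].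
Proof.
move=> u_adm u_min; have [p [q upq]] := (H20P u).1 u_adm.1.
have [Up Pq _ [u0 u1 _ _]] := upq.
have cu := prim_continuous Up; have cp := prim_continuous Pq.
(* A third of the depth of the obstacle at the ends: near an end, [psi] may rise by [c] and [u] may
   fall by [c], and a gap [c] remains. *)
pose c := Num.min (- psi 0) (- psi 1) / 3.
have [c0' cpsi0 cpsi1] : [/\ 0 < c, psi 0 <= - 3 * c & psi 1 <= - 3 * c].
  have m0 : 0 < Num.min (- psi 0) (- psi 1) by rewrite lt_min !oppr_gt0 psi0.
  have m1 : Num.min (- psi 0) (- psi 1) <= - psi 0 by rewrite ge_min lexx.
  have m2 : Num.min (- psi 0) (- psi 1) <= - psi 1 by rewrite ge_min lexx orbT.
  by rewrite /c; split; lra.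
have near_end t : 0 <= t <= 1 -> psi t <= - 3 * c -> u t = 0 -> exists2 d : R, 0 < d &
    forall x, 0 <= x <= 1 -> `|x - t| < d -> psi x + c <= u x.
  move=> t01 pt ut.
  have [d1 d10 H1] := (within01P psi).1 psi_cont t t01 c c0'.
  have [d2 d20 H2] := (within01P u).1 cu t t01 c c0'.
  exists (Num.min d1 d2); first by rewrite lt_min d10.
  move=> x x01; rewrite lt_min => /andP[xd1 xd2].
  have := H1 x x01 xd1; have := H2 x x01 xd2; rewrite !ltr_norml ut => /andP[? ?] /andP[? ?].
  lra.
have [d1 d10 H1] := near_end 0 (ltac:(by rewrite lexx ler01)) cpsi0 u0.
have [d2 d20 H2] := near_end 1 (ltac:(by rewrite lexx ler01)) cpsi1 u1.
(* Halving makes the inequalities strict, so that the closed end strips lie where the gap estimates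
   hold. *)
pose del := Num.min (1 / 2) (Num.min d1 d2) / 2.
have [del0 del12 deld1 deld2] : [/\ 0 < del, del < 1 / 2, del < d1 & del < d2].
  have m0 : 0 < Num.min (1 / 2) (Num.min d1 d2) by rewrite !lt_min d10 d20 divr_gt0.
  have : Num.min (1 / 2) (Num.min d1 d2) <= 1 / 2 by rewrite ge_min lexx.
  have : Num.min (1 / 2) (Num.min d1 d2) <= d1 by rewrite !ge_min lexx orbT.
  have : Num.min (1 / 2) (Num.min d1 d2) <= d2 by rewrite !ge_min lexx !orbT.
  by rewrite /del; split; lra.
have gap : exists2 c : R, 0 < c & forall x, 0 <= x -> x <= 1 -> x <= del \/ 1 - del <= x ->
    psi x + c <= u x.
  exists c => // x x0 x1 [xd|xd].
    by apply: H1; [rewrite x0|rewrite subr0 ger0_norm//; lra].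
  by apply: H2; [rewrite x0|rewrite ler0_norm ?subr_le0//; lra].
have [qs [g [Ppqs Pqsg dg]]] :=
  regular_second_derivative psi u p q del upq u_adm u_min del0 del12 gap.
have cqs := prim_continuous Pqsg.
have du := prim_is_derive _ _ Up cp; have dp := prim_is_derive _ _ Ppqs cqs.
(* The iterated derivative is taken of the total function [u], so it is identified with [qs] only
   inside the open interval, where [derive1 u] equals [p] in a neighbourhood of each point. *)
have du2 x : 0 < x -> x < 1 -> derive1n 2 u x = qs x.
  move=> x0 x1; rewrite /derive1n/= derive1E.
  suff H : is_derive x (1 : R) (derive1 u) (qs x) by rewrite derive_val.
  apply: near_eq_is_derive (dp x x0 x1); near=> y.
  have y0 : 0 < y by near: y; exact: lt_nbhsr.
  have y1 : y < 1 by near: y; exact: lt_nbhsl.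
  by rewrite derive1E; have := du y y0 y1 => H; rewrite derive_val.
have d2i : int01 (derive1n 2 u).
  apply/int01_oo; apply: eq_integrable ((int01_oo qs).2 (within01_int01 cqs)) => //.
  move=> x; rewrite inE/= in_itv/= => /andP[x0 x1].
  exact: (congr1 EFin (esym (du2 x x0 x1))).
have w2 : weak_derivative (derive1n 2 u) g.
  apply: eq_weak_derivative (prim_weak_derivative _ _ Pqsg); last exact: locally_integrable01.
  by apply: nearW => x; rewrite in_itv => /andP[x0 x1]; exact: esym (du2 x x0 x1).
split.
- split=> //; exists p; first by move=> x; rewrite in_itv/= => /andP[x0 x1]; exact: du.
  split=> //; exists qs => //; by move=> x; rewrite in_itv/= => /andP[x0 x1]; exact: dp.
- by exists g.
- exact: monotone_diff_BV01 (wderiv_ae _ _ w2) dg.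
Unshelve. all: by end_near. Qed.

Theorem theorem2p19 (R : realType) (psi : R -> R)
    (psi_cont : {within `[0, 1], continuous psi})
    (psi0 : psi 0 < 0) (psi1 : psi 1 < 0)
    (psi_pos : exists2 x0 : R, x0 \in `]0, 1[ & 0 < psi x0)
    (inf_lt : (inf_elastica psi < (c0 R ^+ 2)%:E)%E) :
  exists u : R -> R,
    [/\ admissible psi u,
        elastica u = inf_elastica psi,
        Ck 2 u,
        weakly_differentiable (derive1n 2 u) &
        BV01 (wderiv (derive1n 2 u))].
Proof.
have [u u_adm u_min] := minimizer_exists psi inf_lt.
have [H1 H2 H3] := minimizer_regular R psi u psi_cont psi0 psi1 u_adm u_min.
by exists u; split.
Qed.
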